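(* Let $(M,\omega)$ be a symplectic manifold of dimension $2n$ and $0\le p\le n$. Let $\mathcal F_p=\bigoplus_{j=0}^{2n+2p+1}\mathcal F_p^j$ be the graded space of $p$-filtered forms, with $m_1$ the differential $d_j:\mathcal F_p^j\to\mathcal F_p^{j+1}$, with $m_2=\times$ the filtered product, with $m_3$ the trilinear map given by $$m_3(A_i,A_j,A_k)=\Pi^p*_r\Big[A_i\wedge L^{-(p+1)}(A_j\wedge A_k)-L^{-(p+1)}(A_i\wedge A_j)\wedge A_k\Big]\in\overline{F^p\Omega^{2n+2p+2-i-j-k}}$$ for $A_i,A_j,A_k\in F^p\Omega^*$ with $i+j+k\ge n+p+2$, and $m_3=0$ on all other triples of homogeneous elements (i.e. if $i+j+k<n+p+2$ or if at least one argument lies in some $\overline{F^p\Omega^*}$), and with $m_k=0$ for all $k\ge4$. Then $(\mathcal F_p,m_1,m_2,m_3,0,0,\dots)$ is an $A_\infty$-algebra. Consequently the cohomology $F^pH=H(\mathcal F_p,m_1)$, with the product induced by $\times$, is a ring.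
   Context: $\Omega^k$ denotes the smooth real $k$-forms on $M$ (zero for $k<0$ or $k>2n$), and $L(A)=\omega\wedge A$. For $0\le s\le n$, $\mathcal P^s=\{B\in\Omega^s: L^{n+1-s}B=0\}$ is the space of primitive $s$-forms; set $\mathcal P^s=0$ for other $s$. Every $A_k\in\Omega^k$ has a unique Lefschetz decomposition $A_k=\sum_{\max(0,k-n)\le r\le\lfloor k/2\rfloor}L^rB_{k-2r}$ with $B_{k-2r}\in\mathcal P^{k-2r}$. Reflection: $*_r$ is the linear operator with $*_r(L^rB_s)=L^{n-r-s}B_s$ for $B_s\in\mathcal P^s$, $0\le r\le n-s$. Negative powers: for $q>0$, $L^{-q}A_k=\sum_{r\ge q}L^{r-q}B_{k-2r}$. Projection: $\Pi^p A_k=\sum_{r\le p}L^rB_{k-2r}$. Filtered forms: $F^p\Omega^k=\Pi^p\Omega^k$ (nonzero only for $0\le k\le n+p$; $F^p\Omega^{n+p}=L^p\mathcal P^{n-p}$). Operators $\partial_\pm$: for $B_s\in\mathcal P^s$ write uniquely $dB_s=\partial_+B_s+\omega\wedge\partial_-B_s$ with $\partial_\pm B_s\in\mathcal P^{s\pm1}$, and set $\partial_\pm(L^rB_s)=L^r\partial_\pm B_s$. Operators $d_\pm$: $d_+=\Pi^p\circ d:F^p\Omega^k\to F^p\Omega^{k+1}$ and $d_-=*_r\,d\,*_r:F^p\Omega^k\to F^p\Omega^{k-1}$. Graded space: $\mathcal F_p^j=F^p\Omega^j$ for $0\le j\le n+p$ and $\mathcal F_p^{2n+2p+1-j}=\overline{F^p\Omega^j}$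 for $0\le j\le n+p$, where $\overline{F^p\Omega^j}$ is a second copy of $F^p\Omega^j$ whose elements are written $\bar A_j$; $\mathcal F_p^j=0$ for other $j$. Differential: $d_j=d_+$ for $0\le j<n+p$; $d_{n+p}=-\partial_+\partial_-:F^p\Omega^{n+p}\to\overline{F^p\Omega^{n+p}}$; $d_j=-d_-$ for $n+p+1\le j\le2n+2p+1$. Product $\times:\mathcal F_p^j\otimes\mathcal F_p^k\to\mathcal F_p^{j+k}$: for $j+k\le n+p$, $A_j\times A_k=\Pi^p(A_j\wedge A_k)\in F^p\Omega^{j+k}$; for $j+k>n+p$, $A_j\times A_k=\Pi^p*_r\big[-d\,L^{-(p+1)}(A_j\wedge A_k)+(L^{-(p+1)}dA_j)\wedge A_k+(-1)^jA_j\wedge(L^{-(p+1)}dA_k)\big]\in\overline{F^p\Omega^{2n+2p+1-j-k}}$; $A_j\times\bar A_k=(-1)^j*_r\big(A_j\wedge( *_r\bar A_k)\big)\in\overline{F^p\Omega^{k-j}}$; $\bar A_j\times A_k=*_r\big(( *_r\bar A_j)\wedge A_k\big)\in\overline{F^p\Omega^{j-k}}$; $\bar A_j\times\bar A_k=0$. $A_\infty$-algebra: a $\mathbb Z$-graded vector space $\mathcal A$ with graded maps $m_k:\mathcal A^{\otimes k}\to\mathcal A$ of degree $2-k$ ($k\ge1$) such that for each $k\ge1$ $$\sum_{r+s+t=k,\ r,t\ge0,\ s>0}(-1)^{r+st}\,m_{r+t+1}\big(\mathbf 1^{\otimes r}\otimes m_s\otimes\mathbf 1^{\otimes t}\big)=0,$$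 with the Koszul sign convention $(\varphi_1\otimes\varphi_2)(v_1\otimes v_2)=(-1)^{|\varphi_2||v_1|}\varphi_1(v_1)\otimes\varphi_2(v_2)$. *)

(* Defs.v *)
(* MathComp-Analysis, over an arbitrary R : realType.                         *)
From HB Require Import structures.
From mathcomp Require Import all_boot all_order all_algebra.
From mathcomp Require Import all_classical all_reals all_analysis.

Set Implicit Arguments.
Unset Strict Implicit.
Unset Printing Implicit Defensive.

Import Order.TTheory GRing.Theory Num.Theory.
Import numFieldNormedType.Exports.

Local Open Scope classical_set_scope.
Local Open Scope ring_scope.

Section Smooth.
Context {R : realType} {m : nat}.

Definition pderiv (a : 'I_m) (f : 'rV[R]_m -> R^o) : 'rV[R]_m -> R^o :=
  'D_(delta_mx 0 a) f.

(* All partial derivatives of order <= k exist and are continuous on U        *)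
(* (used for open U only).                                                    *)
Fixpoint class_C (k : nat) (U : set 'rV[R]_m) (f : 'rV[R]_m -> R^o) : Prop :=
  (forall u, U u -> {for u, continuous f}) /\
  if k is k'.+1 then
    forall a : 'I_m, (forall u, U u -> derivable f u (delta_mx 0 a)) /\
                     class_C k' U (pderiv a f)
  else True.

Definition smooth_on (U : set 'rV[R]_m) (f : 'rV[R]_m -> R^o) : Prop :=
  forall k, class_C k U f.

End Smooth.

(* Smooth m-manifolds without boundary, given by a smooth atlas.  The maps    *)
(* cmap i and cinv i are total functions that are only meaningful on          *)
(* chart_dom i and on its image.                                              *)
Record manifold (R : realType) (m : nat) := Manifold {
  carrier :> topologicalType ;
  chart : Type ;
  chart_dom : chart -> set carrier ;
  cmap : chart -> carrier -> 'rV[R]_m ;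
  cinv : chart -> 'rV[R]_m -> carrier ;
  manifold_hausdorff : hausdorff_space carrier ;
  manifold_second_countable : @second_countable carrier ;
  dom_open : forall i, open (chart_dom i) ;
  dom_cover : forall x, exists i, chart_dom i x ;
  image_open : forall i, open (cmap i @` chart_dom i) ;
  cmapK : forall i x, chart_dom i x -> cinv i (cmap i x) = x ;
  cmap_continuous : forall i, {within chart_dom i, continuous (cmap i)} ;
  cinv_continuous : forall i,
    {within cmap i @` chart_dom i, continuous (cinv i)} ;
  transition_smooth : forall i j (b : 'I_m),
    smooth_on (cmap i @` (chart_dom i `&` chart_dom j))
              (fun u => cmap j (cinv i u) 0 b)
}.

(* The exterior algebra of the dual of R^m: a is the covector                 *)
(* \sum_S a S *: dx_S, where dx_S = dx_(i_1) /\ ... /\ dx_(i_k) for           *)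
(* S = {i_1 < ... < i_k}.                                                     *)
Definition ext (R : realType) (m : nat) := {ffun {set 'I_m} -> R^o}.

Section Exterior.
Context {R : realType} {m : nat}.
Implicit Types (S T U : {set 'I_m}) (a b : ext R m).

Definition ebase S : ext R m := [ffun T => (T == S)%:R].

(* dx_S /\ dx_T = shuffle_sign S T *: dx_(S :|: T) for disjoint S and T.      *)
Definition shuffle_sign S T : R :=
  (-1) ^+ #|[set x : 'I_m * 'I_m |
              [&& x.1 \in S, x.2 \in T & x.2 < x.1]%N]%SET|.

Definition ewedge a b : ext R m :=
  [ffun U : {set 'I_m} => \sum_(S : {set 'I_m} | S \subset U)
               shuffle_sign S (U :\: S) * a S * b (U :\: S)].

(* The algebra map with dx_b |-> \sum_c J c b *: dx_c.                        *)
Definition epull (J : 'M[R]_m) a : ext R m :=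
  \sum_(S : {set 'I_m}) a S *:
    \big[ewedge/ebase finset.set0]_(b <- enum S)
      \sum_(c < m) J c b *: ebase (finset.set1 c).

(* The value on (v, w) of the degree 2 part of a.                             *)
Definition eval2 a (v w : 'rV[R]_m) : R :=
  \sum_(b < m) \sum_(c < m | (b < c)%N)
    a (b |: finset.set1 c)%SET * (v 0 b * w 0 c - v 0 c * w 0 b).

End Exterior.

(* Families of local expressions, one for each chart, in the coordinates of   *)
(* the chart; the differential forms are singled out by [dform] below.        *)
Definition chart_family (R : realType) (m : nat) (M : manifold R m) :=
  chart M -> 'rV[R]_m -> ext R m.

HB.instance Definition _ (R : realType) (m : nat) (M : manifold R m) :=
  GRing.Lmodule.copy (chart_family M) (chart M -> 'rV[R]_m -> ext R m).

Section Forms.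
Context {R : realType} {m : nat} {M : manifold R m}.
Implicit Types (A B : chart_family M).

Definition image_dom (i : chart M) : set 'rV[R]_m := cmap i @` chart_dom i.

(* Omega^k: smooth local expressions, homogeneous of degree k, that           *)
(* correspond to each other under pullback by the transition maps.  They are  *)
(* normalized to be 0 outside the image of the chart, so that two forms are   *)
(* equal iff the underlying families are.  Here 'J f u c b is the c-th        *)
(* partial derivative of the b-th component of f.                             *)
Definition dform (k : int) : set (chart_family M) := [set A : chart_family M |
  [/\ forall i u, ~ image_dom i u -> A i u = 0,
      forall i S, smooth_on (image_dom i) (fun u => A i u S),
      forall i j x, chart_dom i x -> chart_dom j x ->
        A i (cmap i x) =
        epull ('J (cmap j \o cinv i) (cmap i x)) (A j (cmap j x)) &
      forall i u (S : {set 'I_m}), #|S|%:Z != k -> A i u S = 0]].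

Definition wedge A B : chart_family M := fun i u => ewedge (A i u) (B i u).

Definition extd A : chart_family M := fun i u =>
  if u \in image_dom i then
    \sum_(a < m) ewedge (ebase (finset.set1 a))
                        [ffun S => pderiv a (fun v => A i v S) u]
  else 0.

Definition symplectic (omega : chart_family M) : Prop :=
  [/\ dform 2 omega, extd omega = 0 &
      forall i u, image_dom i u -> forall v : 'rV[R]_m,
        (forall w, eval2 (omega i u) v w = 0) -> v = 0].

End Forms.

Section Lefschetz.
Context {R : realType} {n : nat} {M : manifold R n.*2} (omega : chart_family M).
Implicit Types (A B : chart_family M) (p q r s : nat).

Definition Lop A : chart_family M := wedge omega A.
Definition Lpow r A : chart_family M := iter r Lop A.

Definition primitive (s : int) : set (chart_family M) :=
 [set B : chart_family M |
  if 0 <= s <= n%:Z then dform s B /\ Lpow `|n.+1%:Z - s|%N B = 0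
  else B = 0].

(* The decomposition A = \sum_(r, s) L^r B_(r, s), B_(r, s) in P^s, of a      *)
(* possibly inhomogeneous form A.  In degree k the only terms are those with  *)
(* 2r + s = k, and r + s <= n is then the condition k - n <= r; hence the     *)
(* operators below need no degree argument.                                   *)
Definition lefschetz_dec A (B : nat -> nat -> chart_family M) : Prop :=
  [/\ forall r s, (r + s <= n)%N -> primitive s (B r s),
      forall r s, (n < r + s)%N -> B r s = 0 &
      A = \sum_(s < n.+1) \sum_(r < (n - s).+1) Lpow r (B r s)].

Definition lef A : nat -> nat -> chart_family M :=
  xget (fun _ _ => 0) [set B | lefschetz_dec A B].

Definition star A : chart_family M :=
  \sum_(s < n.+1) \sum_(r < (n - s).+1) Lpow (n - r - s) (lef A r s).

Definition Lneg q A : chart_family M :=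
  \sum_(s < n.+1) \sum_(r < (n - s).+1 | (q <= r)%N) Lpow (r - q) (lef A r s).

Definition filt_proj p A : chart_family M :=
  \sum_(s < n.+1) \sum_(r < (n - s).+1 | (r <= p)%N) Lpow r (lef A r s).

Definition filtered p (k : int) : set (chart_family M) :=
  filt_proj p @` dform k.

Definition del_pair (s : int) B : chart_family M * chart_family M :=
  xget (0, 0) [set X | [/\ primitive (s + 1) X.1, primitive (s - 1) X.2 &
                           extd B = X.1 + Lop X.2]].

Definition del_plus A : chart_family M :=
  \sum_(s < n.+1) \sum_(r < (n - s).+1) Lpow r (del_pair s (lef A r s)).1.

Definition del_minus A : chart_family M :=
  \sum_(s < n.+1) \sum_(r < (n - s).+1) Lpow r (del_pair s (lef A r s)).2.

Definition d_plus p A : chart_family M := filt_proj p (extd A).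
Definition d_minus A : chart_family M := star (extd (star A)).

End Lefschetz.

(* The graded space F_p and its operations.  A homogeneous element is a pair  *)
(* (j, A) made of its degree j in F_p and of a form A: for j <= n + p it is   *)
(* A itself, in F^p Omega^j; for j > n + p it is the barred copy of A, in     *)
(* F^p Omega^(2n+2p+1-j).                                                     *)
Section FilteredAlgebra.
Context {R : realType} {n : nat} {M : manifold R n.*2}.
Variables (omega : chart_family M) (p : nat).
Implicit Types (x y z : int * chart_family M).

Local Notation star := (star omega).
Local Notation filt_proj := (filt_proj omega p).
Local Notation Lneg := (Lneg omega p.+1).

Definition unbarred (j : int) : bool := j <= (n + p)%N%:Z.

Definition Fp (j : int) : set (chart_family M) :=
  if 0 <= j <= (n + p)%N%:Z then filtered omega p j
  else if (n + p)%N%:Z < j <= (2 * n + 2 * p + 1)%N%:Z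
       then filtered omega p ((2 * n + 2 * p + 1)%N%:Z - j)
  else [set 0].

Definition Fp_m1 x : chart_family M :=
  let: (j, A) := x in
  if j < (n + p)%N%:Z then d_plus omega p A
  else if j == (n + p)%N%:Z then - del_plus omega (del_minus omega A)
  else - d_minus omega A.

Definition Fp_m2 x y : chart_family M :=
  let: (j, A) := x in
  let: (k, B) := y in
  match unbarred j, unbarred k with
  | true, true =>
      if j + k <= (n + p)%N%:Z then filt_proj (wedge A B)
      else filt_proj (star (- extd (Lneg (wedge A B))
                            + wedge (Lneg (extd A)) B
                            + ((-1) ^ j : R) *: wedge A (Lneg (extd B))))
  | true, false => ((-1) ^ j : R) *: star (wedge A (star B))
  | false, true => star (wedge (star A) B)
  | false, false => 0
  end.

Definition Fp_m3 x y z : chart_family M :=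
  let: (i, A) := x in
  let: (j, B) := y in
  let: (k, C) := z in
  if [&& unbarred i, unbarred j, unbarred k & (n + p + 2)%N%:Z <= i + j + k]
  then filt_proj (star (wedge A (Lneg (wedge B C))
                        - wedge (Lneg (wedge A B)) C))
  else 0.

Definition Fp_m (xs : seq (int * chart_family M)) : chart_family M :=
  match xs with
  | [:: x] => Fp_m1 x
  | [:: x; y] => Fp_m2 x y
  | [:: x; y; z] => Fp_m3 x y z
  | _ => 0
  end.

End FilteredAlgebra.

(* A Z-graded vector space is given by subspaces gr j of an ambient vector    *)
(* space V; it is their external direct sum, so they need not be independent  *)
(* in V.  The list [:: (d_1, v_1); ...; (d_k, v_k)], with v_i in gr d_i,      *)
(* stands for v_1 (x) ... (x) v_k, and m_k is the restriction of m to lists   *)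
(* of length k.                                                               *)
Section Ainfinity.
Context {R : fieldType} {V : lmodType R}.
Variables (gr : int -> set V) (m : seq (int * V) -> V).

Definition subspaces : Prop := forall j,
  gr j 0 /\ forall (c : R) x y, gr j x -> gr j y -> gr j (c *: x + y).

Definition homogeneous (xs : seq (int * V)) : Prop :=
  forall x, x \in xs -> gr x.1 x.2.

Definition degree (xs : seq (int * V)) : int := \sum_(x <- xs) x.1.

Definition multilinear : Prop :=
  forall xs ys j (c : R) v w, homogeneous xs -> homogeneous ys ->
    gr j v -> gr j w ->
    m (xs ++ (j, c *: v + w) :: ys)
    = c *: m (xs ++ (j, v) :: ys) + m (xs ++ (j, w) :: ys).

(* The value of 1^(r) (x) m_s (x) 1^(t) on xs, without its Koszul sign.       *)
Definition insert_m (r s : nat) (xs : seq (int * V)) : seq (int * V) :=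
  let mid := take s (drop r xs) in
  take r xs ++ (degree mid + 2 - s%:Z, m mid) :: drop (r + s) xs.

(* The first sign is (-1)^(r + st); the second one is the Koszul sign of      *)
(* moving m_s, of degree 2 - s, past the first r arguments.                   *)
Definition stasheff (xs : seq (int * V)) : Prop :=
  \sum_(r < size xs) \sum_(1 <= s < (size xs - r).+1)
    ((-1) ^+ (r + s * (size xs - r - s)) : R) *:
    (((-1) ^ ((2 - s%:Z) * degree (take r xs)) : R) *: m (insert_m r s xs))
  = 0.

Definition Ainfty_algebra : Prop :=
  [/\ subspaces,
      forall xs, (0 < size xs)%N -> homogeneous xs ->
        gr (degree xs + 2 - (size xs)%:Z) (m xs),
      multilinear &
      forall xs, (0 < size xs)%N -> homogeneous xs -> stasheff xs].

(* Elements of the direct sum of the gr j, and the maps m_1, m_2 on them.     *)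
Definition gr_total : set (int -> V) :=
  [set z | finite_set [set j | z j != 0] /\ forall j, gr j (z j)].

Definition total_m1 (z : int -> V) : int -> V :=
  fun j => m [:: (j - 1, z (j - 1))].

Definition total_m2 (z w : int -> V) : int -> V :=
  fun l => \sum_(j \in [set: int]) m [:: (j, z j); (l - j, w (l - j))].

Definition cocycle : set (int -> V) := [set z | gr_total z /\ total_m1 z = 0].
Definition coboundary : set (int -> V) := total_m1 @` gr_total.

(* The quotient group cocycle / coboundary, with the product induced by m_2,  *)
(* is a ring: cl is the projection onto the quotient.                         *)
Definition cohomology_is_ring : Prop :=
  coboundary `<=` cocycle /\
  exists (H : pzRingType) (cl : (int -> V) -> H),
    [/\ forall h, exists2 z, cocycle z & cl z = h,
        forall z w, cocycle z -> cocycle w -> cl (z + w) = cl z + cl w,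
        forall z, cocycle z -> (cl z = 0 <-> coboundary z) &
        forall z w, cocycle z -> cocycle w ->
          cocycle (total_m2 z w) /\ cl (total_m2 z w) = cl z * cl w].

End Ainfinity.

(* Main.v *)
(* Wedge with W = omega^(p+1) commutes with d, so its cone carries a dga
   structure.  By the hard Lefschetz theorem H = L^-(p+1) satisfies W H W = W and
   H W H = H; hence 1 - W H = Pi^p projects onto a complement of the image of W,
   and 1 - H W = *_r Pi^p *_r onto its kernel.  Reading a barred form through *_r
   identifies F_p with coker W (+) ker W, and m_1, m_2, m_3 become the structure
   transferred from the cone along H.  In this model the Stasheff relations only
   use the Leibniz rule, d^2 = 0, the identities for H and W, and the fact that
   multiplication and d commute with W.

   Hard Lefschetz is proved pointwise: the contraction Lambda with the inverse of
   omega satisfies [Lambda, L] = n - j on j-forms, and sl_2 theory gives existence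
   and uniqueness of the Lefschetz decomposition.  Since Lambda is built from the
   smooth inverse of the matrix of omega, the components are smooth; they agree on
   overlaps of charts by uniqueness. *)

Require Import Defs.
From HB Require Import structures.
From mathcomp Require Import all_boot all_order all_algebra.
From mathcomp Require Import reals.
From mathcomp Require Import ring lra zify.

Set Implicit Arguments.
Unset Strict Implicit.
Unset Printing Implicit Defensive.

Import Order.TTheory GRing.Theory Num.Theory.

Local Open Scope ring_scope.

(** * Exterior algebra *)

Section ExteriorAlgebra.
Context {R : realType} {m : nat}.
Implicit Types (S T U : {set 'I_m}) (x y z : ext R m) (a b c : 'I_m) (k : R).

(** The definition of F_p branches on the degree, the cone does not. What reconciles them is that
    Pi^p kills all degrees above n + p, while the projector onto the kernel of W kills all degrees
    below n - p. A pair with a cokernel and a kernel component is thus automatically concentrated in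
    the right one, and a single formula covers every case of m_1, m_2 and m_3; the bound n + p + 2
    for m_3 is the same vanishing. The middle map is - d H d cut down to the kernel of W and read
    through the reflection. Composing m_3 with itself gives 0, because m_3 lands in the kernel part
    and depends only on cokernel parts. The operators of the statement are total functions that
    choose a Lefschetz decomposition, so their linearity is available on genuine forms only; the
    algebra is therefore done in a module of finite sums of homogeneous forms. Signs depend on
    parities alone, hence the [bool] parity in the abstract transfer. *)

Definition ninv S T : nat := \sum_(i in S) \sum_(j in T) (j < i)%N.

(** Counting inversions by a double sum makes the exponent additive in S and in T, which is what the
    sign computations below use. *)
Lemma shuffle_signE S T : shuffle_sign S T = (-1) ^+ ninv S T :> R.
Proof.
congr (_ ^+ _); rewrite /ninv pair_big_dep /= -sum1_card.
rewrite [RHS]big_mkcond [LHS]big_mkcond /=; apply: eq_bigr => -[i j] _ /=.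
by rewrite inE /=; case: (i \in S); case: (j \in T); case: (j < i)%N.
Qed.

Lemma ninvUl S1 S2 T : [disjoint S1 & S2] ->
  ninv (S1 :|: S2) T = (ninv S1 T + ninv S2 T)%N.
Proof.
by move=> d; rewrite /ninv -bigU //; apply: eq_bigl => i; rewrite !inE.
Qed.

Lemma ninvUr S T1 T2 : [disjoint T1 & T2] ->
  ninv S (T1 :|: T2) = (ninv S T1 + ninv S T2)%N.
Proof.
move=> d; rewrite /ninv -big_split /=; apply: eq_bigr => i _; rewrite -bigU //.
by apply: eq_bigl => j; rewrite !inE.
Qed.

Lemma ninv11 a b : ninv [set a] [set b] = (b < a)%N.
Proof. by rewrite /ninv !big_set1. Qed.

(** A pair with one element in each of two disjoint sets is an inversion in exactly one of the two
    orders. *)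
Lemma ninv_comm S T : [disjoint S & T] ->
  (ninv S T + ninv T S)%N = (#|S| * #|T|)%N.
Proof.
move=> d; rewrite /ninv [X in (_ + X)%N]exchange_big -big_split /=.
transitivity (\sum_(i in S) \sum_(j in T) 1)%N; last first.
  by under eq_bigr do rewrite sum1_card; rewrite sum_nat_const.
apply: eq_bigr => i iS; rewrite -big_split /=.
apply: eq_bigr => j jT; case: ltngtP => // /val_inj ij.
by move: (disjointFr d iS); rewrite ?ij ?jT -?ij ?jT.
Qed.

Lemma shuffle_sign_sq S T : shuffle_sign S T * shuffle_sign S T = 1 :> R.
Proof. by rewrite shuffle_signE -expr2 sqrr_sign. Qed.

Lemma extP x y : (forall S, x S = y S) -> x = y.
Proof. by move=> /ffunP. Qed.

Lemma ext_sumE x : x = \sum_S x S *: ebase S.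
Proof.
apply: extP => T; rewrite sum_ffunE (bigD1 T) //= big1 ?addr0.
  by rewrite !ffunE eqxx [_ *: _]mulr1.
by move=> S ST; rewrite !ffunE eq_sym (negbTE ST) [_ *: _]mulr0.
Qed.

(** Reduces multilinear identities to the basis covectors. *)
Lemma ext_ind (P : ext R m -> Prop) : P 0 ->
  (forall k x y, P x -> P y -> P (k *: x + y)) ->
  (forall S, P (ebase S)) -> forall x, P x.
Proof.
move=> P0 PD PS x; rewrite (ext_sumE x); elim/big_ind: _ => //.
  by move=> y z Py Pz; rewrite -[y]scale1r; exact: PD.
by move=> S _; rewrite -[_ *: _]addr0; exact: PD.
Qed.

Lemma ewedgeDl x y z : ewedge (x + y) z = ewedge x z + ewedge y z.
Proof.
apply: extP => S; rewrite !ffunE -big_split; apply: eq_bigr => T _ /=.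
by rewrite ffunE mulrDr mulrDl.
Qed.

Lemma ewedgeDr x y z : ewedge x (y + z) = ewedge x y + ewedge x z.
Proof.
apply: extP => S; rewrite !ffunE -big_split; apply: eq_bigr => T _ /=.
by rewrite ffunE mulrDr.
Qed.

Lemma ewedgeZl k x y : ewedge (k *: x) y = k *: ewedge x y.
Proof.
apply: extP => S; rewrite !ffunE scaler_sumr; apply: eq_bigr => T _ /=.
by rewrite ffunE -[RHS]/(k * _) -[k *: _]/(k * _) mulrCA -!mulrA.
Qed.

Lemma ewedgeZr k x y : ewedge x (k *: y) = k *: ewedge x y.
Proof.
apply: extP => S; rewrite !ffunE scaler_sumr; apply: eq_bigr => T _ /=.
by rewrite ffunE -[RHS]/(k * _) -[k *: _]/(k * _) mulrCA.
Qed.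

Lemma ewedge0l y : ewedge 0 y = 0.
Proof. by rewrite -(scale0r 0) ewedgeZl !scale0r. Qed.

Lemma ewedge0r x : ewedge x 0 = 0.
Proof. by rewrite -(scale0r 0) ewedgeZr !scale0r. Qed.

Lemma ewedgeNl x y : ewedge (- x) y = - ewedge x y.
Proof. by rewrite -scaleN1r ewedgeZl scaleN1r. Qed.

Lemma ewedgeNr x y : ewedge x (- y) = - ewedge x y.
Proof. by rewrite -scaleN1r ewedgeZr scaleN1r. Qed.

Lemma ewedge_suml (I : Type) (s : seq I) (P : pred I) (F : I -> ext R m) y :
  ewedge (\sum_(i <- s | P i) F i) y = \sum_(i <- s | P i) ewedge (F i) y.
Proof. exact: (big_morph (ewedge^~ y) (fun u v => ewedgeDl u v y) (ewedge0l y)). Qed.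

Lemma ewedge_sumr (I : Type) (s : seq I) (P : pred I) (F : I -> ext R m) x :
  ewedge x (\sum_(i <- s | P i) F i) = \sum_(i <- s | P i) ewedge x (F i).
Proof. exact: (big_morph (ewedge x) (ewedgeDr x) (ewedge0r x)). Qed.

Lemma ewedge_ebase S T : ewedge (ebase S) (ebase T) =
  if [disjoint S & T] then (shuffle_sign S T : R) *: ebase (S :|: T) else 0.
Proof.
apply: extP => U; rewrite ffunE.
transitivity (if (S \subset U) && (U :\: S == T)
              then shuffle_sign S T else 0 : R).
  rewrite big_mkcond /= (bigD1 S) //= big1 ?addr0.
    rewrite !ffunE eqxx; case: ifP => //= _.
    by case: eqP => [->|_]; rewrite ?mulr1 ?mulr0.
  by move=> S' S'S; rewrite ffunE (negbTE S'S) mulr0 mul0r; case: ifP.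
(* Only the term indexed by S survives, and it requires U to be the disjoint union of S and T. *)
have -> : (S \subset U) && (U :\: S == T) = [disjoint S & T] && (U == S :|: T).
  apply/andP/andP => [[SU /eqP <-]|[d /eqP ->]]; split.
  - by rewrite disjoint_sym disjoints_subset setDE subsetIr.
  - by rewrite setDE setUIr setUCr setIT; move/setUidPr: SU => ->.
  - exact: subsetUl.
  - rewrite setDUl setDv set0U; apply/eqP/setDidPl.
    by rewrite disjoint_sym.
by case: [disjoint S & T] => /=; rewrite !ffunE //; case: eqP; rewrite /GRing.scale /= ?mulr1 ?mulr0.
Qed.

Lemma disjoint_setUl S T U :
  [disjoint S :|: T & U] = [disjoint S & U] && [disjoint T & U].
Proof. by rewrite -!setI_eq0 setIUl setU_eq0. Qed.

(** On basis covectors both sides vanish unless the three index sets are pairwise disjoint; then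
    both exponents count the inversions of the pairs (S, T), (S, U) and (T, U). *)
Lemma ewedgeA x y z : ewedge x (ewedge y z) = ewedge (ewedge x y) z.
Proof.
move: x; apply: ext_ind => [|k x x' Hx Hx'|S].
- by rewrite !ewedge0l.
- by rewrite !(ewedgeDl, ewedgeZl) Hx Hx'.
move: y; apply: ext_ind => [|k x x' Hx Hx'|T].
- by rewrite ewedge0r !ewedge0l ewedge0r.
- by rewrite !(ewedgeDl, ewedgeZl, ewedgeDr, ewedgeZr) Hx Hx'.
move: z; apply: ext_ind => [|k x x' Hx Hx'|U].
- by rewrite !ewedge0r.
- by rewrite !(ewedgeDl, ewedgeZl, ewedgeDr, ewedgeZr) Hx Hx'.
rewrite !ewedge_ebase.
have [dST|nST] := boolP [disjoint S & T]; last first.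
  rewrite ewedge0l; case: ifP => _; rewrite ?ewedge0r // ewedgeZr ewedge_ebase.
  rewrite disjoint_sym disjoint_setUl !(disjoint_sym _ S) (negbTE nST).
  by rewrite scaler0.
have [dTU|nTU] := boolP [disjoint T & U]; last first.
  rewrite ewedge0r ewedgeZl ewedge_ebase disjoint_setUl (negbTE nTU) andbF.
  by rewrite scaler0.
rewrite ewedgeZl ewedgeZr !ewedge_ebase disjoint_setUl dTU andbT.
rewrite disjoint_sym disjoint_setUl (disjoint_sym T) dST /= (disjoint_sym U).
case: ifP => dSU; last by rewrite !scaler0.
rewrite !scalerA setUA; congr (_ *: _).
rewrite !shuffle_signE -!exprD ninvUl // ninvUr //; congr (_ ^+ _).
lia.
Qed.

Lemma ewedge1x x : ewedge (ebase set0) x = x.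
Proof.
move: x; apply: ext_ind => [|k x x' Hx Hx'|S].
- by rewrite ewedge0r.
- by rewrite ewedgeDr ewedgeZr Hx Hx'.
rewrite ewedge_ebase disjoint_sym disjoints_subset setC0 subsetT set0U.
by rewrite shuffle_signE /ninv big_set0 scale1r.
Qed.

Lemma ewedgex1 x : ewedge x (ebase set0) = x.
Proof.
move: x; apply: ext_ind => [|k x x' Hx Hx'|S].
- by rewrite ewedge0l.
- by rewrite ewedgeDl ewedgeZl Hx Hx'.
rewrite ewedge_ebase disjoints_subset setC0 subsetT setU0.
by rewrite shuffle_signE /ninv big1 ?scale1r // => i _; rewrite big_set0.
Qed.

Lemma ebaseC S T : ewedge (ebase S) (ebase T) =
  ((-1) ^+ (#|S| * #|T|) : R) *: ewedge (ebase T) (ebase S).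
Proof.
rewrite !ewedge_ebase (disjoint_sym T); case: ifP => d; last by rewrite scaler0.
rewrite scalerA setUC -ninv_comm // !shuffle_signE exprD -mulrA.
by rewrite -expr2 sqrr_sign mulr1.
Qed.

(** The pointwise form of the degree condition in [dform]. Degrees are integers, so operators that
    lower the degree need no case distinction. *)
Definition homog (j : int) x := forall S, #|S|%:Z != j -> x S = 0.

Lemma homog0 j : homog j 0.
Proof. by move=> S _; rewrite ffunE. Qed.

Lemma homogP j k x y : homog j x -> homog j y -> homog j (k *: x + y).
Proof.
move=> hx hy S Sj; rewrite !ffunE (hx S Sj) (hy S Sj) addr0.
exact: (mulr0 k).
Qed.

Lemma homog_sum j (I : Type) (s : seq I) (P : pred I) (F : I -> ext R m) :
  (forall i, P i -> homog j (F i)) -> homog j (\sum_(i <- s | P i) F i).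
Proof.
move=> hF; elim/big_ind: _ => //; first exact: homog0.
by move=> x y hx hy; rewrite -[x]scale1r; exact: homogP.
Qed.

Lemma homog_ewedge i j x y : homog i x -> homog j y ->
  homog (i + j) (ewedge x y).
Proof.
move=> hx hy U hU; rewrite ffunE big1 // => S SU.
case: (eqVneq #|S|%:Z i) => [Si|/hx ->]; last by rewrite mulr0 mul0r.
case: (eqVneq #|U :\: S|%:Z j) => [Tj|/hy ->]; last by rewrite mulr0.
case/negP: hU; rewrite -Si -Tj -PoszD; apply/eqP; congr Posz.
by rewrite -(cardsID S U) (setIidPr SU).
Qed.

Lemma homog_ebase S : homog #|S| (ebase S).
Proof. by move=> T; rewrite ffunE; have [->|//] := eqVneq T S; rewrite eqxx. Qed.

Lemma homog_ind (P : ext R m -> Prop) (j : int) : P 0 ->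
  (forall k x y, P x -> P y -> P (k *: x + y)) ->
  (forall S, #|S|%:Z = j -> P (ebase S)) -> forall x, homog j x -> P x.
Proof.
move=> P0 PD PS x hx; rewrite (ext_sumE x); elim/big_ind: _ => //.
  by move=> y z Py Pz; rewrite -[y]scale1r; exact: PD.
move=> S _; case: (eqVneq #|S|%:Z j) => [Sj|/hx ->]; last by rewrite scale0r.
by rewrite -[_ *: _]addr0; apply: PD => //; exact: PS.
Qed.

Lemma homog_comm i j x y : homog i x -> homog j y ->
  ewedge x y = ((-1) ^ (i * j) : R) *: ewedge y x.
Proof.
move=> hx hy; move: x hx; apply: homog_ind => [|k x x' Hx Hx'|S Si].
- by rewrite ewedge0l ewedge0r scaler0.
- rewrite ewedgeDl ewedgeZl Hx Hx' ewedgeDr ewedgeZr scalerDr !scalerA.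
  by rewrite [k * _]mulrC.
move: y hy; apply: homog_ind => [|k y y' Hy Hy'|T Tj].
- by rewrite ewedge0l ewedge0r scaler0.
- rewrite ewedgeDr ewedgeZr Hy Hy' ewedgeDl ewedgeZl scalerDr !scalerA.
  by rewrite [k * _]mulrC.
by rewrite ebaseC -Si -Tj -PoszM.
Qed.

Lemma homog_large j x : (m%:Z < j) -> homog j x -> x = 0.
Proof.
move=> mj hx; apply: extP => S; rewrite ffunE; apply: hx.
by rewrite lt_eqF // (le_lt_trans _ mj) // lez_nat -[leqRHS]card_ord max_card.
Qed.

Lemma homog_neg j x : j < 0 -> homog j x -> x = 0.
Proof.
move=> j0 hx; apply: extP => S; rewrite ffunE; apply: hx.
by rewrite gt_eqF // (lt_le_trans j0).
Qed.

End ExteriorAlgebra.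

(** Gives access to the big operator lemmas for the ordered products in [epull]. *)
HB.instance Definition _ (R : realType) (m : nat) :=
  Monoid.isLaw.Build (ext R m) (ebase set0) ewedge
    (@ewedgeA R m) (@ewedge1x R m) (@ewedgex1 R m).

(** * Pullback of covectors along a matrix *)

Section Pullback.
Context {R : realType} {m : nat} (J : 'M[R]_m).
Implicit Types (S T U : {set 'I_m}) (x y z : ext R m) (a b c : 'I_m) (k : R).

Definition theta b : ext R m := \sum_(c < m) J c b *: ebase [set c].

Definition thetas S : ext R m := \big[ewedge/ebase set0]_(b <- enum S) theta b.

Lemma homog_theta b : homog 1 (theta b).
Proof.
apply: homog_sum => c _; rewrite -[_ *: _]addr0; apply: homogP.
  by have := @homog_ebase R m [set c]; rewrite cards1.
exact: homog0.
Qed.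

Lemma thetaC a b : ewedge (theta a) (theta b) = - ewedge (theta b) (theta a).
Proof. by rewrite (homog_comm (@homog_theta a) (@homog_theta b)) scaleN1r. Qed.

Lemma theta_sq b : ewedge (theta b) (theta b) = 0.
Proof.
have /eqP := thetaC b b; rewrite -addr_eq0 -mulr2n -scaler_nat.
by rewrite scaler_eq0 pnatr_eq0 /= => /eqP.
Qed.

Lemma homog_thetas S : homog #|S| (thetas S).
Proof.
rewrite /thetas cardE; elim: (enum S) => [|b l IH].
  by rewrite big_nil; have := @homog_ebase R m set0; rewrite cards0.
rewrite big_cons /= -add1n PoszD.
exact: homog_ewedge (homog_theta b) IH.
Qed.

(** Each factor crossed contributes one sign. The product runs over a list filtered by S, so that
    the enumeration can be cut at any place. *)
Lemma theta_move b S (l : seq 'I_m) :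
  ewedge (theta b) (\big[ewedge/ebase set0]_(i <- l | i \in S) theta i) =
  (-1) ^+ count (mem S) l *:
    ewedge (\big[ewedge/ebase set0]_(i <- l | i \in S) theta i) (theta b).
Proof.
elim: l => [|i l IH]; first by rewrite big_nil ewedge1x ewedgex1 scale1r.
rewrite big_cons /=; case: ifP => iS; rewrite ?add0n //.
rewrite ewedgeA thetaC ewedgeNl -ewedgeA IH ewedgeZr ewedgeA.
by rewrite exprS mulN1r scaleNr.
Qed.

(** In the increasing enumeration the factor [theta b] belongs right after the elements of S below
    b; moving it there costs one sign per such element, and these are the inversions. If b lies in
    S, the square of [theta b] appears. *)
Lemma theta_thetas b S : ewedge (theta b) (thetas S) =
  if b \in S then 0 else (shuffle_sign [set b] S : R) *: thetas (b |: S).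
Proof.
rewrite /thetas /enum_mem !big_filter -enumT.
have : pairwise (fun i j : 'I_m => (i < j)%N) (enum 'I_m).
  rewrite -(pairwise_map (@nat_of_ord m) ltn) val_enum_ord.
  by rewrite -sorted_pairwise ?iota_ltn_sorted //; exact: ltn_trans.
have bs : b \in enum 'I_m by rewrite mem_enum.
have cnt : ninv [set b] S = (\sum_(j <- enum 'I_m) (j \in S) * (j < b))%N.
  by rewrite /ninv big_set1 big_mkcond /= enumT; apply: eq_bigr => j _;
    case: (j \in S); rewrite ?mul1n.
(* Cut the enumeration at b: [p1] lies below b and [p2] above. *)
move: cnt; case/splitPr: bs => p1 p2 cnt.
rewrite pairwise_cat allrel_consr /= => /and4P[/andP[p1b _] _ bp2 _].
have cnt1 : ninv [set b] S = count (mem S) p1.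
  rewrite cnt big_cat big_cons /= ltnn muln0 add0n.
  rewrite [X in (_ + X)%N]big1_seq ?addn0; last first.
    move=> j /= jp2; move/allP: bp2 => /(_ j jp2) /= bj.
    by rewrite ltnNge (ltnW bj) muln0.
  rewrite -sum1_count [RHS]big_mkcond big_seq [RHS]big_seq.
  apply: eq_bigr => j jp1; rewrite (allP p1b j jp1) muln1.
  by rewrite -[j \in S]/(mem S j); case: (mem S j).
have Q p : (b \notin p) ->
    \big[ewedge/ebase set0]_(i <- p | i \in b |: S) theta i =
    \big[ewedge/ebase set0]_(i <- p | i \in S) theta i.
  move=> bp; rewrite big_seq_cond [RHS]big_seq_cond; apply: eq_bigl => i.
  rewrite in_setU1; case: eqVneq => // ->; rewrite (negbTE bp) //.
have bp1 : b \notin p1.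
  by apply/negP => /(allP p1b); rewrite ltnn.
have bp2' : b \notin p2.
  by apply/negP => /(allP bp2); rewrite ltnn.
rewrite !big_cat !big_cons /= setU11 !Q //.
rewrite ewedgeA theta_move shuffle_signE cnt1 ewedgeZl -ewedgeA.
case: ifP => bS //.
by rewrite (ewedgeA (theta b)) theta_sq ewedge0l ewedge0r scaler0.
Qed.

Lemma epull_is_linear k x y :
  epull J (k *: x + y) = k *: epull J x + epull J y.
Proof.
rewrite /epull scaler_sumr -big_split; apply: eq_bigr => S _ /=.
by rewrite !ffunE scalerDl scalerA.
Qed.

Lemma epull0 : epull J 0 = 0.
Proof. by rewrite /epull big1 // => S _; rewrite ffunE scale0r. Qed.

Lemma epullZ k x : epull J (k *: x) = k *: epull J x.
Proof. by rewrite -[_ *: x]addr0 epull_is_linear epull0 addr0. Qed.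

Lemma epullD x y : epull J (x + y) = epull J x + epull J y.
Proof. by rewrite -[x]scale1r epull_is_linear !scale1r. Qed.

Lemma epull_sum (I : Type) (s : seq I) (P : pred I) (F : I -> ext R m) :
  epull J (\sum_(i <- s | P i) F i) = \sum_(i <- s | P i) epull J (F i).
Proof. exact: (big_morph (epull J) epullD epull0). Qed.

Lemma epullE x : epull J x = \sum_S x S *: thetas S.
Proof. by []. Qed.

Lemma epull_ebase S : epull J (ebase S) = thetas S.
Proof.
rewrite epullE (bigD1 S) //= big1 ?addr0 => [|T TS]; rewrite ffunE.
  by rewrite eqxx scale1r.
by rewrite (negbTE TS) scale0r.
Qed.

Lemma homog_epull j x : homog j x -> homog j (epull J x).
Proof.
move: x; apply: homog_ind => [|k x y hx hy|S <-].
- by rewrite epull0; exact: homog0.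
- by rewrite epull_is_linear; exact: homogP.
- by rewrite epull_ebase; exact: homog_thetas.
Qed.

Lemma ebaseU1 b S : b \notin S ->
  ebase (b |: S) = (shuffle_sign [set b] S : R) *: ewedge (ebase [set b]) (ebase S).
Proof.
move=> bS; rewrite ewedge_ebase disjoints1 bS scalerA.
by rewrite shuffle_sign_sq scale1r.
Qed.

Lemma epull_ebase1_wedge b x :
  epull J (ewedge (ebase [set b]) x) = ewedge (theta b) (epull J x).
Proof.
move: x; apply: ext_ind => [|k x y Hx Hy|S].
- by rewrite epull0 !ewedge0r epull0.
- by rewrite epull_is_linear !(ewedgeDr, ewedgeZr) epull_is_linear Hx Hy.
rewrite ewedge_ebase disjoints1 epull_ebase theta_thetas.
by case: (b \in S) => /=; rewrite ?epull0 // epullZ epull_ebase.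
Qed.

Lemma epull1 : epull J (ebase set0) = ebase set0.
Proof. by rewrite epull_ebase /thetas enum_set0 big_nil. Qed.

(** Induction on the size of S, peeling off one dx_b at a time with [epull_ebase1_wedge]. *)
Lemma epull_wedge x y : epull J (ewedge x y) = ewedge (epull J x) (epull J y).
Proof.
move: x; apply: ext_ind => [|k x z Hx Hz|S].
- by rewrite epull0 !ewedge0l epull0.
- by rewrite epull_is_linear !(ewedgeDl, ewedgeZl) epull_is_linear Hx Hz.
move: {2}#|S| (erefl #|S|) => N; elim: N S => [|N IH] S.
  by move=> /eqP; rewrite cards_eq0 => /eqP ->; rewrite epull1 !ewedge1x.
move=> SN; have /card_gt0P[b bS] : (0 < #|S|)%N by rewrite SN.
have := cardsD1 b S; rewrite bS SN => -[SN'].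
rewrite -(setD1K bS) ebaseU1 ?setD11 // ewedgeZl !epullZ ewedgeZl -ewedgeA.
by rewrite !epull_ebase1_wedge IH // ewedgeA.
Qed.

End Pullback.

(** * Interior products with coordinate vectors *)

Section Interior.
Context {R : realType} {m : nat}.
Implicit Types (S T U : {set 'I_m}) (x y z : ext R m) (a b c : 'I_m) (k : R).

(** The interior product with the b-th coordinate vector. *)
Definition econtract b x : ext R m :=
  [ffun S : {set 'I_m} =>
     if b \in S then 0 else shuffle_sign [set b] S * x (b |: S)].

Lemma contract_is_linear b k x y : econtract b (k *: x + y) = k *: econtract b x + econtract b y.
Proof.
apply: extP => S; rewrite !ffunE; case: ifP => _; first by rewrite scaler0 addr0.
by rewrite -![k *: _]/(k * _) mulrDr mulrCA.
Qed.

Lemma contract0 b : econtract b 0 = 0.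
Proof. by apply: extP => S; rewrite !ffunE mulr0; case: ifP. Qed.

Lemma contractZ b k x : econtract b (k *: x) = k *: econtract b x.
Proof. by rewrite -[_ *: x]addr0 contract_is_linear contract0 addr0. Qed.

Lemma contractD b x y : econtract b (x + y) = econtract b x + econtract b y.
Proof. by rewrite -[x]scale1r contract_is_linear !scale1r. Qed.

Lemma contract_sum b (I : Type) (s : seq I) (P : pred I) (F : I -> ext R m) :
  econtract b (\sum_(i <- s | P i) F i) = \sum_(i <- s | P i) econtract b (F i).
Proof. exact: (big_morph (econtract b) (contractD b) (contract0 b)). Qed.

Lemma homog_contract b j x : homog j x -> homog (j - 1) (econtract b x).
Proof.
move=> hx S Sj; rewrite ffunE; case: ifP => // bS.
rewrite hx ?mulr0 //; apply: contra Sj => /eqP <-.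
by rewrite cardsU1 bS add1n -addn1 PoszD addrK.
Qed.

Lemma ewedge_ebase1E c x S : ewedge (ebase [set c]) x S =
  if c \in S then shuffle_sign [set c] (S :\ c) * x (S :\ c) else 0.
Proof.
rewrite ffunE; case: ifP => cS.
  rewrite (bigD1 [set c]) ?sub1set //= big1 ?addr0.
    by rewrite ffunE eqxx mulr1.
  by move=> T /andP[_ Tc]; rewrite ffunE (negbTE Tc) mulr0 mul0r.
rewrite big1 // => T TS; rewrite ffunE; case: eqVneq => [Tc|]; last first.
  by rewrite mulr0 mul0r.
by move: TS; rewrite Tc sub1set cS.
Qed.

(** The Clifford relation between interior and exterior multiplication. *)
Lemma contract_ebase1 b c x : econtract b (ewedge (ebase [set c]) x) =
  (b == c)%:R *: x - ewedge (ebase [set c]) (econtract b x).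
Proof.
apply: extP => S; rewrite ffunE [RHS]ffunE [X in _ + X]ffunE.
rewrite !ewedge_ebase1E [X in X + _]ffunE [econtract b x _]ffunE.
have [<-{c}|bc] := eqVneq b c.
  rewrite setD11 setU11 scale1r; case: ifP => bS.
    by rewrite setD1K // mulrA shuffle_sign_sq mul1r subrr.
  by rewrite setU1K ?bS // mulrA shuffle_sign_sq mul1r subr0.
have cb : (c == b) = false by rewrite eq_sym (negbTE bc).
rewrite scale0r add0r !inE cb bc /=.
case: (boolP (c \in S)) => cS; last by rewrite mulr0 oppr0; case: ifP.
case: ifP => bS; first by rewrite mulr0 oppr0.
have cS' := setD11 c S.
have -> : (b |: S) :\ c = b |: (S :\ c).
  by rewrite setDUl; congr (_ :|: _); apply/setDidPl; rewrite disjoints1 inE.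
rewrite -{1}(setD1K cS) !shuffle_signE.
have dc : [disjoint [set c] & S :\ c] by rewrite disjoints1 cS'.
have db : [disjoint [set b] & S :\ c] by rewrite disjoints1 inE bS andbF.
rewrite !ninvUr // !ninv11 !mulrA -!exprD -mulNr; congr (_ * _).
(* For distinct b and c the two orders of inserting them differ by exactly one inversion, whence the
   minus sign. *)
have : ((c < b) + (b < c) = 1)%N.
  by case: ltngtP => // /val_inj E; rewrite E eqxx in bc.
by rewrite addnACA => ->; rewrite exprD expr1 mulN1r addnC.
Qed.

Lemma ebase1C a c x : ewedge (ebase [set a]) (ewedge (ebase [set c]) x) =
  - ewedge (ebase [set c]) (ewedge (ebase [set a]) x).
Proof. by rewrite !ewedgeA ebaseC !cards1 ewedgeZl scaleN1r. Qed.

(** The coefficient at S is reproduced once for every element of S. *)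
Lemma euler_contract j x : homog j x ->
  \sum_c ewedge (ebase [set c]) (econtract c x) = j%:~R *: x.
Proof.
move=> hx; apply: extP => S; rewrite sum_ffunE !ffunE.
transitivity (\sum_(c in S) x S).
  rewrite [RHS]big_mkcond; apply: eq_bigr => c _; rewrite ewedge_ebase1E ffunE.
  by rewrite setD11; case: ifP => cS //; rewrite setD1K // mulrA shuffle_sign_sq mul1r.
rewrite sumr_const; case: (eqVneq #|S|%:Z j) => [<-|/hx ->].
  by rewrite -[RHS]/(_ * _) mulr_natl.
by rewrite mul0rn scaler0.
Qed.

End Interior.

(** * The Lefschetz commutator at a point *)

Section LefschetzPoint.
Context {R : realType} {m : nat}.
Implicit Types (S T U : {set 'I_m}) (x y z w : ext R m) (a b c : 'I_m) (k : R).

(** The Gram matrix of [eval2 w], see [eval2E]. *)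
Definition omat w : 'M[R]_m := \matrix_(b, c)
  if (b < c)%N then w [set b; c] else
  if (c < b)%N then - w [set b; c] else 0.

Lemma omat_tr w : (omat w)^T = - omat w.
Proof.
apply/matrixP => b c; rewrite !mxE setUC.
by case: ltngtP; rewrite ?opprK ?oppr0.
Qed.

Lemma eval2E w (u v : 'rV[R]_m) : eval2 w u v = (u *m omat w *m v^T) 0 0.
Proof.
transitivity (\sum_b \sum_c omat w b c * (u 0 b * v 0 c)); last first.
  rewrite mxE exchange_big; apply: eq_bigr => c _; rewrite !mxE mulr_suml.
  by apply: eq_bigr => b _; rewrite mulrCA mulrA.
rewrite /eval2.
under eq_bigr do under eq_bigr do rewrite mulrBr.
under eq_bigr do rewrite sumrB.
rewrite sumrB [X in _ - X](exchange_big_dep xpredT) //= -sumrB.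
apply: eq_bigr => b _.
rewrite big_mkcond [X in _ - X]big_mkcond -sumrB; apply: eq_bigr => c _.
rewrite mxE setUC [c |: [set b]]setUC.
by case: ltngtP => _; rewrite ?subr0 ?sub0r ?mul0r ?oppr0 ?mulNr // ?mulNr.
Qed.

Lemma sum_delta2 (E : 'I_m -> 'I_m -> ext R m) p q :
  \sum_b \sum_c ((b == p) && (c == q))%:R *: E b c = E p q.
Proof.
rewrite (bigD1 p) //= [X in _ + X]big1 ?addr0; last first.
  by move=> b /negbTE ->; rewrite big1 // => c _; rewrite scale0r.
rewrite (bigD1 q) //= !eqxx scale1r big1 ?addr0 // => c /negbTE ->.
by rewrite scale0r.
Qed.

(** Summing over ordered pairs counts each basis 2-covector twice, hence the factor 1/2; the
    redundancy makes the contractions below symmetric in the two indices. *)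
Lemma ebase2E w : homog 2 w ->
  w = 2^-1 *: \sum_b \sum_c omat w b c *: ewedge (ebase [set b]) (ebase [set c]).
Proof.
move: w; apply: homog_ind => [|k x y Hx Hy|S [/eqP/cards2P[p [q [pq SE]]]]].
- rewrite big1 ?scaler0 // => b _; rewrite big1 // => c _.
  by rewrite mxE !ffunE oppr0; case: ifP => _; [|case: ifP => _]; rewrite scale0r.
- rewrite {1}Hx {1}Hy scalerA mulrC -scalerA -scalerDr; congr (_ *: _).
  rewrite scaler_sumr -big_split; apply: eq_bigr => b _ /=.
  rewrite scaler_sumr -big_split; apply: eq_bigr => c _ /=.
  rewrite scalerA -scalerDl; congr (_ *: _); rewrite !mxE !ffunE.
  rewrite -[k *: _]/(k * _) opprD -mulrN.
  by case: ifP => _; [|case: ifP => _]; rewrite ?mulr0 ?addr0.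
wlog {pq} pq : p q SE / (p < q)%N => [wl|].
  move: pq; rewrite -val_eqE neq_ltn => /orP[]; first exact: wl.
  by apply: wl; rewrite setUC.
have lt2 b c : (b < c)%N -> ([set b; c] == S) = (b == p) && (c == q).
  move=> bc; rewrite SE; apply/eqP/andP => [E|[/eqP -> /eqP ->] //].
  have : b \in [set p; q] by rewrite -E set21.
  have : c \in [set p; q] by rewrite -E set22.
  have : p \in [set b; c] by rewrite E set21.
  have : q \in [set b; c] by rewrite E set22.
  rewrite !inE -!val_eqE /=; move: bc pq; clear; lia.
have omE b c : omat (ebase S) b c =
    ((b == p) && (c == q))%:R - ((b == q) && (c == p))%:R.
  rewrite mxE !ffunE; case: ltngtP => bc.
  - rewrite lt2 //; case: (boolP (_ && (c == p))); rewrite ?subr0 //.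
    by case/andP=> /eqP E1 /eqP E2; move: bc pq; rewrite E1 E2; lia.
  - rewrite setUC lt2 // andbC; case: (boolP (_ && (c == q))); rewrite ?sub0r //.
    by case/andP=> /eqP E1 /eqP E2; move: bc pq; rewrite E1 E2; lia.
  - have <- := val_inj bc.
    by case: eqVneq => [->|_]; rewrite ?andbF ?andbT ?subrr //=
       -!val_eqE /=; case: ltngtP pq; rewrite ?subrr.
under eq_bigr do under eq_bigr do rewrite omE scalerBl.
under eq_bigr do rewrite sumrB.
rewrite sumrB !sum_delta2 [X in _ - X]ebaseC !cards1 scaleN1r opprK.
rewrite -mulr2n -scaler_nat scalerA mulVf ?pnatr_eq0 // scale1r.
rewrite ewedge_ebase disjoints1 inE -val_eqE ltn_eqF //= shuffle_signE ninv11.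
by rewrite ltnNge (ltnW pq) scale1r SE.
Qed.

(** The product with x of the interior product of the 2-covector w with the b-th coordinate
    vector. *)
Definition eta w b x : ext R m := \sum_c omat w b c *: ewedge (ebase [set c]) x.

(** Contraction passes w without a sign since w has even degree. *)
Lemma contract_omega w b x : homog 2 w ->
  econtract b (ewedge w x) = ewedge w (econtract b x) + eta w b x.
Proof.
move=> hw; set E := ebase2E hw.
have W z : ewedge w z = 2^-1 *: \sum_a \sum_c
    omat w a c *: ewedge (ebase [set a]) (ewedge (ebase [set c]) z).
  rewrite {1}E ewedgeZl ewedge_suml; congr (_ *: _); apply: eq_bigr => a _.
  rewrite ewedge_suml; apply: eq_bigr => c _.
  by rewrite ewedgeZl ewedgeA.
rewrite !W contractZ contract_sum.
(* The factor 1/2 of [ebase2E] calls for two copies of [eta]: [e1] and [e2] come from contracting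
   the first and the second covector factor, and they agree by skewness of [omat]. *)
have -> : eta w b x = 2^-1 *: (eta w b x + eta w b x).
  by rewrite -mulr2n -scaler_nat scalerA mulVf ?pnatr_eq0 // scale1r.
rewrite -scalerDr; congr (_ *: _).
have e1 : eta w b x = \sum_a \sum_c omat w a c *: ((b == a)%:R *: ewedge (ebase [set c]) x).
  rewrite (bigD1 b) //= [X in _ + X]big1 ?addr0.
    by apply: eq_bigr => c _; rewrite eqxx scale1r.
  by move=> a ab; rewrite big1 // => c _; rewrite eq_sym (negbTE ab) scale0r scaler0.
have e2 : eta w b x = - \sum_a \sum_c omat w a c *: ((b == c)%:R *: ewedge (ebase [set a]) x).
  rewrite exchange_big (bigD1 b) //= [X in _ + X]big1 ?addr0.
    rewrite -sumrN; apply: eq_bigr => c _; rewrite eqxx scale1r -scaleNr.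
    by have /matrixP/(_ c b) := omat_tr w; rewrite !mxE => ->.
  by move=> c cb; rewrite big1 // => a _; rewrite eq_sym (negbTE cb) scale0r scaler0.
rewrite [X in _ + (X + _)]e1 {1}e2 -sumrN -!big_split.
apply: eq_bigr => a _ /=; rewrite contract_sum -sumrN -!big_split.
apply: eq_bigr => c _ /=.
rewrite contractZ !contract_ebase1 ewedgeDr ewedgeNr ewedgeZr.
by rewrite opprB !scalerDr scalerN addrCA.
Qed.

Variables (w : ext R m) (P : 'M[R]_m).
Hypotheses (hw : homog 2 w) (PO : P *m omat w = 1%:M) (Pt : P^T = - P).

(** The lowering operator: contraction with the bivector whose matrix P inverts that of w. *)
Definition lambda x : ext R m :=
  2^-1 *: \sum_b \sum_c P b c *: econtract b (econtract c x).

Lemma lambda_is_linear k x y : lambda (k *: x + y) = k *: lambda x + lambda y.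
Proof.
rewrite /lambda scalerA mulrC -scalerA -scalerDr; congr (_ *: _).
rewrite scaler_sumr -big_split; apply: eq_bigr => b _ /=.
rewrite scaler_sumr -big_split; apply: eq_bigr => c _ /=.
by rewrite !contract_is_linear scalerDr !scalerA mulrC.
Qed.

Lemma homog_lambda j x : homog j x -> homog (j - 2) (lambda x).
Proof.
move=> hx; rewrite -[lambda x]addr0; apply: homogP; last exact: homog0.
apply: homog_sum => b _; apply: homog_sum => c _; rewrite -[_ *: _]addr0.
apply: homogP; last exact: homog0.
have -> : j - 2 = j - 1 - 1 by ring.
by apply: homog_contract; exact: homog_contract.
Qed.

(** Commuting both contractions past w leaves three terms: the trace of [P *m omat w], which is m,
    and twice the Euler operator with a minus sign. *)
Lemma lambda_omega j x : homog j x ->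
  lambda (ewedge w x) = ewedge w (lambda x) + (m%:R / 2 - j%:~R) *: x.
Proof.
move=> hx; rewrite /lambda ewedgeZr.
have -> : (m%:R / 2 - j%:~R) *: x = 2^-1 *: (m%:R *: x - (j%:~R *: x + j%:~R *: x)).
  rewrite -mulr2n -scaler_nat scalerA -scalerBl scalerA; congr (_ *: _).
  by field.
rewrite -scalerDr; congr (_ *: _).
have E1 : m%:R *: x = \sum_b \sum_c P b c *: (omat w c b *: x).
  transitivity (\sum_(b < m) x); first by rewrite sumr_const card_ord scaler_nat.
  apply: eq_bigr => b _; have /matrixP/(_ b b) := PO; rewrite !mxE eqxx => PO1.
  rewrite -[LHS]scale1r -[1]/(1%:R) -PO1 scaler_suml.
  by apply: eq_bigr => c _; rewrite scalerA.
have E2 : j%:~R *: x = \sum_b \sum_c P b c *: eta w c (econtract b x).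
  rewrite -(euler_contract hx); apply: eq_bigr => b _; rewrite /eta.
  under eq_bigr do rewrite scaler_sumr.
  rewrite exchange_big /= (bigD1 b) //= [X in _ + X]big1 ?addr0.
    under eq_bigr do rewrite scalerA; rewrite -scaler_suml.
    by have /matrixP/(_ b b) := PO; rewrite !mxE eqxx => ->; rewrite scale1r.
  move=> d db; under eq_bigr do rewrite scalerA; rewrite -scaler_suml.
  have /matrixP/(_ b d) := PO; rewrite !mxE eq_sym (negbTE db) => ->.
  by rewrite scale0r.
(* The Euler operator again, with b and c exchanged; skewness of P gives the sign. *)
have E3 : j%:~R *: x = - \sum_b \sum_c P b c *: eta w b (econtract c x).
  rewrite E2 exchange_big -sumrN; apply: eq_bigr => b _.
  rewrite -sumrN; apply: eq_bigr => c _.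
  by have /matrixP/(_ b c) := Pt; rewrite !mxE => ->; rewrite scaleNr.
rewrite E1 [X in _ - (X + _)]E2 {1}E3 opprD opprK -!sumrN.
rewrite ewedge_sumr -!big_split; apply: eq_bigr => b _ /=.
rewrite ewedge_sumr -sumrN -!big_split; apply: eq_bigr => c _ /=.
rewrite ewedgeZr -scalerN -!scalerDr; congr (_ *: _).
rewrite contract_omega // contractD contract_omega // -!addrA; congr (_ + _).
rewrite addrC addrA; congr (_ + _).
rewrite /eta contract_sum -sumrN.
transitivity (\sum_d (omat w c d *: ((b == d)%:R *: x)
   - omat w c d *: ewedge (ebase [set d]) (econtract b x))).
  by apply: eq_bigr => d _; rewrite contractZ contract_ebase1 scalerBr.
rewrite sumrB sumrN; congr (_ - _).
rewrite (bigD1 b) //= big1 ?addr0 ?eqxx ?scale1r // => d db.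
by rewrite eq_sym (negbTE db) scale0r scaler0.
Qed.

End LefschetzPoint.

(** * The Lefschetz decomposition of an sl2-module *)

Section SL2.
Context {K : numFieldType} {V : lmodType K} (n : nat).
Variables (gr : int -> V -> Prop) (L : V -> V).
Implicit Types (x y z : V) (j k : int) (q r s : nat) (c : K).
Hypotheses (gr0 : forall j, gr j 0)
  (grP : forall j c x y, gr j x -> gr j y -> gr j (c *: x + y))
  (gr_neg : forall j x, j < 0 -> gr j x -> x = 0)
  (gr_large : forall j x, (2 * n)%N%:Z < j -> gr j x -> x = 0)
  (L_lin : forall c x y, L (c *: x + y) = c *: L x + L y)
  (grL : forall j x, gr j x -> gr (j + 2) (L x)).

Lemma sl2_L0 : L 0 = 0.
Proof. by have := L_lin (-1) 0 0; rewrite !scaleN1r oppr0 addr0 addNr. Qed.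

Lemma sl2_LZ c x : L (c *: x) = c *: L x.
Proof. by rewrite -[c *: x]addr0 L_lin sl2_L0 addr0. Qed.

Lemma sl2_LD x y : L (x + y) = L x + L y.
Proof. by rewrite -[x]scale1r L_lin !scale1r. Qed.

Lemma sl2_LN x : L (- x) = - L x.
Proof. by rewrite -scaleN1r sl2_LZ scaleN1r. Qed.

Lemma iterL0 q : iter q L 0 = 0.
Proof. by elim: q => //= q ->; exact: sl2_L0. Qed.

Lemma iterLP q c x y : iter q L (c *: x + y) = c *: iter q L x + iter q L y.
Proof. by elim: q => //= q ->. Qed.

Lemma iterLZ q c x : iter q L (c *: x) = c *: iter q L x.
Proof. by rewrite -[c *: x]addr0 iterLP iterL0 addr0. Qed.

Lemma iterLD q x y : iter q L (x + y) = iter q L x + iter q L y.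
Proof. by rewrite -[x]scale1r iterLP !scale1r. Qed.

Lemma iterLN q x : iter q L (- x) = - iter q L x.
Proof. by rewrite -scaleN1r iterLZ scaleN1r. Qed.

Lemma iterL_sum q (I : Type) (t : seq I) (P : pred I) (F : I -> V) :
  iter q L (\sum_(i <- t | P i) F i) = \sum_(i <- t | P i) iter q L (F i).
Proof. exact: (big_morph (iter q L) (iterLD q) (iterL0 q)). Qed.

Lemma iterL_le q r x : (q <= r)%N -> iter q L x = 0 -> iter r L x = 0.
Proof. by move=> /subnK <- E; rewrite iterD E iterL0. Qed.

Lemma gr_iterL j q x : gr j x -> gr (j + (2 * q)%N%:Z) (iter q L x).
Proof.
move=> gx; elim: q => [|q IH]; first by rewrite addr0.
by rewrite (_ : _ + _ = j + (2 * q)%N%:Z + 2); [exact: grL | lia].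
Qed.

(** The graded module is abstract because the theory is applied twice: to covectors at a point for
    uniqueness, and to families of local forms for existence. *)
Definition sl2_prim s x := gr s x /\ iter (n.+1 - s) L x = 0.

(** The sum ranges over a square; on a [sl2_family] the terms with r + s > n vanish, so shifting r
    needs no bookkeeping. *)
Definition dsum (B : nat -> nat -> V) : V :=
  \sum_(s < n.+1) \sum_(r < n.+1) iter r L (B r s).

Definition sl2_family (B : nat -> nat -> V) :=
  (forall r s, (r + s <= n)%N -> sl2_prim s (B r s)) /\
  (forall r s, (n < r + s)%N -> B r s = 0).

Section Lambda.
Variable Lam : V -> V.
Hypotheses
  (Lam_lin : forall c x y, Lam (c *: x + y) = c *: Lam x + Lam y)
  (grLam : forall j x, gr j x -> gr (j - 2) (Lam x))
  (Lam_L : forall j x, gr j x ->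
     Lam (L x) = L (Lam x) + (n%:R - j%:~R) *: x).

Let Lam0 : Lam 0 = 0.
Proof. by have := Lam_lin (-1) 0 0; rewrite !scaleN1r oppr0 addr0 addNr. Qed.

Let LamZ c x : Lam (c *: x) = c *: Lam x.
Proof. by rewrite -[c *: x]addr0 Lam_lin Lam0 addr0. Qed.

Lemma gr_iterLam j q x : gr j x -> gr (j - (2 * q)%N%:Z) (iter q Lam x).
Proof.
move=> gx; elim: q => [|q IH]; first by rewrite subr0.
by rewrite (_ : _ - _ = j - (2 * q)%N%:Z - 2); [exact: grLam | lia].
Qed.

(** The scalar is the sum of n - j - 2i for i from 0 to q, collected while [Lam] moves through q + 1
    factors L. *)
Lemma Lam_iterL j q x : gr j x -> Lam (iter q.+1 L x) =
  iter q.+1 L (Lam x) + (q.+1%:R * (n%:R - j%:~R - q%:R)) *: iter q L x.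
Proof.
move=> gx; elim: q => [|q IH]; first by rewrite /= (Lam_L gx) mul1r subr0.
rewrite [in LHS]iterS (Lam_L (gr_iterL q.+1 gx)) IH sl2_LD sl2_LZ -!iterS.
rewrite -addrA -scalerDl; congr (_ + _ *: _).
by rewrite intrD -[(Posz _)%:~R]/((2 * q.+1)%:R) natrM -!natr1; ring.
Qed.

(** The mirror image of [Lam_iterL], on a vector killed by L. *)
Lemma L_iterLam j q x : gr j x -> L x = 0 -> L (iter q.+1 Lam x) =
  (q.+1%:R * (j%:~R - n%:R - q%:R)) *: iter q Lam x.
Proof.
have LLam i y : gr i y -> L (Lam y) = Lam (L y) + (i%:~R - n%:R) *: y.
  move=> gy; rewrite (Lam_L gy) -addrA -scalerDl.
  by rewrite addrA subrK subrr scale0r addr0.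
move=> gx Lx; elim: q => [|q IH].
  by rewrite /= (LLam _ _ gx) Lx Lam0 add0r mul1r subr0.
rewrite [in LHS]iterS (LLam _ _ (gr_iterLam q.+1 gx)) IH LamZ -iterS -scalerDl.
congr (_ *: _).
by rewrite intrB -[(Posz _)%:~R]/((2 * q.+1)%:R) natrM -!natr1; ring.
Qed.

(** Both claims go through one strong induction on the degree: injectivity in degree s - 2 shows
    that [Lam] kills the primitives of degree s, and this yields injectivity in degree s. *)
Lemma prim_Lam_inj s : (s <= n)%N ->
  (forall x, sl2_prim s x -> Lam x = 0) /\
  (forall x, gr s x -> iter (n - s) L x = 0 -> x = 0).
Proof.
elim/ltn_ind: s => s IH sn.
have Pa x : sl2_prim s x -> Lam x = 0.
  (* For q = n - s the scalar of [Lam_iterL] is zero, so a power of L kills [Lam x]. *)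
  move=> [gx Lx]; have := Lam_iterL (n - s) gx.
  rewrite (natrB _ sn) opprB -subSn // Lx Lam0 [X in _ * X](_ : _ = 0); last first.
    by rewrite -[s%:~R]/(s%:R) addrA subrK subrr.
  rewrite mulr0 scale0r addr0 => /esym E.
  have [s2|s2] := ltnP s 2.
    by apply: gr_neg (grLam gx); lia.
  apply: (IH (s - 2)%N _ _).2; [lia|lia| |].
    by rewrite (_ : Posz _ = s%:Z - 2); [exact: grLam | lia].
  by apply: iterL_le E; lia.
split=> // x gx Lx.
have Lamx : Lam x = 0 by apply: Pa; split=> //; apply: iterL_le Lx; lia.
(* Lower the power of L step by step: applying [Lam] to L^(k+1) x = 0 leaves a nonzero multiple of
   L^k x, because [Lam x] is 0. *)
suff : forall q, (q <= n - s)%N -> iter (n - s - q) L x = 0.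
  by move/(_ _ (leqnn _)); rewrite subnn.
elim=> [|q IHq] qn; first by rewrite subn0.
have := Lam_iterL (n - s - q.+1) gx.
rewrite -[(n - s - q.+1).+1]subSn // subSS IHq ?Lam0 ?Lamx ?iterL0 ?add0r; last lia.
move=> /esym/eqP; rewrite scaler_eq0 => /orP[|/eqP //].
rewrite mulf_eq0 pnatr_eq0 /= -[s%:~R]/(s%:R) -natrB // -natrB; last lia.
by rewrite pnatr_eq0; lia.
Qed.

(** L^j Lam^j acts on x by a nonzero scalar, so x is L^j of a multiple of Lam^j x. *)
Lemma ker_L_im (j : nat) x : (j <= n)%N -> gr (n + j)%N x -> L x = 0 ->
  exists2 y, sl2_prim (n - j) y & x = iter j L y.
Proof.
move=> jn gx Lx.
have [c c0 E] : exists2 c, c != 0 & iter j L (iter j Lam x) = c *: x.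
  suff : forall q, (q <= j)%N ->
      exists2 c, c != 0 & iter q L (iter q Lam x) = c *: x.
    by move/(_ _ (leqnn _)).
  elim=> [|q IH] qj; first by exists 1; rewrite ?oner_eq0 ?scale1r.
  have [c c0 E] := IH (ltnW qj).
  (* In degree n + j the scalar of [L_iterLam] is (q + 1)(j - q), nonzero as long as q < j. *)
  exists (q.+1%:R * (j - q)%:R * c).
    by rewrite !mulf_neq0 // pnatr_eq0; lia.
  rewrite iterSr (L_iterLam q gx Lx) iterLZ E scalerA.
  rewrite natrB; last exact: ltnW.
  congr (_ * _ * _ *: _); rewrite -[_%:~R]/((n + j)%:R) natrD; ring.
have xE : x = iter j L (c^-1 *: iter j Lam x).
  by rewrite iterLZ E scalerA mulVf // scale1r.
exists (c^-1 *: iter j Lam x) => //; split.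
  rewrite -[_ *: _]addr0; apply: grP => //.
  by rewrite (_ : Posz _ = (n + j)%N%:Z - (2 * j)%N%:Z); [exact: gr_iterLam|lia].
rewrite (_ : _ - _ = j.+1)%N; last by lia.
by rewrite iterS -xE.
Qed.

(** Descending induction on the degree: decompose L x, divide the result by L where possible, and
    correct by a single new term. *)
Lemma sl2_decomp (k : int) x : gr k x -> exists B, [/\ sl2_family B,
  forall r s, (2 * r + s)%N%:Z != k -> B r s = 0 & x = dsum B].
Proof.
have dsum0 : dsum (fun _ _ => 0) = 0.
  by rewrite /dsum big1 // => s _; rewrite big1 // => r _; exact: iterL0.
have fam0 : sl2_family (fun _ _ => 0).
  by split=> // r s _; split; [exact: gr0 | exact: iterL0].
have dsum1 r s y : (r + s <= n)%N -> sl2_prim s y ->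
    sl2_family (fun r' s' => if (r' == r) && (s' == s) then y else 0) /\
    dsum (fun r' s' => if (r' == r) && (s' == s) then y else 0) = iter r L y.
  move=> rs py; split.
    split=> r' s' rs'; case: andP => [[/eqP E1 /eqP E2]|_] //.
    - by rewrite E2.
    - by split; [exact: gr0 | exact: iterL0].
    - by move: rs'; rewrite E1 E2 ltnNge rs.
  have sn : (s < n.+1)%N by lia.
  have rn : (r < n.+1)%N by lia.
  rewrite /dsum (bigD1 (Ordinal sn)) //= [X in _ + X]big1 ?addr0 => [|s' s's].
    rewrite (bigD1 (Ordinal rn)) //= [X in _ + X]big1 ?addr0 ?eqxx // => r' r'r.
    rewrite -[r' == r :> nat]/(r' == Ordinal rn) (negbTE r'r).
    exact: iterL0.
  rewrite big1 // => r' _; rewrite -[s' == s :> nat]/(s' == Ordinal sn).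
  by rewrite (negbTE s's) andbF iterL0.
have dsumD B1 B2 : sl2_family B1 -> sl2_family B2 ->
    sl2_family (fun r s => B1 r s + B2 r s) /\
    dsum (fun r s => B1 r s + B2 r s) = dsum B1 + dsum B2.
  move=> [B11 B12] [B21 B22]; split.
    split=> r s rs; last by rewrite B12 // B22 // addr0.
    have [g1 e1] := B11 r s rs; have [g2 e2] := B21 r s rs.
    by split; [rewrite -[B1 r s]scale1r; exact: grP | rewrite iterLD e1 e2 addr0].
  rewrite /dsum -big_split; apply: eq_bigr => s _; rewrite -big_split.
  by apply: eq_bigr => r _; rewrite iterLD.
(* N bounds the distance to the degrees above 2n, where the module vanishes. *)
have [N kN] : exists N : nat, (2 * n)%N%:Z < k + N%:Z.
  by exists (2 * n + 1 + `|k|)%N; lia.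
elim: N k kN x => [|N IH] k kN x gx.
  exists (fun _ _ => 0); split=> //.
  by rewrite dsum0; apply: gr_large gx; rewrite addr0 in kN.
case: (ltrP k 0) => k0.
  by exists (fun _ _ => 0); split=> //; rewrite dsum0; exact: gr_neg gx.
case: (ltrP (2 * n)%N%:Z k) => k2n.
  by exists (fun _ _ => 0); split=> //; rewrite dsum0; exact: gr_large gx.
case: k k0 kN k2n gx => // k _ kN k2n gx.
have [|B [[B1 B2] Bk LxE]] := IH (k%:Z + 2) _ (L x) (grL gx); first by lia.
(* Lowering r by one inverts L on the terms with r > 0; what remains of L x is its primitive
   component, of degree k + 2. *)
pose B' r s := B r.+1 s.
have fB' : sl2_family B'.
  split=> r s rs; last by apply: B2; lia.
  case: (leqP (r.+1 + s) n) => rs'; first exact: B1.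
  by rewrite /B' B2 //; split; [exact: gr0 | exact: iterL0].
have B'k r s : (2 * r + s)%N%:Z != k -> B' r s = 0.
  by move=> h; apply: Bk; move: h; lia.
have LB' : L (x - dsum B') = B 0 k.+2.
  rewrite sl2_LD sl2_LN LxE -[L (dsum B')]/(iter 1 L (dsum B')) !iterL_sum.
  rewrite -sumrB.
  transitivity (\sum_(s < n.+1) B 0 s).
    apply: eq_bigr => s _; rewrite iterL_sum.
    under [X in _ - X]eq_bigr do rewrite -iterD addnC addn1.
    rewrite [X in _ - X]big_ord_recr /= /B' [B n.+1 s]B2; last by lia.
    rewrite iterL0 sl2_L0 addr0 big_ord_recl /=.
    by rewrite addrK.
  case: (ltnP k.+2 n.+1) => kn; last first.
    rewrite big1 ?[RHS]B2 ?add0n // => s _; apply: Bk.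
    by have := ltn_ord s; lia.
  rewrite (bigD1 (Ordinal kn)) //= big1 ?addr0 // => s sk; apply: Bk.
  by move: sk; rewrite -val_eqE /=; lia.
have gD : gr k (x - dsum B').
  rewrite addrC -scaleN1r; apply: grP => //.
  rewrite /dsum; elim/big_ind: _ => //.
    by move=> y z gy gz; rewrite -[y]scale1r; exact: grP.
  move=> s _; elim/big_ind: _ => //.
    by move=> y z gy gz; rewrite -[y]scale1r; exact: grP.
  move=> r _; case: (eqVneq (2 * r + s)%N%:Z k) => [E|E]; last first.
    by rewrite B'k // iterL0.
  case: (leqP (r + s) n) => rs; last by rewrite fB'.2 // iterL0.
  have [g _] := fB'.1 r s rs.
  by rewrite -E [in gr _](_ : Posz _ = s%:Z + (2 * r)%N%:Z); [exact: gr_iterL|lia].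
suff [r0 [s0 [y [rs py ks Dy]]]] : exists r s y, [/\ (r + s <= n)%N, sl2_prim s y,
    (2 * r + s)%N = k & x - dsum B' = iter r L y].
  have [f1 E1] := dsum1 _ _ _ rs py.
  have [f2 E2] := dsumD _ _ fB' f1.
  eexists; split; first exact: f2.
    move=> r s h /=; rewrite B'k // add0r; case: andP => // -[/eqP E3 /eqP E4].
    by move: h; rewrite E3 E4 ks eqxx.
  by rewrite E2 E1 -Dy addrC subrK.
(* For k <= n the remainder is itself primitive, since L maps it to a primitive of degree k + 2. For
   k > n that primitive is 0, and [ker_L_im] applies. *)
case: (leqP k n) => kn.
  exists 0%N, k, (x - dsum B'); split=> //; split=> //.
  rewrite subSn // iterSr LB'.
  case: (leqP k.+2 n) => kn2; last by rewrite B2 ?iterL0 ?add0n.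
  have [_] := B1 0%N k.+2 kn2.
  by apply: iterL_le; lia.
have B00 : B 0%N k.+2 = 0 by apply: B2; lia.
have [|||y py xE] := @ker_L_im (k - n) (x - dsum B').
- by lia.
- by rewrite subnKC // ltnW.
- by rewrite LB' B00.
exists (k - n)%N, (n - (k - n))%N, y; split=> //; lia.
Qed.

Section Uniqueness.
Variable pr : int -> V -> V.
Hypotheses (pr_add : forall k x y, pr k (x + y) = pr k x + pr k y)
  (pr_id : forall k x, gr k x -> pr k x = x)
  (pr_0 : forall j k x, gr j x -> j != k -> pr k x = 0).

(** In a fixed degree there is one unknown for each r. The highest one is isolated by a power of L
    that kills all the others, and it vanishes by injectivity; then one descends. *)
Lemma sl2_uniq B : sl2_family B -> dsum B = 0 -> forall r s, B r s = 0.
Proof.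
move=> [B1 B2] B0 r0 s0.
pose k := (2 * r0 + s0)%N.
have pr00 i : pr i 0 = 0.
  have := pr_0 (gr0 (i + 1)) (k := i); apply; lia.
(* The components that contribute to degree k; the guard excludes truncated subtraction. *)
pose b r := if (2 * r <= k)%N then B r (k - 2 * r)%N else 0.
have pr_sum i (I : Type) (t : seq I) (P : pred I) (F : I -> V) :
    pr i (\sum_(e <- t | P e) F e) = \sum_(e <- t | P e) pr i (F e).
  exact: (big_morph (pr i) (pr_add i) (pr00 i)).
have grB r s : gr s (B r s).
  case: (leqP (r + s) n) => rs; first by case: (B1 r s rs).
  by rewrite B2.
have grLB r s : gr (2 * r + s)%N (iter r L (B r s)).
  by rewrite [in gr _](_ : Posz _ = s%:Z + (2 * r)%N%:Z); [exact: gr_iterL|lia].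
have sumb : \sum_(r < n.+1) iter r L (b r) = 0.
  transitivity (pr k (dsum B)); last by rewrite B0.
  rewrite /dsum exchange_big pr_sum. apply: eq_bigr => r _; rewrite pr_sum /b.
  case: leqP => rk; last first.
    rewrite iterL0 big1 // => s _; apply: (pr_0 (grLB _ _)); lia.
  case: (ltnP (k - 2 * r) n.+1) => kr.
    rewrite (bigD1 (Ordinal kr)) //= big1 ?addr0.
      by rewrite pr_id //; have := grLB r (k - 2 * r)%N; rewrite subnKC.
    move=> s sk; apply: (pr_0 (grLB _ _)); move: sk; rewrite -val_eqE /=; lia.
  rewrite B2 ?iterL0; last by lia.
  by rewrite big1 // => s _; apply: (pr_0 (grLB _ _)); have := ltn_ord s; lia.
have bz r : (n < r)%N -> b r = 0.
  by move=> nr; rewrite /b; case: ifP => // _; apply: B2; lia.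
suff H N : \sum_(r < N) iter r L (b r) = 0 -> forall r, (r < N)%N -> b r = 0.
  have b0 : b r0 = 0.
    by case: (leqP r0 n) => rn; [apply: (H n.+1 sumb) | exact: bz].
  by move: b0; rewrite /b /k leq_addr addKn.
elim: N => [|N IH] //; rewrite big_ord_recr /= => E.
suff bN : b N = 0.
  move=> r; rewrite ltnS leq_eqVlt => /orP[/eqP ->//|rN].
  by apply: IH => //; move: E; rewrite bN iterL0 addr0.
rewrite /b; case: ifP => // Nk.
case: (leqP (N + (k - 2 * N)) n) => Nn; last exact: B2.
have [g _] := B1 _ _ Nn.
apply: (prim_Lam_inj _).2 g _; first by lia.
(* With s = k - 2r, this power carries L^r past the vanishing order of the primitive B r s when r <
   N, and for r = N it produces L^(n - s), which is injective. *)
have := congr1 (iter (n - (k - N)) L) E.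
rewrite iterL0 iterLD iterL_sum big1 ?add0r => [|r _].
  by rewrite /b Nk -iterD => <-; congr iter; lia.
have rN := ltn_ord r; rewrite -iterD /b; case: ifP => rk; last exact: iterL0.
case: (leqP (r + (k - 2 * r)) n) => rn; last by rewrite B2 // iterL0.
have [_] := B1 _ _ rn; apply: iterL_le; lia.
Qed.

End Uniqueness.
End Lambda.
End SL2.

(** * Transfer of a cone to cokernel and kernel *)

(* Decides identities in a zmodType, where [ring] does not apply. *)
Module ZmodTac.
Inductive expr := Var of nat | Zero | Add of expr & expr | Opp of expr.

Section Eval.
Variable V : zmodType.
Implicit Types (env : seq V) (e : expr).

Fixpoint eval env e : V := match e with
  | Var i => env`_i
  | Zero => 0
  | Add e1 e2 => eval env e1 + eval env e2
  | Opp e1 => - eval env e1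
  end.

Fixpoint coef (i : nat) e : int := match e with
  | Var j => (i == j)%:Z
  | Zero => 0
  | Add e1 e2 => coef i e1 + coef i e2
  | Opp e1 => - coef i e1
  end.

Lemma evalE env e : eval env e = \sum_(i < size env) env`_i *~ coef i e.
Proof.
elim: e => [j||e1 IH1 e2 IH2|e1 IH1] /=; rewrite ?IH1 ?IH2.
- have [js|js] := ltnP j (size env).
    rewrite (bigD1 (Ordinal js)) //= eqxx big1 ?addr0 // => i ij.
    by rewrite -[i == j :> nat]/(i == Ordinal js) (negbTE ij).
  rewrite nth_default // big1 // => i _.
  by rewrite (_ : (i == j :> nat) = false) // ltn_eqF // (leq_trans _ js).
- by rewrite big1.
- by rewrite -big_split; apply: eq_bigr => i _; rewrite mulrzDr.
- by rewrite -sumrN; apply: eq_bigr => i _; rewrite mulrNz.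
Qed.

(** The reflection step: it suffices to compare the integer coefficients of each atom, which is
    decided by computation. *)
Lemma eval_eq env e1 e2 :
  all (fun i => coef i e1 == coef i e2) (iota 0 (size env)) ->
  eval env e1 = eval env e2.
Proof.
move=> /allP h; rewrite !evalE; apply: eq_bigr => i _.
suff /h/eqP -> : nat_of_ord i \in iota 0 (size env) by [].
by rewrite mem_iota ltn_ord.
Qed.
End Eval.

Ltac find x env := lazymatch env with
  | x :: _ => constr:(Some 0%N)
  | _ :: ?env' => let r := find x env' in
      lazymatch r with Some ?i => constr:(Some (S i)) | None => r end
  | _ => constr:(@None nat)
  end.
(* Equal atoms may differ by a path in the hierarchy, hence [unify]. *)
Ltac findu x env := lazymatch env with
  | x :: _ => constr:(Some 0%N)
  | ?y :: ?env' => let r := findu x env' in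
      lazymatch r with
      | Some ?i => constr:(Some (S i))
      | None => match goal with
        | _ => let _ := match goal with _ => unify x y end in constr:(Some 0%N)
        | _ => constr:(@None nat)
        end
      end
  | _ => constr:(@None nat)
  end.
Ltac atoms fnd t env := lazymatch t with
  | (?a + ?b)%R => let env := atoms fnd a env in atoms fnd b env
  | (- ?a)%R => atoms fnd a env
  | 0%R => env
  | _ => let r := fnd t env in
      lazymatch r with Some _ => env | None => constr:(t :: env) end
  end.
Ltac reify fnd t env := lazymatch t with
  | (?a + ?b)%R =>
      let a := reify fnd a env in let b := reify fnd b env in
      constr:(Add a b)
  | (- ?a)%R => let a := reify fnd a env in constr:(Opp a)
  | 0%R => constr:(Zero)
  | _ => let r := fnd t env in
      lazymatch r with Some ?i => constr:(Var i) end
  end.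
Ltac zmod_with fnd := lazymatch goal with |- @eq ?T ?x ?y =>
  let env := atoms fnd x (@nil T) in let env := atoms fnd y env in
  let e1 := reify fnd x env in let e2 := reify fnd y env in
  refine (@eval_eq _ env e1 e2 _); vm_compute; reflexivity end.
Ltac zmod := let fnd x env := find x env in zmod_with fnd.
Ltac zmodu := let fnd x env := findu x env in zmod_with fnd.
End ZmodTac.

Section Contraction.
Context {F : fieldType} {A : lmodType F}.
Variables (mul : A -> A -> A) (d H W : A -> A).
Variable par : bool -> A -> Prop.
Local Notation "x ** y" := (mul x y) (at level 40, left associativity).
Local Notation sg a := ((-1) ^+ nat_of_bool a : F).
Implicit Types (x y z : A) (a b c : bool).

Hypotheses
  (mulDl : forall x y z, (x + y) ** z = x ** z + y ** z)
  (mulDr : forall x y z, x ** (y + z) = x ** y + x ** z)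
  (mulZl : forall (k : F) x y, (k *: x) ** y = k *: (x ** y))
  (mulZr : forall (k : F) x y, x ** (k *: y) = k *: (x ** y))
  (d_lin : linear d) (H_lin : linear H) (W_lin : linear W)
  (mulA : forall x y z, x ** (y ** z) = x ** y ** z)
  (dd : forall x, d (d x) = 0)
  (dW : forall x, d (W x) = W (d x))
  (mulWl : forall x y, W x ** y = W (x ** y))
  (mulWr : forall x y, x ** W y = W (x ** y))
  (WHW : forall x, W (H (W x)) = W x)
  (HWH : forall x, H (W (H x)) = H x)
  (leib : forall a x y, par a x -> d (x ** y) = d x ** y + sg a *: (x ** d y))
  (par_d : forall a x, par a x -> par (~~ a) (d x))
  (par_H : forall a x, par a x -> par a (H x))
  (par_mul : forall a b x y, par a x -> par b y -> par (a (+) b) (x ** y)).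

(* The cone of W is A (+) A with differential (x, y) |-> (d x - W y, - d y) and
   product (x, y) (x', y') = (x x', (-1)^|x| x y' + y x').  The inclusion sends x in
   coker W to (x, H (d x)), the projection sends (z, w) to the classes of z and of
   w - d (H z). *)
Definition cokP x : A := x - W (H x).
Definition kerP x : A := x - H (W x).

(** Multiplying the lifts (x, H (d x)) and (x', H (d x')) in the cone and applying w - d (H z) to
    the result gives these three terms, which are those of the filtered product. *)
Definition cone_mixed a x x' : A :=
  - d (H (x ** x')) + H (d x) ** x' + sg a *: (x ** H (d x')).
Local Notation G := cone_mixed.

(** The two planar binary trees with three leaves, with H on the inner edge. *)
Definition cone_triple x y z : A := x ** H (y ** z) - H (x ** y) ** z.
Local Notation T := cone_triple.

(** The cone differential of the lift of x has second component - d (H (d x)), which [kerP] projects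
    to the kernel of W. *)
Definition cone_m1 (u : A * A) : A * A := (cokP (d u.1), - d u.2 - kerP (d (H (d u.1)))).
Local Notation M1 := cone_m1.

Definition cone_m2 a (u v : A * A) : A * A :=
  (cokP (u.1 ** v.1),
   kerP (G a u.1 v.1) + sg a *: (u.1 ** v.2) + u.2 ** v.1).
Local Notation M2 := cone_m2.

Definition cone_m3 (u v w : A * A) : A * A := (0, kerP (T u.1 v.1 w.1)).
Local Notation M3 := cone_m3.

(** The second component has the opposite parity because of the shift by one in the cone. *)
Definition cone_homog a (u : A * A) := [/\ par a u.1, par (~~ a) u.2 & W u.2 = 0].
Local Notation good := cone_homog.

Let mulNl x y : (- x) ** y = - (x ** y).
Proof. by rewrite -scaleN1r mulZl scaleN1r. Qed.
Let mulNr x y : x ** (- y) = - (x ** y).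
Proof. by rewrite -scaleN1r mulZr scaleN1r. Qed.
Let mul0l y : 0 ** y = 0.
Proof. by rewrite -(scale0r 0) mulZl !scale0r. Qed.
Let mul0r y : y ** 0 = 0.
Proof. by rewrite -(scale0r 0) mulZr !scale0r. Qed.
Let dD x y : d (x + y) = d x + d y.
Proof. by rewrite -[x]scale1r d_lin !scale1r. Qed.
Let d0 : d 0 = 0.
Proof. by have := d_lin (-1) 0 0; rewrite !scaleN1r oppr0 addr0 addNr. Qed.
Let dN x : d (- x) = - d x.
Proof. by rewrite -scaleN1r -[_ *: _]addr0 d_lin d0 addr0 scaleN1r. Qed.
Let HD x y : H (x + y) = H x + H y.
Proof. by rewrite -[x]scale1r H_lin !scale1r. Qed.
Let H0 : H 0 = 0.
Proof. by have := H_lin (-1) 0 0; rewrite !scaleN1r oppr0 addr0 addNr. Qed.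
Let HN x : H (- x) = - H x.
Proof. by rewrite -scaleN1r -[_ *: _]addr0 H_lin H0 addr0 scaleN1r. Qed.
Let WD x y : W (x + y) = W x + W y.
Proof. by rewrite -[x]scale1r W_lin !scale1r. Qed.
Let W0 : W 0 = 0.
Proof. by have := W_lin (-1) 0 0; rewrite !scaleN1r oppr0 addr0 addNr. Qed.
Let WN x : W (- x) = - W x.
Proof. by rewrite -scaleN1r -[_ *: _]addr0 W_lin W0 addr0 scaleN1r. Qed.

Let lin := (mulDl, mulDr, mulNl, mulNr, mul0l, mul0r, dD, HD, WD, dN, HN, WN,
  d0, H0, W0, scaleN1r, scale1r).

(** Under an outer W an inner H W may be dropped, because W moves through products and d, and W H W
    = W. This rule and its variants normalise the terms created by [kerP]. *)
Let WHWl x y : W (H (W x) ** y) = W (x ** y).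
Proof. by rewrite -mulWl WHW mulWl. Qed.
Let WHWr x y : W (x ** H (W y)) = W (x ** y).
Proof. by rewrite -mulWr WHW mulWr. Qed.
Let WHWl2 x y z : W (H (W x) ** y ** z) = W (x ** y ** z).
Proof. by rewrite -mulA WHWl mulA. Qed.
Let WHWm x y z : W (x ** H (W y) ** z) = W (x ** y ** z).
Proof. by rewrite -mulWl WHWr mulWl. Qed.
Let WdHW x : W (d (H (W x))) = W (d x).
Proof. by rewrite -dW WHW dW. Qed.
Let WdHWl x y : W (d (H (W x)) ** y) = W (d x ** y).
Proof. by rewrite -mulWl WdHW mulWl. Qed.
Let WdHWr x y : W (x ** d (H (W y))) = W (x ** d y).
Proof. by rewrite -mulWr WdHW mulWr. Qed.
(** Oriented as a rewriting system: once everything is distributed, the relations become identities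
    between integer combinations of normal forms. *)
Let Wrules := (WHW, HWH, WHWl, WHWr, WHWl2, WHWm, WdHW, WdHWl, WdHWr, mulWl, mulWr, dW, dd, mulA).

Local Ltac norm := rewrite /M1 /M2 /M3 /cokP /kerP /G /T /=.

Lemma cone_stasheff1 u : W u.2 = 0 -> M1 (M1 u) = 0.
Proof.
case: u => x y /= Wy; apply: injective_projections; norm;
  by rewrite !(Wy, lin, Wrules); ZmodTac.zmod.
Qed.

Lemma cone_stasheff2 a u v : good a u -> W v.2 = 0 ->
  M1 (M2 a u v) = M2 (~~ a) (M1 u) v + sg a *: M2 a u (M1 v).
Proof.
case: u v => x y [x' y'] [/= px py Wy] Wy'.
have px' := par_d px.
(* H (d x) occurs as a left factor under d, so the Leibniz rule needs its parity. *)
have pHx := par_H px'.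
(* Products with an element of the kernel of W stay in that kernel. *)
have E1 z : W (y ** z) = 0 by rewrite -mulWl Wy mul0l.
have E2 z : W (z ** y') = 0 by rewrite -mulWr Wy' mul0r.
have Wdy' : W (d y') = 0 by rewrite -dW Wy' d0.
have E3 z : W (z ** d y') = 0 by rewrite -mulWr Wdy' mul0r.
have l1 z := @leib _ _ z px; have l2 z := @leib _ _ z py.
have l3 z := @leib _ _ z px'; have l4 z := @leib _ _ z pHx.
pose rules := (Wy, Wy', E1, E2, E3, l1, l2, l3, l4, lin, Wrules).
apply: injective_projections; norm; clearbody rules; clear px py px' pHx l1 l2 l3 l4;
  by case: a rules => rules; rewrite /= ?expr0 ?expr1 !rules; ZmodTac.zmod.
Qed.

Let WHWl3 x y z t : W (H (W x) ** y ** z ** t) = W (x ** y ** z ** t).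
Proof. by rewrite -(mulWl _ t) WHWl2 mulWl. Qed.
Let WHWm2 x y z t : W (x ** H (W y) ** z ** t) = W (x ** y ** z ** t).
Proof. by rewrite -(mulWl _ t) WHWm mulWl. Qed.

(** Differentiating the two trees of [cone_triple] by the Leibniz rule produces both the associator
    of M2 and the terms in which one argument is differentiated. *)
Lemma cone_stasheff3 a b (u v w : A * A) :
  good a u -> good b v -> W w.2 = 0 ->
  M1 (M3 u v w) + M3 (M1 u) v w + sg a *: M3 u (M1 v) w
  + (sg a * sg b) *: M3 u v (M1 w)
  + M2 (a (+) b) (M2 a u v) w - M2 a u (M2 b v w) = 0.
Proof.
case: u v w => x y [x' y'] [x'' y''] [/= px py Wy] [/= px' py' Wy'] Wy''.
(* H (x x') is a left factor in [cone_triple], to which M1 applies d. *)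
have pH := par_H (par_mul px px').
have l1 z := @leib _ _ z px; have l2 z := @leib _ _ z px'.
have l3 z := @leib _ _ z pH.
have E1 z : W (y ** z) = 0 by rewrite -mulWl Wy mul0l.
have E1' z t : W (y ** z ** t) = 0 by rewrite -mulWl E1 mul0l.
have E2 z : W (z ** y'') = 0 by rewrite -mulWr Wy'' mul0r.
have E3 z t : W (z ** y' ** t) = 0 by rewrite -mulWl -mulWr Wy' mul0r mul0l.
pose rules := (Wy, Wy', Wy'', E1, E1', E2, E3, l1, l2, l3, lin, WHWl3, WHWm2, Wrules).
apply: injective_projections; norm; clearbody rules;
  clear px py px' py' pH l1 l2 l3;
  by case: a b rules => -[] rules;
    rewrite /= ?expr0 ?expr1 ?mulrNN ?mulr1 ?mul1r ?scale1r ?scaleN1r !rules;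
    ZmodTac.zmod.
Qed.

(** The differential only meets zero entries here. What is left follows from associativity and the
    rules for W, and the two signs in front of u cancel. *)
Lemma cone_stasheff4 a b c (u v w t : A * A) :
  - M2 c (M3 u v w) t - sg a *: M2 a u (M3 v w t)
  + M3 (M2 a u v) w t - M3 u (M2 b v w) t + M3 u v (M2 c w t) = 0.
Proof.
case: u v w t => x0 y0 [x1 y1] [x2 y2] [x3 y3].
have sgsg z : sg a *: (sg a *: z) = z by rewrite scalerA -signr_addb addbb scale1r.
pose rules := (lin, sgsg, WHWl3, WHWm2, Wrules, @scaler0 F A, @oppr0 A, @add0r A,
  @addr0 A, @scalerN F A, @scalerDr F A).
apply: injective_projections; norm; clearbody rules; clear sgsg;
  by rewrite !rules; ZmodTac.zmod.
Qed.

End Contraction.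

(** * Multilinearity of the transferred operations *)

Section Linearity.
Context {F : fieldType} {A : lmodType F}.
Variables (mul : A -> A -> A) (d H W : A -> A).
Hypotheses
  (mulPl : forall (k : F) x y z, mul (k *: x + y) z = k *: mul x z + mul y z)
  (mulPr : forall (k : F) x y z, mul z (k *: x + y) = k *: mul z x + mul z y)
  (dP : forall (k : F) x y, d (k *: x + y) = k *: d x + d y)
  (HP : forall (k : F) x y, H (k *: x + y) = k *: H x + H y)
  (WP : forall (k : F) x y, W (k *: x + y) = k *: W x + W y).
Implicit Types (u v w t : A * A) (k : F).
Local Notation M1 := (cone_m1 d H W).
Local Notation M2 := (cone_m2 mul d H W).
Local Notation M3 := (cone_m3 mul H W).

Let cokP_lin k x y : cokP H W (k *: x + y) = k *: cokP H W x + cokP H W y.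
Proof. by rewrite /cokP !(HP, WP) scalerBr; ZmodTac.zmodu. Qed.
Let kerP_lin k x y : kerP H W (k *: x + y) = k *: kerP H W x + kerP H W y.
Proof. by rewrite /kerP !(HP, WP) scalerBr; ZmodTac.zmodu. Qed.

Let G_lin_l a k x y z : cone_mixed mul d H a (k *: x + y) z =
  k *: cone_mixed mul d H a x z + cone_mixed mul d H a y z.
Proof.
rewrite /cone_mixed !(mulPl, mulPr, HP, dP) !scalerDr !scalerN !scalerA [k * _]mulrC.
ZmodTac.zmodu.
Qed.

Let G_lin_r a k x y z : cone_mixed mul d H a z (k *: x + y) =
  k *: cone_mixed mul d H a z x + cone_mixed mul d H a z y.
Proof.
rewrite /cone_mixed !(mulPl, mulPr, HP, dP) !scalerDr !scalerN !scalerA [k * _]mulrC.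
ZmodTac.zmodu.
Qed.

Lemma cone_m1_linear k u v : M1 (k *: u + v) = k *: M1 u + M1 v.
Proof.
case: u v => x y [x' y']; rewrite /cone_m1; apply: injective_projections => /=.
  by rewrite dP cokP_lin.
rewrite !(dP, HP) kerP_lin; move: (kerP H W) => K.
by rewrite !scalerDr !scalerN; ZmodTac.zmodu.
Qed.

Lemma cone_m2_linear_l a k u v w : M2 a (k *: u + v) w = k *: M2 a u w + M2 a v w.
Proof.
case: u v w => x y [x' y'] [x'' y'']; rewrite /cone_m2.
apply: injective_projections => /=; first by rewrite mulPl cokP_lin.
rewrite G_lin_l kerP_lin !mulPl; move: (kerP H W) (cone_mixed _ _ _ _) => K g.
by rewrite !scalerDr !scalerA [k * _]mulrC; ZmodTac.zmodu.
Qed.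

Lemma cone_m2_linear_r a k u v w : M2 a w (k *: u + v) = k *: M2 a w u + M2 a w v.
Proof.
case: u v w => x y [x' y'] [x'' y'']; rewrite /cone_m2.
apply: injective_projections => /=; first by rewrite mulPr cokP_lin.
rewrite G_lin_r kerP_lin !mulPr; move: (kerP H W) (cone_mixed _ _ _ _) => K g.
by rewrite !scalerDr !scalerA [k * _]mulrC; ZmodTac.zmodu.
Qed.

Let T_lin k x1 x2 x3 x : 
  [/\ cone_triple mul H (k *: x1 + x) x2 x3 = k *: cone_triple mul H x1 x2 x3 + cone_triple mul H x x2 x3,
      cone_triple mul H x2 (k *: x1 + x) x3 = k *: cone_triple mul H x2 x1 x3 + cone_triple mul H x2 x x3 &
      cone_triple mul H x2 x3 (k *: x1 + x) = k *: cone_triple mul H x2 x3 x1 + cone_triple mul H x2 x3 x].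
Proof.
by split; rewrite /cone_triple !(HP, mulPl, mulPr) scalerBr; ZmodTac.zmodu.
Qed.

Lemma cone_m3_linear k u v w t :
  [/\ M3 (k *: u + v) w t = k *: M3 u w t + M3 v w t,
      M3 w (k *: u + v) t = k *: M3 w u t + M3 w v t &
      M3 w t (k *: u + v) = k *: M3 w t u + M3 w t v].
Proof.
have [h1 h2 h3] := T_lin k u.1 w.1 t.1 v.1.
by split; rewrite /cone_m3; apply: injective_projections => /=;
  rewrite ?scaler0 ?addr0 // -kerP_lin; congr kerP.
Qed.

End Linearity.

From mathcomp Require Import all_classical all_reals all_analysis.

Import numFieldNormedType.Exports.

Local Open Scope classical_set_scope.
Local Open Scope ring_scope.

(** * Smooth functions *)

Section SmoothCalculus.
Context {R : realType} {m : nat}.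
Implicit Types (U : set 'rV[R]_m) (f g : 'rV[R]_m -> R^o) (a b : 'I_m).
Implicit Types (k : nat) (u v e : 'rV[R]_m).

Lemma near_of_open U u (P : 'rV[R]_m -> Prop) :
  open U -> U u -> (forall v, U v -> P v) -> \forall v \near u, P v.
Proof. by move=> oU Uu UP; apply: filterS (open_nbhs_nbhs (conj oU Uu)). Qed.

Lemma eq_on_derive U f g u v : open U -> U u ->
  (forall w, U w -> f w = g w) -> 'D_v f u = 'D_v g u.
Proof.
by move=> oU Uu fg; apply: near_eq_derive; apply: near_of_open fg.
Qed.

Lemma eq_on_derivable U f g u v : open U -> U u ->
  (forall w, U w -> f w = g w) -> derivable f u v -> derivable g u v.
Proof.
by move=> oU Uu fg; apply: near_eq_derivable; apply: near_of_open fg.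
Qed.

Lemma eq_on_continuous U f g u : open U -> U u ->
  (forall w, U w -> f w = g w) -> {for u, continuous f} ->
  {for u, continuous g}.
Proof.
move=> oU Uu fg cf; have : f @ u --> f u := cf.
suff : f @ u --> f u -> g @ u --> g u by [].
rewrite -(fg u Uu); apply: cvg_trans; apply: (@near_eq_cvg _ _ (nbhs u)).
by apply: (near_of_open oU Uu) => w Uw; rewrite fg.
Qed.

(** Derivatives at points of an open set depend only on the values there, so a function may be
    replaced by any formula valid on U. *)
Lemma eq_on_class_C k U f g : open U -> (forall w, U w -> f w = g w) ->
  class_C k U f -> class_C k U g.
Proof.
move=> oU; elim: k f g => [|k IH] f g fg /= [cf df]; split.
1,3: by move=> u Uu; apply: (eq_on_continuous oU Uu fg); exact: cf.
- by [].
- move=> a; have [da ca] := df a; split.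
  + by move=> u Uu; apply: eq_on_derivable fg _ => //; exact: da.
  + by apply: IH ca => u Uu; exact: eq_on_derive fg.
Qed.

Lemma class_CW k U f : class_C k.+1 U f -> class_C k U f.
Proof.
elim: k f => [|k IH] f; first by case.
move=> [cf df]; split=> [|a]; first exact: cf.
by have [da ca] := df a; split; [exact: da | exact: (IH _ ca)].
Qed.

Lemma class_C_cst k U (c : R) : class_C k U (fun=> c).
Proof.
elim: k c => [|k IH] c /=.
  by split=> // u _; exact: (@cst_continuous _ _ (c : R^o) u).
split=> [u _|a]; first exact: (@cst_continuous _ _ (c : R^o) u).
split; first by move=> u _; exact: derivable_cst.
have -> : pderiv a (fun=> c : R^o) = fun=> 0.
  by apply/funext => u; exact: derive_cst.
exact: IH.
Qed.

Lemma derivableDf f g u v : derivable f u v -> derivable g u v ->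
  derivable (fun w => f w + g w : R^o) u v /\
  'D_v (fun w => f w + g w : R^o) u = 'D_v f u + 'D_v g u.
Proof. by move=> df dg; split; [exact: derivableD | exact: deriveD]. Qed.

Lemma derivableMf f g u v : derivable f u v -> derivable g u v ->
  derivable (fun w => f w * g w : R^o) u v /\
  'D_v (fun w => f w * g w : R^o) u = f u * 'D_v g u + g u * 'D_v f u.
Proof. by move=> df dg; split; [exact: derivableM | exact: deriveM]. Qed.

Lemma class_CD k U f g : open U -> class_C k U f -> class_C k U g ->
  class_C k U (fun w => f w + g w).
Proof.
move=> oU; elim: k f g => [|k IH] f g /= [cf df] [cg dg]; split.
1,3: by move=> u Uu; exact: (cvgD (cf u Uu) (cg u Uu)).
- by [].
- move=> a; have [daf caf] := df a; have [dag cag] := dg a; split.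
  + by move=> u Uu; exact: (derivableDf (daf u Uu) (dag u Uu)).1.
  + apply: (@eq_on_class_C _ _ (fun w => pderiv a f w + pderiv a g w)) => //.
      by move=> u Uu; rewrite /pderiv (derivableDf (daf u Uu) (dag u Uu)).2.
    exact: IH.
Qed.

(** The product rule multiplies derivatives of class k by the functions themselves, whose class is
    first lowered from k + 1 to k. *)
Lemma class_CM k U f g : open U -> class_C k U f -> class_C k U g ->
  class_C k U (fun w => f w * g w).
Proof.
move=> oU; elim: k f g => [|k IH] f g F G.
  by move: F G => /= [cf df] [cg dg]; split=> // u Uu;
    exact: (cvgM (cf u Uu) (cg u Uu)).
have F' := class_CW F; have G' := class_CW G.
move: F G => [cf df] [cg dg]; split.
  by move=> u Uu; exact: (cvgM (cf u Uu) (cg u Uu)).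
move=> a; have [daf caf] := df a; have [dag cag] := dg a; split.
  by move=> u Uu; exact: (derivableMf (daf u Uu) (dag u Uu)).1.
apply: (@eq_on_class_C _ _
  (fun w => f w * pderiv a g w + g w * pderiv a f w)) => //.
  by move=> u Uu; rewrite /pderiv (derivableMf (daf u Uu) (dag u Uu)).2.
by apply: class_CD => //; exact: IH.
Qed.

(** The derivative of 1/f is a product of copies of 1/f, covered by the induction hypothesis, with a
    derivative of f. *)
Lemma class_CV k U f : open U -> (forall u, U u -> f u != 0) ->
  class_C k U f -> class_C k U (fun w => (f w)^-1).
Proof.
move=> oU f0; elim: k => [|k IH] F.
  by move: F => /= [cf df]; split=> // u Uu; exact: (cvgV (f0 u Uu) (cf u Uu)).
have F' := IH (class_CW F).
move: F => [cf df]; split.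
  by move=> u Uu; exact: (cvgV (f0 u Uu) (cf u Uu)).
move=> a; have [daf caf] := df a; split.
  by move=> u Uu; apply: derivableV; [exact: f0 | exact: daf].
apply: (@eq_on_class_C _ _
  (fun w => (-1) * (((f w)^-1 * (f w)^-1) * pderiv a f w))) => //.
  move=> u Uu; rewrite /pderiv deriveV ?f0 //; last exact: daf.
  by rewrite expr2 invfM mulN1r -mulNr.
by apply: class_CM => //; [exact: class_C_cst | do 2!apply: class_CM => //].
Qed.

Lemma eq_on_smooth U f g : open U -> (forall w, U w -> f w = g w) ->
  smooth_on U f -> smooth_on U g.
Proof. by move=> oU fg sf k; apply: eq_on_class_C fg _. Qed.

Lemma smooth_cst U (c : R) : smooth_on U (fun=> c).
Proof. by move=> k; exact: class_C_cst. Qed.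

Lemma smoothD U f g : open U -> smooth_on U f -> smooth_on U g ->
  smooth_on U (fun w => f w + g w).
Proof. by move=> oU sf sg k; exact: class_CD. Qed.

Lemma smoothM U f g : open U -> smooth_on U f -> smooth_on U g ->
  smooth_on U (fun w => f w * g w).
Proof. by move=> oU sf sg k; exact: class_CM. Qed.

Lemma smoothV U f : open U -> (forall u, U u -> f u != 0) ->
  smooth_on U f -> smooth_on U (fun w => (f w)^-1).
Proof. by move=> oU f0 sf k; exact: class_CV. Qed.

Lemma smooth_sum (I : Type) (s : seq I) (P : pred I) U
    (F : I -> 'rV[R]_m -> R^o) : open U ->
  (forall i, P i -> smooth_on U (F i)) ->
  smooth_on U (fun w => \sum_(i <- s | P i) F i w).
Proof.
move=> oU sF; elim: s => [|i s IH].
  apply: (@eq_on_smooth U (fun=> 0)) => //; last exact: smooth_cst.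
  by move=> w _; rewrite big_nil.
have [Pi|Pi] := boolP (P i); last first.
  by apply: eq_on_smooth IH => // w _; rewrite big_cons (negbTE Pi).
apply: eq_on_smooth (smoothD oU (sF i Pi) IH) => // w _.
by rewrite big_cons Pi.
Qed.

Lemma smooth_prod (I : Type) (s : seq I) (P : pred I) U
    (F : I -> 'rV[R]_m -> R^o) : open U ->
  (forall i, P i -> smooth_on U (F i)) ->
  smooth_on U (fun w => \prod_(i <- s | P i) F i w).
Proof.
move=> oU sF; elim: s => [|i s IH].
  apply: (@eq_on_smooth U (fun=> 1)) => //; last exact: smooth_cst.
  by move=> w _; rewrite big_nil.
have [Pi|Pi] := boolP (P i); last first.
  by apply: eq_on_smooth IH => // w _; rewrite big_cons (negbTE Pi).
apply: eq_on_smooth (smoothM oU (sF i Pi) IH) => // w _.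
by rewrite big_cons Pi.
Qed.

Lemma smooth_derivable U f u a : smooth_on U f -> U u ->
  derivable f u (delta_mx 0 a).
Proof. by move=> /(_ 1%N) [_ /(_ a) [+ _]] Uu; apply. Qed.

Lemma smooth_pderiv U f a : smooth_on U f -> smooth_on U (pderiv a f).
Proof. by move=> sf k; have [_ /(_ a) []] := sf k.+1. Qed.

(** Bounding c by absolute value covers both signs of h and is enough to keep the intermediate point
    in a given ball. *)
Lemma mvt_line f u e (h : R) :
  (forall t : R, `|t| <= `|h| -> derivable f (u + t *: e) e) ->
  exists2 c : R, `|c| <= `|h| & f (u + h *: e) - f u = h * 'D_e f (u + c *: e).
Proof.
move=> df.
pose g (t : R) : R := f (u + t *: e).
have dg t : `|t| <= `|h| -> is_derive t (1 : R) g ('D_e f (u + t *: e)).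
  move=> th; have eqf : (fun s : R => s^-1 *: ((g \o shift t) (s *: 1) - g t)) =
      (fun s : R => s^-1 *: ((f \o shift (u + t *: e)) (s *: e) - f (u + t *: e))).
    apply/funext => s /=; congr (_ *: (_ - _)).
    by rewrite /g /shift /= scalerDl [_ *: 1]mulr1; congr f; rewrite addrCA.
  by split; [rewrite /derivable eqf; exact: df | rewrite /derive eqf].
have cg (x y : R) : (forall t, t \in `[x, y]%R -> `|t| <= `|h|) ->
    {within `[x, y], continuous g}.
  move=> xy; apply: derivable_within_continuous => t /xy /dg; case; done.
have [h0|h0] := leP 0 h.
  have Ht t : t \in `[0, h]%R -> `|t| <= `|h|.
    by rewrite in_itv /= => /andP[t0 th]; rewrite !ger0_norm.
  have [c ch Ec] := @MVT_segment _ g (fun t => 'D_e f (u + t *: e)) 0 h h0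
    (fun t tI => dg t (Ht t (subset_itv_oo_cc tI))) (cg _ _ Ht).
  exists c; first exact: Ht.
  by move: Ec; rewrite /g scale0r addr0 subr0 mulrC.
have Ht t : t \in `[h, 0]%R -> `|t| <= `|h|.
  rewrite in_itv /= => /andP[t0 th]; rewrite !ler0_norm ?lerN2 //.
  exact: ltW.
have [c ch Ec] := @MVT_segment _ g (fun t => 'D_e f (u + t *: e)) h 0 (ltW h0)
    (fun t tI => dg t (Ht t (subset_itv_oo_cc tI))) (cg _ _ Ht).
exists c; first exact: Ht.
move: Ec; rewrite /g scale0r addr0 sub0r mulrN => Ec.
by rewrite -opprB Ec opprK mulrC.
Qed.

Lemma norm_delta (t : R) a : `|t *: delta_mx 0 a : 'rV[R]_m| <= `|t|.
Proof.
rewrite normrZ ler_piMr //.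
rewrite [leLHS]/Num.Def.normr/= mx_normrE (bigmax_le _ ler01) //= => -[i j] _.
by rewrite mxE; case: (_ && _); rewrite ?normr1 ?normr0.
Qed.

Lemma continuous_epsdelta f u (e : R) : {for u, continuous f} -> 0 < e ->
  \forall v \near u, `|f v - f u| < e.
Proof.
by move=> /cvgrPdist_lt cf e0; near=> v; rewrite distrC; near: v; exact: cf.
Unshelve. all: by end_near. Qed.

Lemma near_norm_ball u (P : 'rV[R]_m -> Prop) : (\forall v \near u, P v) ->
  exists2 d : R, 0 < d & forall v, `|v - u| < d -> P v.
Proof.
move=> /nbhs_ballP[d /= d0 dP]; exists d => // v vu; apply: dP.
by rewrite -ball_normE /= distrC.
Qed.

End SmoothCalculus.

(** * Symmetry of second partial derivatives *)

Section SmoothCalculus2.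
Context {R : realType} {m : nat}.
Implicit Types (U : set 'rV[R]_m) (f g : 'rV[R]_m -> R^o) (a b : 'I_m).
Implicit Types (k : nat) (u v e : 'rV[R]_m).

(** The second difference of f along two axes, divided by the square of the step, is a value of
    either mixed derivative near u; continuity of both derivatives then forces equality at u. *)
Lemma pderivC U f a b u : open U -> U u -> class_C 2 U f ->
  pderiv a (pderiv b f) u = pderiv b (pderiv a f) u.
Proof.
move=> oU Uu [_ /= C2].
have key c c' (e : R) : 0 < e -> exists2 d : R, 0 < d & forall s : R, 0 < s < d ->
    exists2 r, `|r - pderiv c' (pderiv c f) u| < e &
    f (u + s *: delta_mx 0 c + s *: delta_mx 0 c') - f (u + s *: delta_mx 0 c)
    - f (u + s *: delta_mx 0 c') + f u = s * (s * r).
  move=> e0; have [d1 [_ /(_ c') [d2 [c2 _]]]] := C2 c.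
  have [d d0 Pd] : exists2 d : R, 0 < d & forall v, `|v - u| < d ->
     U v /\ `|pderiv c' (pderiv c f) v - pderiv c' (pderiv c f) u| < e.
    apply: near_norm_ball; near=> v; split.
      by near: v; exact: (near_of_open oU Uu).
    by near: v; apply: continuous_epsdelta => //; exact: c2.
  exists (d / 2); first by rewrite divr_gt0.
  move=> s /andP[s0 sd].
  have Bd (t t' : R) : `|t| <= `|s| -> `|t'| <= `|s| ->
      `|u + t *: delta_mx 0 c + t' *: delta_mx 0 c' - u| < d.
    move=> ts ts'; rewrite -(addrA u) (addrC _ (- u)) addKr.
    rewrite (le_lt_trans (ler_normD _ _)) // (splitr d) ltrD //.
      by rewrite (le_lt_trans (norm_delta _ _)) // (le_lt_trans ts) // gtr0_norm.
    by rewrite (le_lt_trans (norm_delta _ _)) // (le_lt_trans ts') // gtr0_norm.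
  have Bd0 (t : R) : `|t| <= `|s| -> `|u + t *: delta_mx 0 c - u| < d.
    by move=> ts; have := Bd t 0 ts; rewrite scale0r addr0 normr0; apply.
  (* The mean value theorem is used twice: for the difference [g] along c, then for the partial
     derivative of f along c'. *)
  pose g v := f (v + s *: delta_mx 0 c') - f v : R^o.
  have dgs t : `|t| <= `|s| ->
      is_derive (u + t *: delta_mx 0 c) (delta_mx 0 c) g
        (pderiv c f (u + t *: delta_mx 0 c + s *: delta_mx 0 c') -
         pderiv c f (u + t *: delta_mx 0 c)).
    move=> ts; apply: is_deriveB.
      have Uv := (Pd _ (Bd t s ts (lexx _))).1.
      have := derivableP (d1 _ Uv).
      set v := u + t *: delta_mx 0 c => -[Dv Ev].
      have eqf : (fun h : R => h^-1 *: (((fun v => f (v + s *: delta_mx 0 c')) \o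
            shift v) (h *: delta_mx 0 c) - f (v + s *: delta_mx 0 c'))) =
          (fun h : R => h^-1 *: ((f \o shift (v + s *: delta_mx 0 c'))
             (h *: delta_mx 0 c) - f (v + s *: delta_mx 0 c'))).
        apply/funext => h /=. by rewrite -(addrA (h *: _) v).
      by split; [rewrite /derivable eqf | rewrite /derive eqf].
    by apply: derivableP; apply: d1; exact: (Pd _ (Bd0 t ts)).1.
  have [t ts Et] := @mvt_line _ _ g u (delta_mx 0 c) s
     (fun t ts => @ex_derive _ _ _ _ _ _ _ (dgs t ts)).
  have [t' ts' Et'] := @mvt_line _ _ (pderiv c f) (u + t *: delta_mx 0 c)
     (delta_mx 0 c') s (fun t' ts' => d2 _ (Pd _ (Bd t t' ts ts')).1).
  exists (pderiv c' (pderiv c f) (u + t *: delta_mx 0 c + t' *: delta_mx 0 c')).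
    exact: (Pd _ (Bd t t' ts ts')).2.
  move: Et; have [_ ->] := dgs t ts; rewrite Et' => <-.
  by rewrite /g opprB addrA; ring.
apply/eqP; rewrite -subr_eq0 -normr_le0; apply/ler_addgt0Pl => e e0.
rewrite addr0.
have e20 : 0 < e / 2 by rewrite divr_gt0.
have [d1 d10 P1] := key a b _ e20; have [d2 d20 P2] := key b a _ e20.
pose s := Num.min d1 d2 / 2.
have m0 : 0 < Num.min d1 d2 by rewrite lt_min d10.
have s0 : 0 < s by rewrite divr_gt0.
have sm : s < Num.min d1 d2 by rewrite ltr_pdivrMr // ltr_pMr // ltr1n.
have [|r1 r1e E1] := P1 s.
  by rewrite s0 (lt_le_trans sm) // ge_min lexx.
have [|r2 r2e E2] := P2 s.
  by rewrite s0 (lt_le_trans sm) // ge_min lexx orbT.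
(* The second difference is symmetric in the two directions, so for a common step both orders give
   the same quotient. *)
have Er : r1 = r2.
  apply: (mulfI (lt0r_neq0 s0)); apply: (mulfI (lt0r_neq0 s0)).
  rewrite -E1 -E2 -!addrA; rewrite [s *: delta_mx 0 a + _]addrC.
  by rewrite [- f (u + s *: delta_mx 0 a) + _]addrCA.
rewrite Er in r1e.
move: r1e r2e; move: (pderiv a _ u) (pderiv b _ u) => x y r1e r2e.
have /= := ltrD r1e r2e; rewrite -splitr => /ltW; apply: le_trans.
have -> : x - y = (r2 - y) - (r2 - x) :> R by ring.
exact: (@ler_normB R R).
Unshelve. all: by end_near. Qed.

End SmoothCalculus2.

(** * Continuously differentiable functions are differentiable *)

Section SmoothCalculus3.
Context {R : realType} {m : nat}.
Implicit Types (U : set 'rV[R]_m) (f g : 'rV[R]_m -> R^o) (a b : 'I_m).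
Implicit Types (k : nat) (u v e h : 'rV[R]_m).

(** The k-th vertex of the path from 0 to h that changes one coordinate at a time. *)
Definition trunc_row k h : 'rV[R]_m := \row_a (if (a < k)%N then h 0 a else 0).

Lemma trunc_rowS a h :
  trunc_row a.+1 h = trunc_row a h + h 0 a *: delta_mx 0 a.
Proof.
apply/rowP => b; rewrite !mxE eqxx /= ltnS leq_eqVlt val_eqE.
case: eqVneq => [->|ba]; first by rewrite ltnn mulr1 add0r.
by rewrite mulr0 addr0.
Qed.

Lemma le_norm_row h a : `|h 0 a| <= `|h|.
Proof.
rewrite [leRHS]/Num.Def.normr/= mx_normrE.
exact: (le_bigmax _ (fun i => `|h i.1 i.2|) (0, a)).
Qed.

(** In the sup norm the whole coordinate path stays in the ball of radius |h|. *)
Lemma norm_trunc_row a h (t : R) : `|t| <= `|h 0 a| ->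
  `|trunc_row a h + t *: delta_mx 0 a| <= `|h|.
Proof.
move=> th; rewrite [leLHS]/Num.Def.normr/= mx_normrE.
rewrite (bigmax_le _ (normr_ge0 _)) //= => -[i b] _ /=.
rewrite (ord1 i) !mxE eqxx /=; case: ltnP => ab.
  have -> : (b == a) = false by rewrite -val_eqE ltn_eqF.
  by rewrite mulr0 addr0 le_norm_row.
case: eqVneq => [_|ba]; last by rewrite mulr0 addr0 normr0.
by rewrite mulr1 add0r (le_trans th) // le_norm_row.
Qed.

Definition grad f u : 'cV[R]_m := \col_a pderiv a f u.

(** [class_C] only speaks of partial derivatives, while the chain rule needs the total derivative.
    The increment is telescoped over coordinate steps, each estimated by the mean value theorem. *)
Lemma differentiable_C1 U f u : open U -> U u -> class_C 1 U f ->
  differentiable f u.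
Proof.
move=> oU Uu [_ C1].
pose D h : R^o := (h *m grad f u) 0 0.
have lD : linear D by move=> c x y; rewrite /D mulmxDl -scalemxAl !mxE.
pose DM := GRing.isLinear.Build _ _ _ _ _ lD.
pose DL : {linear 'rV[R]_m -> R^o} := HB.pack D DM.
have bD h : `|D h| <= (\sum_a `|grad f u a 0|) * `|h|.
  rewrite /D mxE mulr_suml (le_trans (ler_norm_sum _ _ _)) // ler_sum // => a _.
  by rewrite normrM mulrC ler_wpM2l // le_norm_row.
have cD : continuous DL.
  apply: bounded_linear_continuous; apply/ex_bound.
  exists (\sum_a `|grad f u a 0|); near=> h.
  have h1 : `|h| <= 1.
    near: h; have := nbhsx_ballx (0 : 'rV[R]_m) _ ltr01.
    by apply: filterS => h; rewrite -ball_normE /= sub0r normrN => /ltW.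
  by apply: (le_trans (bD h)); rewrite ler_piMr // sumr_ge0.
suff E : f \o shift u = cst (f u) + DL +o_ (0 : 'rV[R]_m) id.
  by apply/diff_locallyP; rewrite (diff_unique cD E); split.
apply/eqaddoP => _/posnumP[eps].
(* Each of the m coordinate steps contributes at most e |h|; adding 1 keeps the denominator positive
   when m = 0. *)
pose e := eps%:num / (m%:R + 1).
have m1 : 0 < m%:R + 1 :> R by rewrite ltr_wpDl.
have e0 : 0 < e by rewrite divr_gt0.
have [d d0 Pd] : exists2 d : R, 0 < d & forall v, `|v - u| < d ->
     U v /\ forall a, `|pderiv a f v - pderiv a f u| < e.
  apply: near_norm_ball; near=> v; split.
    by near: v; exact: (near_of_open oU Uu).
  near: v; apply: filter_forall => a; apply: continuous_epsdelta => //.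
  by have [_ [+ _]] := C1 a; apply.
near=> h.
have hd : `|h| < d.
  near: h; have := nbhsx_ballx (0 : 'rV[R]_m) _ d0.
  by apply: filterS => h; rewrite -ball_normE /= sub0r normrN.
have step a : `|f (u + trunc_row a.+1 h) - f (u + trunc_row a h)
    - h 0 a * pderiv a f u| <= e * `|h|.
  have B (t : R) : `|t| <= `|h 0 a| ->
      `|u + trunc_row a h + t *: delta_mx 0 a - u| < d.
    move=> th; rewrite -(addrA u) (addrC _ (- u)) addKr.
    exact: le_lt_trans (norm_trunc_row th) hd.
  have [c ch E] := @mvt_line _ _ f (u + trunc_row a h) (delta_mx 0 a) (h 0 a)
    (fun t th => (C1 a).1 _ (Pd _ (B t th)).1).
  rewrite trunc_rowS addrA E -mulrBr normrM mulrC.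
  rewrite ler_pM // ?le_norm_row //.
  exact: ltW ((Pd _ (B c ch)).2 a).
have tele : f (u + h) - f u =
    \sum_(a < m) (f (u + trunc_row a.+1 h) - f (u + trunc_row a h)).
  rewrite -(big_mkord xpredT
    (fun k => f (u + trunc_row k.+1 h) - f (u + trunc_row k h))).
  rewrite telescope_sumr //; congr (f (u + _) - f _).
    by apply/rowP => a; rewrite mxE ltn_ord.
  rewrite (_ : trunc_row 0 h = 0) ?addr0 //.
  by apply/rowP => a; rewrite !mxE.
have -> : (f \o shift u - (cst (f u) + DL)) h =
    \sum_(a < m) (f (u + trunc_row a.+1 h) - f (u + trunc_row a h)
            - h 0 a * pderiv a f u).
  rewrite sumrB -tele.
  have -> : \sum_a h 0 a * pderiv a f u = D h.
    by rewrite /D mxE; apply: eq_bigr => a _; rewrite mxE.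
  by rewrite -addrA -opprD [u + h]addrC.
rewrite (le_trans (ler_norm_sum _ _ _)) //.
apply: (@le_trans _ _ (\sum_(a < m) e * `|h|)).
  by apply: ler_sum => a _; exact: step.
rewrite sumr_const card_ord -[leLHS]mulr_natl mulrA ler_wpM2r //.
rewrite /e mulrA ler_pdivrMr // mulrC ler_wpM2l // lerDl //.
Unshelve. all: by end_near. Qed.

End SmoothCalculus3.

(** * The chain rule for maps of row vectors *)

Section ChainRule.
Context {R : realType} {m : nat}.
Implicit Types (U : set 'rV[R]_m) (f : 'rV[R]_m -> R^o) (a b c : 'I_m).
Implicit Types (phi : 'rV[R]_m -> 'rV[R]_m).

Lemma differentiable_row phi u :
  (forall b, differentiable (fun v => phi v 0 b : R^o) u) ->
  differentiable phi u.
Proof.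
move=> dphi.
have -> : phi = \sum_(b < m) (fun v => (phi v 0 b : R^o) *: (delta_mx 0 b : 'rV[R]_m)).
  apply/funext => v; rewrite fct_sumE; apply/rowP => b.
  rewrite summxE (bigD1 b) //= big1 => [|b' b'b]; rewrite !mxE ?eqxx ?mulr1 ?addr0 //.
  by rewrite eq_sym (negbTE b'b) mulr0.
apply: differentiable_sum => b.
exact: differentiableZl.
Qed.

Lemma smooth_map_differentiable U phi u : open U -> U u ->
  (forall b, smooth_on U (fun v => phi v 0 b)) -> differentiable phi u.
Proof.
move=> oU Uu sphi; apply: differentiable_row => b.
exact: differentiable_C1 oU Uu (sphi b 1%N).
Qed.

(** Fixes the convention used in [dform]: rows of the Jacobian are indexed by variables, columns by
    components. *)
Lemma jacobianE phi u c b : differentiable phi u ->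
  'J phi u c b = pderiv c (fun v => phi v 0 b) u.
Proof.
move=> dphi; have := deriveEjacobian (delta_mx 0 c) dphi.
rewrite derive_mx; last exact: diff_derivable.
by move=> /rowP/(_ b); rewrite -rowE !mxE.
Qed.

Lemma chain_rule phi f u c :
  differentiable phi u -> differentiable f (phi u) ->
  derivable (f \o phi : _ -> R^o) u (delta_mx 0 c) /\
  pderiv c (f \o phi) u = \sum_b 'J phi u c b * pderiv b f (phi u).
Proof.
move=> dphi df; have dc : differentiable (f \o phi) u by exact: differentiable_comp.
split; first exact: diff_derivable.
have E : 'd phi u (delta_mx 0 c) = row c ('J phi u).
  by rewrite -deriveE // deriveEjacobian // -rowE.
rewrite /pderiv deriveE // diff_comp //= E.
rewrite [in LHS](row_sum_delta (row c ('J phi u))) linear_sum.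
apply: eq_bigr => b _; rewrite linearZ /= mxE deriveE //.
Qed.

End ChainRule.

(** * Differential forms *)

Section ExtCalculus.
Context {R : realType} {m : nat}.
Implicit Types (U : set 'rV[R]_m) (F G : 'rV[R]_m -> ext R m) (a b c : 'I_m).
Implicit Types (f g : 'rV[R]_m -> R^o) (u v : 'rV[R]_m).

Definition sext U F := forall S, smooth_on U (fun v => F v S).

Definition pd a F u : ext R m := [ffun S => pderiv a (fun v => F v S) u].

(** The exterior derivative inside a single chart. *)
Definition dext F u : ext R m := \sum_a ewedge (ebase (finset.set1 a)) (pd a F u).

Lemma is_pderiv_sum (I : Type) (s : seq I) (P : pred I)
    (f : I -> 'rV[R]_m -> R^o) a u :
  (forall i, P i -> derivable (f i) u (delta_mx 0 a)) ->
  derivable (fun v => \sum_(i <- s | P i) f i v : R^o) u (delta_mx 0 a) /\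
  pderiv a (fun v => \sum_(i <- s | P i) f i v) u =
  \sum_(i <- s | P i) pderiv a (f i) u.
Proof.
move=> df; elim: s => [|i s [IH1 IH2]].
  have -> : (fun v => \sum_(i <- [::] | P i) f i v : R^o) = cst 0.
    by apply/funext => v; rewrite big_nil.
  by split; [exact: derivable_cst | rewrite big_nil; exact: derive_cst].
rewrite big_cons; have [Pi|Pi] := boolP (P i); last first.
  by split; [apply: near_eq_derivable IH1 | rewrite -IH2; apply: near_eq_derive];
    near=> v; rewrite big_cons (negbTE Pi).
have [D1 D2] := derivableDf (df i Pi) IH1.
split; first by apply: near_eq_derivable D1; near=> v; rewrite big_cons Pi.
rewrite -IH2 /pderiv -D2; apply: near_eq_derive.
by near=> v; rewrite big_cons Pi.
Unshelve. all: by end_near. Qed.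

Lemma pderiv_cst a (k : R) u : pderiv a (fun=> k) u = 0.
Proof. exact: derive_cst. Qed.

Lemma pderivM U a f g u : open U -> U u -> smooth_on U f -> smooth_on U g ->
  pderiv a (fun v => f v * g v) u = f u * pderiv a g u + g u * pderiv a f u.
Proof.
move=> oU Uu sf sg.
exact: (derivableMf (smooth_derivable (a:=a) sf Uu) (smooth_derivable (a:=a) sg Uu)).2.
Qed.

Lemma eq_on_sext U F G : open U -> (forall v, U v -> F v = G v) ->
  sext U F -> sext U G.
Proof.
by move=> oU FG sF S; apply: eq_on_smooth (sF S) => // v Uv; rewrite FG.
Qed.

Lemma eq_on_pd U F G a u : open U -> U u -> (forall v, U v -> F v = G v) ->
  pd a F u = pd a G u.
Proof.
move=> oU Uu FG; apply: extP => S; rewrite !ffunE.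
by apply: (eq_on_derive _ oU Uu) => w Uw; rewrite FG.
Qed.

Lemma eq_on_dext U F G u : open U -> U u -> (forall v, U v -> F v = G v) ->
  dext F u = dext G u.
Proof. by move=> oU Uu FG; apply: eq_bigr => a _; rewrite (eq_on_pd a oU Uu FG). Qed.

Lemma sext_cst U (x : ext R m) : sext U (fun=> x).
Proof. by move=> S; exact: smooth_cst. Qed.

Lemma sextD U F G : open U -> sext U F -> sext U G ->
  sext U (fun v => F v + G v).
Proof.
move=> oU sF sG S; apply: (eq_on_smooth oU _ (smoothD oU (sF S) (sG S))).
by move=> v _; rewrite ffunE.
Qed.

Lemma sextM U f F : open U -> smooth_on U f -> sext U F ->
  sext U (fun v => f v *: F v).
Proof.
move=> oU sf sF S; apply: (eq_on_smooth oU _ (smoothM oU sf (sF S))).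
by move=> v _; rewrite ffunE.
Qed.

Lemma sext_sum (I : Type) (s : seq I) (P : pred I) (F : I -> 'rV[R]_m -> ext R m)
    U : open U -> (forall i, P i -> sext U (F i)) ->
  sext U (fun v => \sum_(i <- s | P i) F i v).
Proof.
move=> oU sF S.
apply: (eq_on_smooth oU _
  (smooth_sum s oU (fun i Pi => sF i Pi S))).
by move=> v _; rewrite sum_ffunE.
Qed.

Lemma sext_wedge U F G : open U -> sext U F -> sext U G ->
  sext U (fun v => ewedge (F v) (G v)).
Proof.
move=> oU sF sG S.
apply: (@eq_on_smooth _ _ U (fun v => \sum_(T : {set 'I_m} | T \subset S)
  shuffle_sign T (S :\: T)%SET * F v T * G v (S :\: T)%SET)) => //.
  by move=> v _; rewrite ffunE.
apply: smooth_sum => // T _; apply: smoothM => //; apply: smoothM => //.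
exact: smooth_cst.
Qed.

Lemma sext_pd U F a : open U -> sext U F -> sext U (pd a F).
Proof.
move=> oU sF S; apply: (eq_on_smooth oU _ (smooth_pderiv a (sF S))).
by move=> v _; rewrite ffunE.
Qed.

Lemma sext_dext U F : open U -> sext U F -> sext U (dext F).
Proof.
move=> oU sF; apply: sext_sum => // a _; apply: sext_wedge => //.
  exact: sext_cst.
exact: sext_pd.
Qed.

Lemma pd_cst a (x : ext R m) u : pd a (fun=> x) u = 0.
Proof. by apply: extP => S; rewrite !ffunE; exact: derive_cst. Qed.

Lemma pdM a f F u : derivable f u (delta_mx 0 a) ->
  (forall S, derivable (fun v => F v S) u (delta_mx 0 a)) ->
  (forall S, derivable (fun v => (f v *: F v) S) u (delta_mx 0 a)) /\
  pd a (fun v => f v *: F v) u = pderiv a f u *: F u + f u *: pd a F u.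
Proof.
move=> df dF.
have E S : (fun v => (f v *: F v) S) = (fun v => f v * F v S).
  by apply/funext => v; rewrite ffunE.
split; first by move=> S; rewrite E; exact: (derivableMf df (dF S)).1.
apply: extP => S; rewrite !ffunE E /pderiv (derivableMf df (dF S)).2.
by rewrite addrC [F u S * _]mulrC.
Qed.

Lemma pd_sum (I : Type) (s : seq I) (P : pred I) (F : I -> 'rV[R]_m -> ext R m)
    a u : (forall i S, P i -> derivable (fun v => F i v S) u (delta_mx 0 a)) ->
  pd a (fun v => \sum_(i <- s | P i) F i v) u = \sum_(i <- s | P i) pd a (F i) u.
Proof.
move=> dF; apply: extP => S; rewrite sum_ffunE ffunE.
under [RHS]eq_bigr do rewrite ffunE.
rewrite -(is_pderiv_sum s (fun i Pi => dF i S Pi)).2.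
by congr (pderiv a _ u); apply/funext => w; rewrite sum_ffunE.
Qed.

Lemma pdP U a (k : R) F G u : open U -> U u -> sext U F -> sext U G ->
  pd a (fun v => k *: F v + G v) u = k *: pd a F u + pd a G u.
Proof.
move=> oU Uu sF sG; apply: extP => S; rewrite !ffunE.
have sk : smooth_on U (fun v => k * F v S).
  by apply: smoothM => //; exact: smooth_cst.
transitivity (pderiv a (fun v => k * F v S + G v S) u).
  by apply: (eq_on_derive _ oU Uu) => w _; rewrite !ffunE.
rewrite /pderiv (derivableDf (smooth_derivable (a:=a) sk Uu)
  (smooth_derivable (a:=a) (sG S) Uu)).2; congr (_ + _).
rewrite -/(pderiv a _ u) (pderivM a oU Uu (smooth_cst U k) (sF S)).
by rewrite pderiv_cst mulr0 addr0.
Qed.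

Lemma pd_wedge U a F G u : open U -> U u -> sext U F -> sext U G ->
  pd a (fun v => ewedge (F v) (G v)) u =
  ewedge (pd a F u) (G u) + ewedge (F u) (pd a G u).
Proof.
move=> oU Uu sF sG; apply: extP => S; rewrite !ffunE.
transitivity (pderiv a (fun v => \sum_(T : {set 'I_m} | T \subset S)
  shuffle_sign T (S :\: T)%SET * F v T * G v (S :\: T)%SET) u).
  by apply: (eq_on_derive _ oU Uu) => w _; rewrite ffunE.
have sc T : smooth_on U (fun v => shuffle_sign T (S :\: T)%SET * F v T).
  by apply: smoothM => //; exact: smooth_cst.
rewrite (is_pderiv_sum _ _).2; last first.
  by move=> T _; apply: smooth_derivable Uu; exact: smoothM.
rewrite -big_split; apply: eq_bigr => T _ /=.
rewrite (pderivM a oU Uu (sc T) (sG _)) !ffunE addrC; congr (_ + _).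
rewrite (pderivM a oU Uu (smooth_cst U _) (sF _)) pderiv_cst.
by rewrite mulr0 addr0 mulrC.
Qed.

Lemma dextP U (k : R) F G u : open U -> U u -> sext U F -> sext U G ->
  dext (fun v => k *: F v + G v) u = k *: dext F u + dext G u.
Proof.
move=> oU Uu sF sG; rewrite /dext scaler_sumr -big_split; apply: eq_bigr => a _ /=.
by rewrite (pdP a k oU Uu sF sG) ewedgeDr ewedgeZr.
Qed.

(** The sign comes from moving dx_a past F u. *)
Lemma dext_wedge U (j : int) F G u : open U -> U u -> sext U F -> sext U G ->
  homog j (F u) ->
  dext (fun v => ewedge (F v) (G v)) u =
  ewedge (dext F u) (G u) + ((-1) ^ j : R) *: ewedge (F u) (dext G u).
Proof.
move=> oU Uu sF sG hF.
rewrite /dext ewedge_suml ewedge_sumr scaler_sumr -big_split.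
apply: eq_bigr => a _ /=; rewrite (pd_wedge a oU Uu sF sG) ewedgeDr ewedgeA.
congr (_ + _); rewrite !ewedgeA -ewedgeZl; congr ewedge.
have h1 : homog 1 (ebase (finset.set1 a) : ext R m).
  by have := @homog_ebase R m (finset.set1 a); rewrite cards1.
by rewrite (homog_comm h1 hF) mul1r.
Qed.

(** Symmetric coefficients against anticommuting covectors; exchanging the indices changes the sign
    of the sum. *)
Lemma ebase2_sum0 (E : 'I_m -> 'I_m -> ext R m) : (forall a b, E a b = E b a) ->
  \sum_a \sum_b ewedge (ebase (finset.set1 a)) (ewedge (ebase (finset.set1 b)) (E a b)) = 0.
Proof.
move=> sE; set X := LHS.
have : X = - X.
  rewrite {1}/X exchange_big -sumrN; apply: eq_bigr => a _.
  by rewrite -sumrN; apply: eq_bigr => b _; rewrite ebase1C sE.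
move/eqP; rewrite -addr_eq0 -mulr2n -scaler_nat.
by rewrite scaler_eq0 pnatr_eq0 /= => /eqP.
Qed.

Lemma dext_dext U F u : open U -> U u -> sext U F -> dext (dext F) u = 0.
Proof.
move=> oU Uu sF; rewrite -[RHS](@ebase2_sum0 (fun a b => pd a (pd b F) u)).
  apply: eq_bigr => a _; rewrite -ewedge_sumr; congr ewedge.
  have sb b : sext U (fun v => ewedge (ebase (finset.set1 b)) (pd b F v)).
    by apply: sext_wedge => //; [exact: sext_cst | exact: sext_pd].
  rewrite pd_sum; last by move=> b S _; exact: smooth_derivable (sb b S) Uu.
  apply: eq_bigr => b _.
  rewrite (pd_wedge a oU Uu (@sext_cst U _) (sext_pd b oU sF)) pd_cst.
  by rewrite ewedge0l add0r.
move=> a b; apply: extP => S; rewrite [LHS]ffunE [RHS]ffunE.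
transitivity (pderiv a (pderiv b (fun v => F v S)) u).
  by apply: (eq_on_derive _ oU Uu) => w _; rewrite ffunE.
rewrite (pderivC a b oU Uu (sF S 2%N)).
by apply: (eq_on_derive _ oU Uu) => w _; rewrite ffunE.
Qed.

(** Naturality of d. The coefficients contribute by the chain rule, and the pulled back basis
    covectors contribute nothing, being products of the closed forms d phi_b. *)
Lemma dext_pull U1 U2 (phi : 'rV[R]_m -> 'rV[R]_m) F u :
  open U1 -> open U2 -> U1 u -> (forall v, U1 v -> U2 (phi v)) ->
  (forall b, smooth_on U1 (fun v => phi v 0 b)) -> sext U2 F ->
  dext (fun v => epull ('J phi v) (F (phi v))) u =
  epull ('J phi u) (dext F (phi u)).
Proof.
move=> oU1 oU2 U1u U12 sphi sF.
have dphi v : U1 v -> differentiable phi v.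
  by move=> U1v; exact: smooth_map_differentiable oU1 U1v sphi.
(* The explicit matrix of partial derivatives has smooth entries on U1; it is known to agree with
   the Jacobian at the points where [phi] is differentiable. *)
pose J v : 'M[R]_m := \matrix_(c, b) pderiv c (fun v => phi v 0 b) v.
have JE v : U1 v -> 'J phi v = J v.
  by move=> U1v; apply/matrixP => c b; rewrite jacobianE ?mxE //; exact: dphi.
have st b : sext U1 (fun v => theta (J v) b).
  apply: sext_sum => // c _; apply: sextM => //; last exact: sext_cst.
  apply: (eq_on_smooth oU1 _ (smooth_pderiv c (sphi b))) => v _.
  by rewrite mxE.
(* [theta (J v) b] is d phi_b, closed by symmetry of second derivatives. *)
have dt b v : U1 v -> dext (fun v => theta (J v) b) v = 0.
  move=> U1v; rewrite -[RHS](@ebase2_sum0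
    (fun a c => pderiv a (pderiv c (fun v => phi v 0 b)) v *: ebase finset.set0)).
    have sc c : smooth_on U1 (fun v => J v c b).
      apply: (eq_on_smooth oU1 _ (smooth_pderiv c (sphi b))) => w _.
      by rewrite mxE.
    apply: eq_bigr => a _; rewrite -ewedge_sumr; congr ewedge.
    have sce c : sext U1 (fun v => J v c b *: ebase (finset.set1 c)).
      by apply: sextM => //; exact: sext_cst.
    rewrite pd_sum; last by move=> c S _; exact: smooth_derivable (sce c S) U1v.
    apply: eq_bigr => c _.
    rewrite (pdM (smooth_derivable (sc c) U1v) _).2  ?pd_cst ?scaler0 ?addr0; last first.
      by move=> S; exact: derivable_cst.
    rewrite ewedgeZr ewedgex1; congr (_ *: _).
    by apply: (eq_on_derive _ oU1 U1v) => w _; rewrite mxE.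
  by move=> a c; rewrite (pderivC a c oU1 U1v (sphi b 2%N)).
(* Closedness of products goes by induction together with smoothness, which the Leibniz rule
   needs. *)
have sts (l : seq 'I_m) :
    sext U1 (fun v => \big[ewedge/ebase finset.set0]_(b <- l) theta (J v) b) /\
    forall v, U1 v ->
      dext (fun v => \big[ewedge/ebase finset.set0]_(b <- l) theta (J v) b) v = 0.
  elim: l => [|b l [s1 d1]].
    split; first by apply: (eq_on_sext oU1 _ (@sext_cst _ (ebase finset.set0))) =>
      v _; rewrite big_nil.
    move=> v U1v; rewrite (@eq_on_dext _ _ (fun=> ebase finset.set0) _ oU1 U1v).
      by rewrite /dext big1 // => a _; rewrite pd_cst ewedge0r.
    by move=> w _; rewrite big_nil.
  split; first by apply: (eq_on_sext oU1 _ (sext_wedge oU1 (st b) s1)) =>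
      v _; rewrite big_cons.
  move=> v U1v; rewrite (@eq_on_dext _ _ (fun v => ewedge (theta (J v) b)
    (\big[ewedge/ebase finset.set0]_(b <- l) theta (J v) b)) _ oU1 U1v).
    rewrite (dext_wedge oU1 U1v (st b) s1 (@homog_theta _ _ _ b)).
    by rewrite dt // d1 // ewedge0l ewedge0r scaler0 addr0.
  by move=> w _; rewrite big_cons.
have sth S : sext U1 (fun v => thetas (J v) S) := (sts (enum S)).1.
have dth S v (U1v : U1 v) : dext (fun v => thetas (J v) S) v = 0 :=
  (sts (enum S)).2 v U1v.
have cr S c := chain_rule c (dphi u U1u)
  (differentiable_C1 oU2 (U12 _ U1u) (sF S 1%N)).
have pdE a : pd a (fun v => epull ('J phi v) (F (phi v))) u =
    \sum_S (pderiv a (fun v => F (phi v) S) u *: thetas (J u) S +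
            F (phi u) S *: pd a (fun v => thetas (J v) S) u).
  rewrite (@eq_on_pd U1 _ (fun v => \sum_S F (phi v) S *: thetas (J v) S)) //.
    rewrite pd_sum.
      apply: eq_bigr => S _; apply: (pdM _ _).2; first exact: (cr S a).1.
      by move=> T; exact: smooth_derivable (sth S T) U1u.
    move=> S T _; apply: (pdM _ _).1; first exact: (cr S a).1.
    by move=> T'; exact: smooth_derivable (sth S T') U1u.
  by move=> v U1v; rewrite JE.
rewrite {1}/dext; under eq_bigr do rewrite pdE ewedge_sumr.
rewrite exchange_big /= JE //.
transitivity (\sum_S \sum_b pderiv b (fun v => F v S) (phi u) *:
    ewedge (theta (J u) b) (thetas (J u) S)).
  apply: eq_bigr => S _.
  under eq_bigr do rewrite ewedgeDr !ewedgeZr.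
  rewrite big_split /= -scaler_sumr [X in _ *: X](dth S u U1u) scaler0 addr0.
  transitivity (\sum_a \sum_b (J u a b * pderiv b (fun v => F v S) (phi u)) *:
      ewedge (ebase (finset.set1 a)) (thetas (J u) S)).
    by apply: eq_bigr => a _; rewrite (cr S a).2 JE // scaler_suml.
  rewrite exchange_big; apply: eq_bigr => b _ /=.
  rewrite /theta ewedge_suml scaler_sumr; apply: eq_bigr => a _.
  by rewrite ewedgeZl scalerA mulrC.
rewrite exchange_big /dext epull_sum; apply: eq_bigr => b _ /=.
rewrite epull_ebase1_wedge epullE ewedge_sumr; apply: eq_bigr => S _.
by rewrite ewedgeZr ffunE.
Qed.

End ExtCalculus.

(** * Differential forms on a manifold and their gluing *)

Section DifferentialForms.
Context {R : realType} {m : nat} {M : manifold R m}.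
Implicit Types (A B C : chart_family M) (i j : chart M) (k l : int).

Lemma open_image_dom i : open (image_dom i).
Proof. exact: image_open. Qed.

(** Inside the image of chart i the overlap is the preimage of the domain of chart j under the
    continuous map [cinv i]. *)
Lemma open_overlap i j : open (cmap i @` (chart_dom i `&` chart_dom j)).
Proof.
have cinv_cont u : image_dom i u -> {for u, continuous (cinv i)}.
  have := @cinv_continuous _ _ M i.
  rewrite continuous_open_subspace; last exact: image_open.
  by move=> c Uu; apply: c; rewrite inE.
rewrite openE => u [x [xi xj] <-{u}].
have Uu : image_dom i (cmap i x) by exists x.
have nj : nbhs (cinv i (cmap i x)) (chart_dom j).
  by rewrite cmapK //; apply: open_nbhs_nbhs; split=> //; exact: dom_open.
have N1 : nbhs (cmap i x) (image_dom i).
  by apply: open_nbhs_nbhs; split=> //; exact: open_image_dom.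
have N2 : nbhs (cmap i x) (cinv i @^-1` chart_dom j) := cinv_cont _ Uu _ nj.
suff : nbhs (cmap i x) (cmap i @` (chart_dom i `&` chart_dom j)) by [].
near=> v.
have [y yi yv] : image_dom i v by near: v.
have : chart_dom j (cinv i v) by near: v.
rewrite -yv cmapK // => yj; by exists y.
Unshelve. all: by end_near. Qed.

(** A [dform] without the gluing condition, kept apart because the sl_2 argument runs chart by
    chart. *)
Definition lform k A :=
  [/\ forall i u, ~ image_dom i u -> A i u = 0,
      forall i, sext (image_dom i) (A i) &
      forall i u, homog k (A i u)].

Definition compat A := forall i j x, chart_dom i x -> chart_dom j x ->
  A i (cmap i x) = epull ('J (cmap j \o cinv i) (cmap i x)) (A j (cmap j x)).

Lemma dformE k A : dform k A <-> lform k A /\ compat A.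
Proof.
split=> [[D1 D2 D3 D4]|[[D1 D2 D4] D3]].
  by split.
by split.
Qed.

Definition sfam A := (forall i u, ~ image_dom i u -> A i u = 0) /\
  (forall i, sext (image_dom i) (A i)).

Lemma lform_sfam k A : lform k A -> sfam A.
Proof. by case. Qed.

Lemma lform0 k : lform k 0.
Proof.
split=> //.
  by move=> i; exact: (@sext_cst _ _ (image_dom i) 0).
by move=> i u; exact: homog0.
Qed.

Lemma lformP k (c : R) A B : lform k A -> lform k B -> lform k (c *: A + B).
Proof.
move=> [A1 A2 A3] [B1 B2 B3]; split.
- by move=> i u Uu; rewrite -[LHS]/(c *: A i u + B i u) A1 // B1 // scaler0 addr0.
- move=> i; apply: sextD => //; first exact: open_image_dom.
  by apply: sextM => //; [exact: open_image_dom | exact: smooth_cst].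
- by move=> i u; exact: homogP.
Qed.

Lemma lform_wedge k l A B : lform k A -> lform l B -> lform (k + l) (wedge A B).
Proof.
move=> [A1 A2 A3] [B1 B2 B3]; split.
- by move=> i u Uu; rewrite /wedge A1 // ewedge0l.
- by move=> i; apply: sext_wedge => //; exact: open_image_dom.
- by move=> i u; exact: homog_ewedge.
Qed.

Lemma extdE A i u : image_dom i u -> extd A i u = dext (A i) u.
Proof. by move=> Uu; rewrite /extd mem_set. Qed.

Lemma extd_out A i u : ~ image_dom i u -> extd A i u = 0.
Proof. by move=> Uu; rewrite /extd memNset. Qed.

Lemma lform_extd k A : lform k A -> lform (k + 1) (extd A).
Proof.
move=> [A1 A2 A3]; split.
- by move=> i u; exact: extd_out.
- move=> i; apply: (eq_on_sext (@open_image_dom i) _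
    (sext_dext (@open_image_dom i) (A2 i))) => v Uv.
  by rewrite extdE.
- move=> i u; have [Uu|Uu] := pselect (image_dom i u); last first.
    by rewrite extd_out //; exact: homog0.
  rewrite extdE //; apply: homog_sum => a _; rewrite addrC; apply: homog_ewedge.
    by have := @homog_ebase R m (finset.set1 a); rewrite cards1.
  move=> S Sk; rewrite ffunE.
  rewrite [X in pderiv a X](_ : _ = fun=> 0); first exact: derive_cst.
  by apply/funext => v; exact: A3.
Qed.

Lemma compat0 : compat 0.
Proof. by move=> i j x xi xj; exact: esym (epull0 _). Qed.

Lemma compatP (c : R) A B : compat A -> compat B -> compat (c *: A + B).
Proof.
move=> cA cB i j x xi xj.
rewrite -[LHS]/(c *: A i (cmap i x) + B i (cmap i x)).
by rewrite (cA i j) // (cB i j) // -epull_is_linear.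
Qed.

Lemma compat_wedge A B : compat A -> compat B -> compat (wedge A B).
Proof.
move=> cA cB i j x xi xj.
by rewrite /wedge (cA i j) // (cB i j) // epull_wedge.
Qed.

Lemma compat_extd k A : lform k A -> compat A -> compat (extd A).
Proof.
move=> [A1 A2 A3] cA i j x xi xj.
have Ui : image_dom i (cmap i x) by exists x.
have Uj : image_dom j (cmap j x) by exists x.
rewrite !extdE //.
pose phi := cmap j \o cinv i.
have phix : phi (cmap i x) = cmap j x by rewrite /phi /= cmapK.
rewrite -phix.
have O1 : open (cmap i @` (chart_dom i `&` chart_dom j)) := @open_overlap i j.
have O1x : (cmap i @` (chart_dom i `&` chart_dom j)) (cmap i x) by exists x.
have O12 v : (cmap i @` (chart_dom i `&` chart_dom j)) v -> image_dom j (phi v).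
  by move=> [y [yi yj] <-]; rewrite /phi /= cmapK //; exists y.
have sphi b : smooth_on (cmap i @` (chart_dom i `&` chart_dom j))
    (fun v => phi v 0 b) := transition_smooth i j b.
rewrite -(dext_pull O1 (@open_image_dom j) O1x O12 sphi (A2 j)).
apply: (eq_on_dext O1 O1x) => v [y [yi yj] <-].
by rewrite (cA i j) // /phi /= cmapK.
Qed.

Lemma dform0 k : @dform R m M k 0.
Proof. by apply/dformE; split; [exact: lform0 | exact: compat0]. Qed.

Lemma dformP k (c : R) A B : dform k A -> dform k B -> dform k (c *: A + B).
Proof.
move=> /dformE[A1 A2] /dformE[B1 B2].
by apply/dformE; split; [exact: lformP | exact: compatP].
Qed.

Lemma dform_wedge k l A B : dform k A -> dform l B -> dform (k + l) (wedge A B).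
Proof.
move=> /dformE[A1 A2] /dformE[B1 B2].
by apply/dformE; split; [exact: lform_wedge | exact: compat_wedge].
Qed.

Lemma dform_extd k A : dform k A -> dform (k + 1) (extd A).
Proof.
move=> /dformE[A1 A2].
by apply/dformE; split; [exact: lform_extd | exact: compat_extd A1 A2].
Qed.

(** The constant function 1, a form of degree 0 despite the name, set to 0 outside the image of the
    chart as [dform] demands. *)
Definition one_form : chart_family M :=
  fun i u => if u \in image_dom i then ebase finset.set0 else 0.

Lemma dform_one : dform 0 one_form.
Proof.
apply/dformE; split; first split.
- by move=> i u Uu; rewrite /one_form memNset.
- move=> i; apply: (eq_on_sext (@open_image_dom i) _ (@sext_cst _ _ _ (ebase finset.set0))).
  by move=> v Uv; rewrite /one_form mem_set.
- move=> i u; rewrite /one_form; case: ifP => _; last exact: homog0.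
  by have := @homog_ebase R m finset.set0; rewrite cards0.
- move=> i j x xi xj.
  have Ui : image_dom i (cmap i x) by exists x.
  have Uj : image_dom j (cmap j x) by exists x.
  by rewrite /one_form !mem_set // epull1.
Qed.

Lemma wedgePl (c : R) A B C : wedge (c *: A + B) C = c *: wedge A C + wedge B C.
Proof.
apply/funext => i; apply/funext => u.
by rewrite /wedge -[(c *: A + B) i u]/(c *: A i u + B i u) ewedgeDl ewedgeZl.
Qed.

Lemma wedgePr (c : R) A B C : wedge C (c *: A + B) = c *: wedge C A + wedge C B.
Proof.
apply/funext => i; apply/funext => u.
by rewrite /wedge -[(c *: A + B) i u]/(c *: A i u + B i u) ewedgeDr ewedgeZr.
Qed.

Lemma wedgeA A B C : wedge A (wedge B C) = wedge (wedge A B) C.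
Proof. by apply/funext => i; apply/funext => u; rewrite /wedge ewedgeA. Qed.

Lemma wedge_comm k l A B : lform k A -> lform l B ->
  wedge A B = ((-1) ^ (k * l) : R) *: wedge B A.
Proof.
move=> [_ _ hA] [_ _ hB]; apply/funext => i; apply/funext => u.
exact: homog_comm.
Qed.

Lemma wedge1 A : sfam A -> wedge one_form A = A.
Proof.
move=> [A1 _]; apply/funext => i; apply/funext => u; rewrite /wedge /one_form.
have [Uu|Uu] := pselect (image_dom i u); first by rewrite mem_set // ewedge1x.
by rewrite memNset // ewedge0l A1.
Qed.

Lemma wedge_one A : sfam A -> wedge A one_form = A.
Proof.
move=> [A1 _]; apply/funext => i; apply/funext => u; rewrite /wedge /one_form.
have [Uu|Uu] := pselect (image_dom i u); first by rewrite mem_set // ewedgex1.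
by rewrite memNset // ewedge0r A1.
Qed.

Lemma extd_linear (c : R) A B : sfam A -> sfam B ->
  extd (c *: A + B) = c *: extd A + extd B.
Proof.
move=> [_ sA] [_ sB]; apply/funext => i; apply/funext => u.
rewrite -[RHS]/(c *: extd A i u + extd B i u).
have [Uu|Uu] := pselect (image_dom i u); last first.
  by rewrite !extd_out // scaler0 addr0.
by rewrite !extdE // -(dextP c (@open_image_dom i) Uu (sA i) (sB i)).
Qed.

Lemma extd_extd A : sfam A -> extd (extd A) = 0.
Proof.
move=> [_ sA]; apply/funext => i; apply/funext => u.
have [Uu|Uu] := pselect (image_dom i u); last by rewrite extd_out.
rewrite extdE // (eq_on_dext (G := dext (A i)) (@open_image_dom i) Uu).
  exact: dext_dext (@open_image_dom i) Uu (sA i).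
by move=> v Uv; rewrite extdE.
Qed.

Lemma extd_wedge k A B : lform k A -> sfam B ->
  extd (wedge A B) = wedge (extd A) B + ((-1) ^ k : R) *: wedge A (extd B).
Proof.
move=> [_ sA hA] [_ sB]; apply/funext => i; apply/funext => u.
rewrite -[RHS]/(ewedge (extd A i u) (B i u) +
  (-1) ^ k *: ewedge (A i u) (extd B i u)).
have [Uu|Uu] := pselect (image_dom i u); last first.
  by rewrite !extd_out // ewedge0l ewedge0r scaler0 addr0.
by rewrite !extdE // -(dext_wedge (@open_image_dom i) Uu (sA i) (sB i) (hA i u)).
Qed.

Lemma extd_one : extd one_form = 0.
Proof.
apply/funext => i; apply/funext => u.
have [Uu|Uu] := pselect (image_dom i u); last by rewrite extd_out.
rewrite extdE // (eq_on_dext (G := fun=> ebase finset.set0) (@open_image_dom i) Uu).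
  by rewrite /dext big1 // => a _; rewrite pd_cst ewedge0r.
by move=> v Uv; rewrite /one_form mem_set.
Qed.

Lemma lform_neg k A : k < 0 -> lform k A -> A = 0.
Proof.
move=> k0 [_ _ hA]; apply/funext => i; apply/funext => u.
exact: homog_neg (hA i u).
Qed.

Lemma lform_large k A : m%:Z < k -> lform k A -> A = 0.
Proof.
move=> k0 [_ _ hA]; apply/funext => i; apply/funext => u.
exact: homog_large (hA i u).
Qed.

Lemma sfamP (c : R) A B : sfam A -> sfam B -> sfam (c *: A + B).
Proof.
move=> [A1 A2] [B1 B2]; split.
- by move=> i u Uu; rewrite -[LHS]/(c *: A i u + B i u) A1 // B1 // scaler0 addr0.
- move=> i; apply: sextD => //; first exact: open_image_dom.
  by apply: sextM => //; [exact: open_image_dom | exact: smooth_cst].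
Qed.

(** Finite sums of homogeneous forms: closed under all the operations, and the domain on which these
    are shown to be linear. *)
Inductive is_form : chart_family M -> Prop :=
| is_form_dform k A of dform k A : is_form A
| is_formP (c : R) A B of is_form A & is_form B : is_form (c *: A + B).

Lemma is_form0 : is_form 0.
Proof. exact: (is_form_dform (dform0 0)). Qed.

Lemma is_form_sfam A : is_form A -> sfam A.
Proof.
elim=> [k B /dformE[/lform_sfam //]|c B C _ HB _ HC].
exact: sfamP.
Qed.

Lemma is_form_sum (I : Type) (t : seq I) (P : pred I) (F : I -> chart_family M) :
  (forall x, P x -> is_form (F x)) -> is_form (\sum_(x <- t | P x) F x).
Proof.
move=> hF; elim/big_ind: _ => //; first exact: is_form0.
by move=> x y hx hy; rewrite -[x]scale1r; exact: is_formP.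
Qed.

Lemma wedge0l A : wedge 0 A = 0.
Proof. by have := wedgePl (-1) 0 0 A; rewrite !scaleN1r oppr0 addr0 addNr. Qed.

Lemma wedge0r A : wedge A 0 = 0.
Proof. by have := wedgePr (-1) 0 0 A; rewrite !scaleN1r oppr0 addr0 addNr. Qed.

Lemma is_form_wedge A B : is_form A -> is_form B -> is_form (wedge A B).
Proof.
move=> hA hB; elim: hA => [k C hC|c C D _ hC _ hD]; last first.
  by rewrite wedgePl; exact: is_formP.
elim: hB => [l D hD|c D E _ hD _ hE]; last by rewrite wedgePr; exact: is_formP.
exact: is_form_dform (dform_wedge hC hD).
Qed.

Lemma is_form_extd A : is_form A -> is_form (extd A).
Proof.
elim=> [k B /dform_extd /is_form_dform //|c B C hB IB hC IC].
rewrite extd_linear; try exact: is_form_sfam.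
exact: is_formP.
Qed.

End DifferentialForms.

(** * Lefschetz operators on forms *)

Section SmoothDeterminant.
Context {R : realType} {m : nat}.
Implicit Types U : set 'rV[R]_m.

Lemma smooth_det U q (X : 'rV[R]_m -> 'M[R]_q) : open U ->
  (forall b c, smooth_on U (fun u => X u b c)) -> smooth_on U (fun u => \det (X u)).
Proof.
move=> oU sX; rewrite /determinant; apply: smooth_sum => // s _.
apply: smoothM => //; first exact: smooth_cst.
exact: smooth_prod.
Qed.

(** Cramer's formula: the entries of the inverse are minors divided by the determinant, up to
    sign. *)
Lemma smooth_invmx U q (X : 'rV[R]_m -> 'M[R]_q) : open U ->
  (forall u, U u -> X u \in unitmx) ->
  (forall b c, smooth_on U (fun u => X u b c)) ->
  forall b c, smooth_on U (fun u => invmx (X u) b c).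
Proof.
move=> oU uX sX b c.
apply: (@eq_on_smooth _ _ U (fun u => (\det (X u))^-1 * \adj (X u) b c)) => //.
  by move=> u Uu; rewrite /invmx uX // [RHS]mxE.
apply: smoothM => //.
  apply: smoothV => //; last exact: smooth_det.
  by move=> u Uu; have := uX u Uu; rewrite unitmxE unitfE.
apply: (@eq_on_smooth _ _ U
  (fun u => (-1) ^+ (c + b) * \det (row' c (col' b (X u))))) => //.
  by move=> u _; rewrite mxE.
apply: smoothM => //; first exact: smooth_cst.
apply: smooth_det => // b' c'.
by apply: (eq_on_smooth oU _ (sX (lift c b') (lift b c'))) => u _; rewrite !mxE.
Qed.

Lemma sext_contract U (F : 'rV[R]_m -> ext R m) b : open U -> sext U F ->
  sext U (fun u => econtract b (F u)).
Proof.
move=> oU sF S; case: (boolP (b \in S)) => bS.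
  by apply: (eq_on_smooth oU _ (smooth_cst U 0)) => u _; rewrite ffunE bS.
apply: (eq_on_smooth oU _ (smoothM oU
  (smooth_cst U (shuffle_sign (finset.set1 b) S)) (sF (b |: S)%SET))) => u _.
by rewrite ffunE (negbTE bS).
Qed.

End SmoothDeterminant.

Lemma ewedge_linr (R : realType) m (w : ext R m) (c : R) x y :
  ewedge w (c *: x + y) = c *: ewedge w x + ewedge w y.
Proof. by rewrite ewedgeDr ewedgeZr. Qed.

(** * Existence and uniqueness of the Lefschetz decomposition of forms *)

Section LefschetzForms.
Context {R : realType} {n : nat} {M : manifold R n.*2} (omega : chart_family M).
Hypothesis homega : symplectic omega.
Implicit Types (A : chart_family M) (B : nat -> nat -> chart_family M) (i : chart M).
Local Notation L := (Lop omega).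

Let ho : lform 2 omega. Proof. by case: homega => /dformE[]. Qed.

(** Nondegeneracy annihilates every row of the left kernel of the matrix of omega. *)
Lemma symplectic_unit i u : image_dom i u -> omat (omega i u) \in unitmx.
Proof.
move=> Uu; have [_ _ nd] := homega.
rewrite -row_free_unit -kermx_eq0; apply/eqP/row_matrixP => b; rewrite row0.
apply: (nd i u Uu) => w; rewrite eval2E.
by rewrite -row_mul mulmx_ker row0 mul0mx mxE.
Qed.

Lemma lambda_at i u k x : image_dom i u -> homog k x ->
  lambda (invmx (omat (omega i u))) (ewedge (omega i u) x) =
  ewedge (omega i u) (lambda (invmx (omat (omega i u))) x) + (n%:R - k%:~R) *: x.
Proof.
move=> Uu hx; have uo := symplectic_unit Uu; have [_ _ h2] := ho.
have n2 : n.*2%:R / 2 = n%:R :> R by rewrite -muln2 natrM mulfK // pnatr_eq0.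
rewrite (@lambda_omega _ _ _ _ (h2 i u) _ _ k) //.
- by rewrite n2.
- by rewrite mulVmx.
(* The inverse of a skew matrix is skew. *)
- have : (omat (omega i u) *m invmx (omat (omega i u)))^T = 1%:M.
    by rewrite mulmxV // trmx1.
  rewrite trmx_mul omat_tr mulmxN -mulNmx => E.
  by rewrite -[RHS]mul1mx -E mulmxN -mulmxA mulmxV // mulmx1 opprK.
Qed.

(** The degree projections on which [sl2_uniq] relies. *)
Definition degree_part (k : int) (x : ext R n.*2) : ext R n.*2 :=
  [ffun S : {set 'I_n.*2} => if #|S|%:Z == k then x S else 0].

Lemma point_uniq i u (b : nat -> nat -> ext R n.*2) : image_dom i u ->
  sl2_family n (@homog R n.*2) (ewedge (omega i u)) b ->
  dsum n (ewedge (omega i u)) b = 0 -> forall r s, b r s = 0.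
Proof.
move=> Uu; have [_ _ h2] := ho.
apply: (@sl2_uniq _ _ n (@homog R n.*2) (ewedge (omega i u)) _ _ _ _
  (lambda (invmx (omat (omega i u)))) _ _ _ degree_part).
- exact: homog0.
- by move=> j x; exact: homog_neg.
- by move=> c x y; rewrite ewedgeDr ewedgeZr.
- by move=> j x hx; rewrite addrC; exact: homog_ewedge.
- exact: lambda_is_linear.
- exact: homog_lambda.
- by move=> j x; exact: lambda_at.
- move=> k x y; apply: extP => S; rewrite !ffunE; case: ifP => //.
  by rewrite addr0.
- move=> k x hx; apply: extP => S; rewrite ffunE; case: ifP => // /negbT Sk.
  by rewrite hx.
- move=> j k x hx jk; apply: extP => S; rewrite !ffunE; case: ifP => // /eqP Sk.
  by apply: hx; rewrite Sk eq_sym.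
Qed.

Definition Lam A : chart_family M := fun i u =>
  if u \in image_dom i then lambda (invmx (omat (omega i u))) (A i u) else 0.

Lemma lform_Lam k A : lform k A -> lform (k - 2) (Lam A).
Proof.
move=> [A1 A2 A3]; split.
- by move=> i u Uu; rewrite /Lam memNset.
- move=> i; have oU := @open_image_dom _ _ _ i.
  apply: (@eq_on_sext _ _ (image_dom i)
      (fun u => lambda (invmx (omat (omega i u))) (A i u))) => //.
    by move=> v Uv; rewrite /Lam mem_set.
  apply: (@sextM _ _ _ (fun=> 2^-1)) => //; first exact: smooth_cst.
  apply: sext_sum => // b _; apply: sext_sum => // c _.
  apply: sextM => //; last by do 2!apply: sext_contract => //.
  apply: smooth_invmx => //; first by move=> u; exact: symplectic_unit.
  have [_ so _] := ho.
  move=> b' c'; case: (ltngtP b' c') => bc.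
  + apply: (eq_on_smooth oU _ (so i [set b'; c']%SET)) => v _.
    by rewrite mxE bc.
  + apply: (eq_on_smooth oU _ (smoothM oU (smooth_cst _ (-1))
      (so i [set b'; c']%SET))) => v _.
    by rewrite mxE bc ltnNge (ltnW bc) /= mulN1r.
  + apply: (eq_on_smooth oU _ (smooth_cst _ 0)) => v _.
    by rewrite mxE bc ltnn.
- move=> i u; rewrite /Lam; case: ifP => _; last exact: homog0.
  exact: homog_lambda.
Qed.

Lemma LpowE r A i u : Lpow omega r A i u = iter r (ewedge (omega i u)) (A i u).
Proof. by elim: r => //= r <-. Qed.

Lemma LopP (c : R) A A' : L (c *: A + A') = c *: L A + L A'.
Proof. exact: wedgePr. Qed.

Lemma LpowP r (c : R) A A' :
  Lpow omega r (c *: A + A') = c *: Lpow omega r A + Lpow omega r A'.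
Proof. by elim: r => //= r ->; exact: LopP. Qed.

Lemma Lpow0 r : Lpow omega r 0 = 0.
Proof. by have := LpowP r (-1) 0 0; rewrite !scaleN1r oppr0 addr0 addNr. Qed.

Lemma dform_Lpow r k A : dform k A -> dform (k + (2 * r)%N%:Z) (Lpow omega r A).
Proof.
move=> hA; elim: r => [|r IH]; first by rewrite addr0.
have [h2 _ _] := homega.
rewrite (_ : _ + _ = 2 + (k + (2 * r)%N%:Z)); last by lia.
exact: dform_wedge.
Qed.

Lemma primitive_nat s A : (s <= n)%N ->
  primitive omega s A <-> dform s A /\ Lpow omega (n.+1 - s) A = 0.
Proof.
move=> sn; rewrite /primitive /= lez_nat sn.
by rewrite (_ : `|n.+1%:Z - s|%N = (n.+1 - s)%N); [|lia].
Qed.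

Lemma primitive0 (s : int) : primitive omega s 0.
Proof.
rewrite /primitive /=; case: ifP => // _; split; first exact: dform0.
exact: Lpow0.
Qed.

Lemma primitive_dform (s : int) A : primitive omega s A -> dform s A.
Proof.
by rewrite /primitive /=; case: ifP => [_ [] //|_ ->]; exact: dform0.
Qed.

Lemma primitiveP (s : int) (c : R) A A' : primitive omega s A ->
  primitive omega s A' -> primitive omega s (c *: A + A').
Proof.
rewrite /primitive /=; case: ifP => [_ [A1 A2] [B1 B2]|_ -> ->].
  by split; [exact: dformP | rewrite LpowP A2 B2 scaler0 addr0].
by rewrite scaler0 addr0.
Qed.

Lemma lefschetz_decE A B : lefschetz_dec omega A B ->
  A = \sum_(s < n.+1) \sum_(r < n.+1) Lpow omega r (B r s).
Proof.
move=> [_ B2 ->]; apply: eq_bigr => s _.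
have le : ((n - s).+1 <= n.+1)%N by rewrite ltnS leq_subr.
rewrite (big_ord_widen n.+1 (fun r => Lpow omega r (B r s)) le).
rewrite big_mkcond; apply: eq_bigr => r _; case: ltnP => // rn.
by rewrite B2 ?Lpow0 //; lia.
Qed.

(** Checked pointwise: outside the chart images both families vanish, and inside them [point_uniq]
    applies to the difference. *)
Lemma lefschetz_dec_uniq A B B' : lefschetz_dec omega A B ->
  lefschetz_dec omega A B' -> B = B'.
Proof.
move=> dB dB'; apply/funext => r; apply/funext => s.
apply/funext => i; apply/funext => u.
have [B1 B2 _] := dB; have [C1 C2 _] := dB'.
have prim (E : nat -> nat -> chart_family M) r' s' : lefschetz_dec omega A E ->
    (r' + s' <= n)%N -> dform s' (E r' s') /\ Lpow omega (n.+1 - s') (E r' s') = 0.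
  move=> [E1 _ _] rs; have := E1 _ _ rs.
  by move/primitive_nat; apply; lia.
have [Uu|Uu] := pselect (image_dom i u); last first.
  case: (leqP (r + s) n) => rs; last by rewrite B2 ?C2.
  have [/dformE[[z _ _] _] _] := prim _ _ _ dB rs.
  have [/dformE[[z' _ _] _] _] := prim _ _ _ dB' rs.
  by rewrite z // z'.
apply/eqP; rewrite -subr_eq0; apply/eqP.
apply: (@point_uniq i u (fun r s => B r s i u - B' r s i u) Uu).
  split=> [r' s' rs|r' s' rs]; last by rewrite B2 // C2 // subrr.
  have [/dformE[[_ _ h1] _] e1] := prim _ _ _ dB rs.
  have [/dformE[[_ _ h2] _] e2] := prim _ _ _ dB' rs.
  split; first by rewrite addrC -scaleN1r; exact: homogP.
  rewrite (iterLD (ewedge_linr _)).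
  rewrite (iterLN (ewedge_linr _)).
  by rewrite -!LpowE e1 e2 subrr.
have EA (E : nat -> nat -> chart_family M) : lefschetz_dec omega A E ->
    dsum n (ewedge (omega i u)) (fun r s => E r s i u) = A i u.
  move=> /lefschetz_decE ->; rewrite /dsum fct_sumE fct_sumE.
  apply: eq_bigr => s' _; rewrite fct_sumE fct_sumE.
  by apply: eq_bigr => r' _; rewrite LpowE.
transitivity (A i u - A i u); last by rewrite subrr.
rewrite -{1}(EA _ dB) -(EA _ dB') /dsum -sumrB.
apply: eq_bigr => s' _; rewrite -sumrB; apply: eq_bigr => r' _.
rewrite (iterLD (ewedge_linr _)).
by rewrite (iterLN (ewedge_linr _)).
Qed.

(** By uniqueness the choice made in [lef] is harmless: any decomposition at hand computes it. *)
Lemma lefE A B : lefschetz_dec omega A B -> lef omega A = B.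
Proof.
move=> dB; apply: (lefschetz_dec_uniq _ dB).
exact: (@xgetPex _ (fun _ _ => 0) [set B | lefschetz_dec omega A B] (ex_intro _ B dB)).
Qed.

Lemma lefschetz_dec_ex (k : int) A : dform k A ->
  exists2 B, lefschetz_dec omega A B &
    forall r s, (2 * r + s)%N%:Z != k -> B r s = 0.
Proof.
move=> /dformE[lA cA].
have [|||||||||B [[B1 B2] Bk AE]] := @sl2_decomp _ _ n (@lform R n.*2 M) L
  _ _ _ _ _ _ Lam _ _ _ k A lA.
- exact: lform0.
- by move=> j c x y; exact: lformP.
- by move=> j x; exact: lform_neg.
- by move=> j x; rewrite mul2n; exact: lform_large.
- exact: LopP.
- by move=> j x hx; rewrite addrC; exact: lform_wedge.
- move=> c x y; apply/funext => i; apply/funext => u.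
  rewrite -[RHS]/(c *: Lam x i u + Lam y i u) /Lam; case: ifP => _.
    exact: lambda_is_linear.
  by rewrite scaler0 addr0.
- by move=> j x; exact: lform_Lam.
- move=> j x [x1 _ hx]; apply/funext => i; apply/funext => u.
  rewrite -[RHS]/(ewedge (omega i u) (Lam x i u) + (n%:R - j%:~R) *: x i u) /Lam.
  have [Uu|Uu] := pselect (image_dom i u).
    by rewrite mem_set // -lambda_at.
  by rewrite memNset // x1 // ewedge0r scaler0 addr0.
exists B => //.
(* Pullback is an algebra map preserving omega, so on an overlap the components in chart j pull back
   to a decomposition of the same covector as in chart i; pointwise uniqueness makes the two
   equal. *)
have cB r s : compat (B r s).
  move=> i j x xi xj; apply/eqP; rewrite -subr_eq0; apply/eqP.
  have Ui : image_dom i (cmap i x) by exists x.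
  set J := 'J _ _.
  have oE : omega i (cmap i x) = epull J (omega j (cmap j x)).
    by have [/dformE[_ co] _ _] := homega; exact: co.
  have itE r' y : iter r' (ewedge (omega i (cmap i x))) (epull J y) =
      epull J (iter r' (ewedge (omega j (cmap j x))) y).
    by elim: r' => //= r' ->; rewrite oE epull_wedge.
  apply: (@point_uniq i _ (fun r s => B r s i (cmap i x) -
    epull J (B r s j (cmap j x))) Ui).
    split=> [r' s' rs|r' s' rs]; last first.
      by rewrite B2 // (_ : (0 : chart_family M) j _ = 0) // epull0 subrr.
    have [[_ _ h1] e1] := B1 _ _ rs.
    split.
      by rewrite addrC -scaleN1r; apply: homogP => //; exact: homog_epull.
    rewrite (iterLD (ewedge_linr _)).
    rewrite (iterLN (ewedge_linr _)).
    by rewrite itE -!LpowE /Lpow e1 epull0 subrr.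
  transitivity (A i (cmap i x) - epull J (A j (cmap j x))); last first.
    by rewrite (cA i j) // subrr.
  rewrite AE /dsum !fct_sumE epull_sum -sumrB; apply: eq_bigr => s' _.
  rewrite !fct_sumE epull_sum -sumrB; apply: eq_bigr => r' _.
  rewrite -/(Lpow omega r' (B r' s')) !LpowE -itE.
  rewrite (iterLD (ewedge_linr _)).
  by rewrite (iterLN (ewedge_linr _)).
split=> //.
  move=> r s rs; apply/primitive_nat; first by lia.
  by have [l1 e1] := B1 _ _ rs; split=> //; apply/dformE.
rewrite AE /dsum; apply: eq_bigr => s _.
have le : ((n - s).+1 <= n.+1)%N by rewrite ltnS leq_subr.
rewrite (big_ord_widen n.+1 (fun r => Lpow omega r (B r s)) le).
rewrite [RHS]big_mkcond; apply: eq_bigr => r _; case: ltnP => // rn.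
by rewrite B2 ?(iterL0 LopP) //; lia.
Qed.

End LefschetzForms.

(** * The module of inhomogeneous forms *)

Section FormType.
Context {R : realType} {m : nat} {M : manifold R m}.

Definition form_pred : {pred chart_family M} := fun A => `[< is_form A >].

Lemma form_predP A : reflect (is_form A) (A \in form_pred).
Proof. exact: asboolP. Qed.

Lemma form_submod : submod_closed form_pred.
Proof.
split; first by apply/form_predP; exact: is_form0.
move=> c A B /form_predP hA /form_predP hB; apply/form_predP; exact: is_formP.
Qed.

(** Bundling yields an lmodule on which the operators are linear everywhere, as the transfer lemmas
    require. *)
Record form := Form { fval : chart_family M; fvalP : fval \in form_pred }.

HB.instance Definition _ := [isSub for fval].
HB.instance Definition _ := [Choice of form by <:].
HB.instance Definition _ := GRing.SubChoice_isSubLmodule.Build R (chart_family M)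
  form_pred form form_submod.

End FormType.
Arguments form {R m} M.

Section FormOps.
Context {R : realType} {m : nat} {M : manifold R m}.
Implicit Types (a b c : form M) (k l : int).

Lemma form_is a : is_form (fval a).
Proof. exact/form_predP/fvalP. Qed.

Definition mkform A (hA : is_form A) : form M := Form (introT (form_predP A) hA).

Lemma form_inj a b : fval a = fval b -> a = b.
Proof. exact: val_inj. Qed.

Lemma fvalE (k : R) a b : fval (k *: a + b) = k *: fval a + fval b.
Proof. exact: (@linearP _ _ _ _ (val : {linear form M -> chart_family M})). Qed.

Definition fwedge a b := mkform (is_form_wedge (form_is a) (form_is b)).
Definition fextd a := mkform (is_form_extd (form_is a)).
Definition fdeg k a := dform k (fval a).

Lemma fextd_linear : linear fextd.
Proof.
move=> k a b; apply: form_inj; rewrite -[LHS]/(extd (fval (k *: a + b))) !fvalE.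
by rewrite extd_linear //; apply: is_form_sfam; exact: form_is.
Qed.

Lemma fwedgePl (k : R) a b c : fwedge (k *: a + b) c = k *: fwedge a c + fwedge b c.
Proof.
apply: form_inj; rewrite -[LHS]/(wedge (fval (k *: a + b)) (fval c)) !fvalE.
by rewrite wedgePl.
Qed.

Lemma fwedgePr (k : R) a b c : fwedge c (k *: a + b) = k *: fwedge c a + fwedge c b.
Proof.
apply: form_inj; rewrite -[LHS]/(wedge (fval c) (fval (k *: a + b))) !fvalE.
by rewrite wedgePr.
Qed.

Lemma fval0 : fval (0 : form M) = 0.
Proof. by have := fvalE (-1) 0 0; rewrite !scaleN1r addNr => ->; rewrite addNr. Qed.

Lemma fvalN a : fval (- a) = - fval a.
Proof. by rewrite -scaleN1r -[_ *: _]addr0 fvalE fval0 addr0 scaleN1r. Qed.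

Lemma fvalD a b : fval (a + b) = fval a + fval b.
Proof. by rewrite -[a in LHS]scale1r fvalE scale1r. Qed.

Lemma fvalZ (k : R) a : fval (k *: a) = k *: fval a.
Proof. by rewrite -[_ *: _ in LHS]addr0 fvalE fval0 addr0. Qed.

Lemma fwedgeA a b c : fwedge a (fwedge b c) = fwedge (fwedge a b) c.
Proof. by apply: form_inj; rewrite /= wedgeA. Qed.

Lemma fextd_fextd a : fextd (fextd a) = 0.
Proof.
by apply: form_inj; rewrite fval0 /= extd_extd //; exact/is_form_sfam/form_is.
Qed.

Lemma fextd_fwedge k a b : fdeg k a ->
  fextd (fwedge a b) = fwedge (fextd a) b + ((-1) ^ k : R) *: fwedge a (fextd b).
Proof.
move=> /dformE[la _]; apply: form_inj; rewrite fvalD fvalZ /=.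
by rewrite (extd_wedge la) //; exact/is_form_sfam/form_is.
Qed.

Lemma fdegP k (c : R) a b : fdeg k a -> fdeg k b -> fdeg k (c *: a + b).
Proof. by move=> ha hb; rewrite /fdeg fvalE; exact: dformP. Qed.

Lemma fdeg_wedge k l a b : fdeg k a -> fdeg l b -> fdeg (k + l) (fwedge a b).
Proof. exact: dform_wedge. Qed.

Lemma fdeg_extd k a : fdeg k a -> fdeg (k + 1) (fextd a).
Proof. exact: dform_extd. Qed.

End FormOps.

(** * Reflection, negative powers and projection *)

Section LefschetzOperators.
Context {R : realType} {n : nat} {M : manifold R n.*2} (omega : chart_family M).
Hypothesis homega : symplectic omega.
Implicit Types (A : chart_family M) (a b : form M) (q : nat -> nat -> nat).
Implicit Types (c : pred nat) (r s p : nat).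
Local Notation lef := (lef omega).
Local Notation Lpow := (Lpow omega).

Lemma lefschetz_decP (k : R) A A' B B' : lefschetz_dec omega A B ->
  lefschetz_dec omega A' B' ->
  lefschetz_dec omega (k *: A + A') (fun r s => k *: B r s + B' r s).
Proof.
move=> [B1 B2 ->] [C1 C2 ->]; split.
- by move=> r s rs; apply: primitiveP => //; [exact: B1 | exact: C1].
- by move=> r s rs; rewrite B2 // C2 // scaler0 addr0.
- rewrite scaler_sumr -big_split; apply: eq_bigr => s _ /=.
  rewrite scaler_sumr -big_split; apply: eq_bigr => r _ /=.
  by rewrite LpowP.
Qed.

Lemma lef_dec A : is_form A -> lefschetz_dec omega A (lef A).
Proof.
move=> hA; suff [B dB] : exists B, lefschetz_dec omega A B.
  by rewrite (lefE homega dB).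
elim: hA => [k A' hA'|k A1 A2 _ [B1 d1] _ [B2 d2]].
  by have [B dB _] := lefschetz_dec_ex homega hA'; exists B.
by eexists; exact: lefschetz_decP d1 d2.
Qed.

Lemma lefP (k : R) A A' r s : is_form A -> is_form A' ->
  lef (k *: A + A') r s = k *: lef A r s + lef A' r s.
Proof.
by move=> hA hA'; rewrite (lefE homega (lefschetz_decP k (lef_dec hA) (lef_dec hA'))).
Qed.

Lemma lef_dform (k : int) A r s : dform k A -> (2 * r + s)%N%:Z != k ->
  lef A r s = 0.
Proof.
move=> hA; have [B dB Bk] := lefschetz_dec_ex homega hA.
by rewrite (lefE homega dB); exact: Bk.
Qed.

Lemma lef_large A r s : is_form A -> (n < r + s)%N -> lef A r s = 0.
Proof. by move=> /lef_dec[_ + _]; apply. Qed.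

Lemma lef_primitive A r s : is_form A -> primitive omega s (lef A r s).
Proof.
move=> hA; case: (leqP (r + s) n) => rs; first by have [+ _ _] := lef_dec hA; apply.
by rewrite lef_large //; exact: primitive0.
Qed.

(** The common shape of [star], [Lneg] and [filt_proj]; [q] gives the new exponent of L and [c]
    selects the terms that are kept. *)
Definition lefschetz_op q c A : chart_family M :=
  \sum_(s < n.+1) \sum_(r < (n - s).+1 | c r) Lpow (q r s) (lef A r s).

Lemma is_form_Lpow r A : is_form A -> is_form (Lpow r A).
Proof.
move=> hA; elim: r => //= r IH; apply: is_form_wedge => //.
by case: homega => h2 _ _; exact: is_form_dform h2.
Qed.

Lemma is_form_lef A r s : is_form A -> is_form (lef A r s).
Proof. by move=> /(lef_primitive r s)/primitive_dform/is_form_dform. Qed.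

Lemma is_form_lefschetz_op q c A : is_form A -> is_form (lefschetz_op q c A).
Proof.
move=> hA; apply: is_form_sum => s _; apply: is_form_sum => r _.
exact/is_form_Lpow/is_form_lef.
Qed.

Lemma lefschetz_op_linear q c (k : R) A A' : is_form A -> is_form A' ->
  lefschetz_op q c (k *: A + A') = k *: lefschetz_op q c A + lefschetz_op q c A'.
Proof.
move=> hA hA'; rewrite /lefschetz_op scaler_sumr -big_split; apply: eq_bigr => s _ /=.
rewrite scaler_sumr -big_split; apply: eq_bigr => r _ /=.
by rewrite lefP // LpowP.
Qed.

Lemma dform_sum (k : int) (I : Type) (t : seq I) (P : pred I) (F : I -> chart_family M) :
  (forall x, P x -> dform k (F x)) -> dform k (\sum_(x <- t | P x) F x).
Proof.
move=> hF; elim/big_ind: _ => //; first exact: dform0.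
by move=> x y hx hy; rewrite -[x]scale1r; exact: dformP.
Qed.

Lemma dform_lefschetz_op q c (k k' : int) A : dform k A ->
  (forall r s, c r -> (r + s <= n)%N -> (2 * r + s)%N%:Z = k ->
     (s + 2 * q r s)%N%:Z = k') ->
  dform k' (lefschetz_op q c A).
Proof.
move=> hA hq; apply: dform_sum => s _; apply: dform_sum => r cr.
case: (eqVneq (2 * r + s)%N%:Z k) => [rk|/(lef_dform hA) ->]; last first.
  by rewrite Lpow0; exact: dform0.
rewrite -(hq r s) //; last by have := ltn_ord r; have := ltn_ord s; lia.
rewrite PoszD; apply: dform_Lpow => //.
exact/primitive_dform/lef_primitive/is_form_dform/hA.
Qed.

Lemma Lpow_add (q : nat) r A : Lpow q (Lpow r A) = Lpow (q + r) A.
Proof. by rewrite /Defs.Lpow iterD. Qed.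

Lemma Lpow_primitive0 r s A : (s <= n)%N -> primitive omega s A -> (n < r + s)%N ->
  Lpow r A = 0.
Proof.
move=> sn /(primitive_nat _ _ sn)[_ e] rs.
have le : (n.+1 - s <= r)%N by lia.
by rewrite -(subnK le) -Lpow_add e Lpow0.
Qed.

Lemma lef_basis r s A : (r + s <= n)%N -> primitive omega s A ->
  lef (Lpow r A) = fun r' s' => if (r' == r) && (s' == s) then A else 0.
Proof.
move=> rs pA; apply: (lefE homega); split.
- by move=> r' s' _; case: andP => [[_ /eqP ->]//|_]; exact: primitive0.
- by move=> r' s' rs'; case: andP => // -[/eqP E1 /eqP E2]; move: rs rs'; rewrite E1 E2; lia.
- have sn : (s < n.+1)%N by lia.
  have rn : (r < (n - s).+1)%N by lia.
  rewrite (bigD1 (Ordinal sn)) //= [X in _ + X]big1 ?addr0 => [|s' s's].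
    rewrite (bigD1 (Ordinal rn)) //= [X in _ + X]big1 ?addr0 ?eqxx // => r' r'r.
    rewrite -[r' == r :> nat]/(r' == Ordinal rn) (negbTE r'r).
    exact: Lpow0.
  rewrite big1 // => r' _; rewrite -[s' == s :> nat]/(s' == Ordinal sn).
  by rewrite (negbTE s's) andbF Lpow0.
Qed.

Lemma lefschetz_op_basis q c r s A : (r + s <= n)%N -> primitive omega s A ->
  lefschetz_op q c (Lpow r A) = if c r then Lpow (q r s) A else 0.
Proof.
move=> rs pA; rewrite /lefschetz_op (lef_basis rs pA).
have sn : (s < n.+1)%N by lia.
have rn : (r < (n - s).+1)%N by lia.
rewrite (bigD1 (Ordinal sn)) //= [X in _ + X]big1 ?addr0 => [|s' s's]; last first.
  rewrite big1 // => r' _; rewrite -[s' == s :> nat]/(s' == Ordinal sn).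
  by rewrite (negbTE s's) andbF Lpow0.
rewrite big_mkcond (bigD1 (Ordinal rn)) //= [X in _ + X]big1 ?addr0 ?eqxx // => r' r'r.
rewrite -[r' == r :> nat]/(r' == Ordinal rn) (negbTE r'r) Lpow0.
by case: ifP.
Qed.

Definition fop q c a : form M := mkform (is_form_lefschetz_op q c (form_is a)).
Definition fpow r a : form M := mkform (is_form_Lpow r (form_is a)).

Lemma fop_linear q c : linear (fop q c).
Proof.
move=> k a b; apply: form_inj.
rewrite -[LHS]/(lefschetz_op q c (fval (k *: a + b))) !fvalE lefschetz_op_linear //; exact: form_is.
Qed.

Lemma fpow_linear r : linear (fpow r).
Proof.
move=> k a b; apply: form_inj.
by rewrite -[LHS]/(Lpow r (fval (k *: a + b))) !fvalE LpowP.
Qed.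

(** The operator identities below are all checked on single terms L^r B_s with B_s primitive. *)
Lemma form_lin_eq (f g : form M -> form M) : linear f -> linear g ->
  (forall r s b, (r + s <= n)%N -> primitive omega s (fval b) ->
     f (fpow r b) = g (fpow r b)) -> forall a, f a = g a.
Proof.
move=> lf lg fg a.
have f0 : f 0 = 0 by have := lf (-1) 0 0; rewrite !scaleN1r oppr0 addr0 addNr.
have g0 : g 0 = 0 by have := lg (-1) 0 0; rewrite !scaleN1r oppr0 addr0 addNr.
have fD x y : f (x + y) = f x + f y.
  by have := lf 1 x y; rewrite !scale1r.
have gD x y : g (x + y) = g x + g y.
  by have := lg 1 x y; rewrite !scale1r.
pose b r s := mkform (is_form_lef r s (form_is a)).
have -> : a = \sum_(s < n.+1) \sum_(r < (n - s).+1) fpow r (b r s).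
  apply: form_inj; have [_ _ E] := lef_dec (form_is a); rewrite {1}E.
  rewrite (big_morph fval (@fvalD _ _ M) (@fval0 _ _ M)); apply: eq_bigr => s _.
  by rewrite (big_morph fval (@fvalD _ _ M) (@fval0 _ _ M)).
rewrite (big_morph f fD f0) (big_morph g gD g0); apply: eq_bigr => s _.
rewrite (big_morph f fD f0) (big_morph g gD g0); apply: eq_bigr => r _.
apply: (fg r s); first by have := ltn_ord r; have := ltn_ord s; lia.
exact/lef_primitive/form_is.
Qed.

Lemma fop_basis q c r s b : (r + s <= n)%N -> primitive omega s (fval b) ->
  fop q c (fpow r b) = if c r then fpow (q r s) b else 0.
Proof.
move=> rs pb; apply: form_inj; rewrite -[LHS]/(lefschetz_op q c (Lpow r (fval b))).
by rewrite (lefschetz_op_basis _ _ rs pb); case: ifP => // _; rewrite fval0.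
Qed.

Lemma fpow_add r r' b : fpow r (fpow r' b) = fpow (r + r') b.
Proof. by apply: form_inj; exact: Lpow_add. Qed.

Lemma fpow_primitive0 r s b : (s <= n)%N -> primitive omega s (fval b) ->
  (n < r + s)%N -> fpow r b = 0.
Proof.
by move=> sn pb rs; apply: form_inj; rewrite fval0; exact: Lpow_primitive0 pb rs.
Qed.

Definition fstar := fop (fun r s => n - r - s)%N xpredT.
Definition fneg p := fop (fun r s => r - p)%N (fun r => p <= r)%N.
Definition fproj p := fop (fun r s => r) (fun r => r <= p)%N.

Lemma fval_star a : fval (fstar a) = star omega (fval a).
Proof. by []. Qed.
Lemma fval_proj p a : fval (fproj p a) = filt_proj omega p (fval a).
Proof. by []. Qed.

Lemma linear_id_fun : linear (fun a : form M => a).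
Proof. by []. Qed.

Lemma linear_compf (f g : form M -> form M) : linear f -> linear g ->
  linear (fun a => f (g a)).
Proof. by move=> lf lg k x y; rewrite lg lf. Qed.

Lemma linear_subf (f g : form M -> form M) : linear f -> linear g ->
  linear (fun a => f a - g a).
Proof.
move=> lf lg k x y; rewrite lf lg scalerBr opprD.
by rewrite addrACA.
Qed.

Lemma linear0f (f : form M -> form M) : linear f -> f 0 = 0.
Proof. by move=> lf; have := lf (-1) 0 0; rewrite !scaleN1r oppr0 addr0 addNr. Qed.

Lemma fop0 q c : fop q c 0 = 0.
Proof. exact: linear0f (@fop_linear _ _). Qed.

Lemma fpow0 r : fpow r 0 = 0.
Proof. exact: linear0f (@fpow_linear _). Qed.

Lemma fstarK a : fstar (fstar a) = a.
Proof.
apply: (form_lin_eq (f := fun a => fstar (fstar a)) (g := fun a => a)) => //.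
  by apply: linear_compf; exact: fop_linear.
move=> r s b rs pb; rewrite [fstar (fpow r b)](fop_basis _ _ rs pb) /=.
rewrite [LHS](fop_basis _ _ _ pb) /=; last by lia.
by congr fpow; lia.
Qed.

Lemma fpow_neg p a : fpow p.+1 (fneg p.+1 a) = a - fproj p a.
Proof.
apply: (form_lin_eq (f := fun a => fpow p.+1 (fneg p.+1 a))
  (g := fun a => a - fproj p a)).
- by apply: linear_compf; [exact: fpow_linear | exact: fop_linear].
- by apply: linear_subf; [exact: linear_id_fun | exact: fop_linear].
move=> r s b rs pb.
rewrite /fneg /fproj !(fop_basis _ _ rs pb); case: (leqP r p) => rp.
  by rewrite fpow0 subrr.
by rewrite subr0 fpow_add subnKC.
Qed.

(** A nonzero term L^r B_s is killed by L^(p+1) exactly when n - r - s <= p, that is, when its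
    reflection lies in the filtration. *)
Lemma fneg_pow p a : fneg p.+1 (fpow p.+1 a) = a - fstar (fproj p (fstar a)).
Proof.
apply: (form_lin_eq (f := fun a => fneg p.+1 (fpow p.+1 a))
  (g := fun a => a - fstar (fproj p (fstar a)))).
- by apply: linear_compf; [exact: fop_linear | exact: fpow_linear].
- apply: linear_subf; first exact: linear_id_fun.
  by do 2!(apply: linear_compf; first exact: fop_linear); exact: fop_linear.
move=> r s b rs pb; rewrite fpow_add [fstar (fpow r b)](fop_basis _ _ rs pb) /=.
have rs' : (n - r - s + s <= n)%N by lia.
rewrite [fproj p _](fop_basis _ _ rs' pb); case: (leqP (n - r - s) p) => rp.
  rewrite [X in _ - X](fop_basis _ _ rs' pb) /= (_ : (n - (n - r - s) - s = r)%N); last by lia.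
  rewrite subrr (fpow_primitive0 _ pb); [|lia|lia].
  exact: fop0.
rewrite [fstar 0]fop0 subr0 [LHS](fop_basis _ _ _ pb); last by lia.
by rewrite leq_addr addKn.
Qed.

Lemma fpow_neg_pow p a : fpow p.+1 (fneg p.+1 (fpow p.+1 a)) = fpow p.+1 a.
Proof.
apply: (form_lin_eq (f := fun a => fpow p.+1 (fneg p.+1 (fpow p.+1 a)))
  (g := fpow p.+1)); try exact: fpow_linear.
  apply: linear_compf; first exact: fpow_linear.
  by apply: linear_compf; [exact: fop_linear | exact: fpow_linear].
move=> r s b rs pb; rewrite !fpow_add.
case: (leqP (p.+1 + r + s) n) => prs; last first.
  rewrite (fpow_primitive0 _ pb); [|lia|lia].
  by rewrite [fneg _ 0]fop0 fpow0.
by rewrite [fneg _ _](fop_basis _ _ prs pb) leq_addr addKn fpow_add.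
Qed.

Lemma fneg_pow_neg p a : fneg p.+1 (fpow p.+1 (fneg p.+1 a)) = fneg p.+1 a.
Proof.
apply: (form_lin_eq (f := fun a => fneg p.+1 (fpow p.+1 (fneg p.+1 a)))
  (g := fneg p.+1)); try exact: fop_linear.
  apply: linear_compf; first exact: fop_linear.
  by apply: linear_compf; [exact: fpow_linear | exact: fop_linear].
move=> r s b rs pb; rewrite [fneg _ (fpow r b)](fop_basis _ _ rs pb).
case: (leqP p.+1 r) => pr; last first.
  by rewrite fpow0 [fneg _ 0]fop0.
by rewrite fpow_add subnKC // [LHS](fop_basis _ _ rs pb) pr.
Qed.

Lemma fpow_fwedgel r a b : fwedge (fpow r a) b = fpow r (fwedge a b).
Proof.
apply: form_inj; rewrite /=; elim: r => //= r IH.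
by rewrite /Lop -wedgeA IH.
Qed.

Lemma omega_comm A : is_form A -> wedge omega A = wedge A omega.
Proof.
case: homega => /dformE[lo _] _ _.
elim=> [k B /dformE[lB _]|k B C _ IB _ IC]; last by rewrite wedgePl wedgePr IB IC.
by rewrite (wedge_comm lo lB) -exprz_exp -exprnP sqrrN expr1n exp1rz scale1r.
Qed.

Lemma fpow_fwedger r a b : fwedge a (fpow r b) = fpow r (fwedge a b).
Proof.
apply: form_inj; rewrite /=; elim: r => //= r IH.
by rewrite /Lop wedgeA -(omega_comm (form_is a)) -wedgeA IH.
Qed.

Lemma fextd_fpow r a : fextd (fpow r a) = fpow r (fextd a).
Proof.
apply: form_inj; rewrite /=; elim: r => //= r IH.
case: homega => /dformE[lo _] do0 _.
rewrite /Lop (extd_wedge lo); last exact/is_form_sfam/is_form_Lpow/form_is.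
by rewrite do0 wedge0l add0r -exprnP sqrrN expr1n scale1r IH.
Qed.

Lemma fdeg_star (k : int) a : fdeg k a -> fdeg ((2 * n)%N%:Z - k) (fstar a).
Proof. by move=> hk; apply: (dform_lefschetz_op hk) => r s _ rs; lia. Qed.

Lemma fdeg_neg p (k : int) a : fdeg k a -> fdeg (k - (2 * p)%N%:Z) (fneg p a).
Proof. by move=> hk; apply: (dform_lefschetz_op hk) => r s pr rs; lia. Qed.

Lemma fdeg_proj p (k : int) a : fdeg k a -> fdeg k (fproj p a).
Proof. by move=> hk; apply: (dform_lefschetz_op hk) => r s pr rs; lia. Qed.

(** If r <= p and 2r + s > n + p then r + s > n, and such a component vanishes. *)
Lemma fproj_large p (k : int) a : fdeg k a -> (n + p)%N%:Z < k -> fproj p a = 0.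
Proof.
move=> hk pk; apply: form_inj; rewrite fval0.
rewrite -[LHS]/(lefschetz_op _ _ (fval a)) /lefschetz_op big1 // => s _; rewrite big1 // => r rp.
rewrite (lef_dform hk) ?Lpow0 //; have := ltn_ord r; have := ltn_ord s; lia.
Qed.

(* Every term L^r B of a form of degree k < n - p survives L^(p+1). *)
Lemma fpow_ker_small p (k : int) a : fdeg k a -> k + p%:Z < n%:Z ->
  fstar (fproj p (fstar a)) = 0.
Proof.
move=> hk pk; rewrite (fproj_large (fdeg_star hk)).
  exact: fop0.
lia.
Qed.

End LefschetzOperators.

Arguments mkform : simpl never.
Arguments fop : simpl never.
Arguments fstar : simpl never.
Arguments fneg : simpl never.
Arguments fproj : simpl never.
Arguments fpow : simpl never.
Arguments fwedge : simpl never.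
Arguments fextd : simpl never.

(** * Filtered forms as a transferred cone *)

Section Model.
Context {R : realType} {n : nat} {M : manifold R n.*2} (omega : chart_family M).
Hypothesis homega : symplectic omega.
Variable p : nat.
Implicit Types (x y z : form M) (u v w : form M * form M) (D : int).
Local Notation P := (fproj homega p).
Local Notation star := (fstar homega).
Local Notation W := (fpow homega p.+1).
Local Notation H := (fneg homega p.+1).
Local Notation d := (@fextd R n.*2 M).
Local Notation "x ** y" := (fwedge x y) (at level 40, left associativity).
Local Notation K := (kerP H W).
Local Notation M1 := (cone_m1 d H W).
Local Notation M2 := (cone_m2 (@fwedge R n.*2 M) d H W).
Local Notation M3 := (cone_m3 (@fwedge R n.*2 M) H W).

Lemma cokP_proj x : cokP H W x = P x.
Proof. by rewrite /cokP fpow_neg subKr. Qed.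

Lemma kerP_star x : K x = star (P (star x)).
Proof. by rewrite /kerP fneg_pow subKr. Qed.

(** The zero form has both parities. *)
Definition par (a : bool) x :=
  exists2 j : int, fdeg j x & ((-1) ^ j : R) = (-1) ^+ nat_of_bool a.

Lemma par_fextd a x : par a x -> par (~~ a) (d x).
Proof.
move=> [j hj ja]; exists (j + 1); first exact: fdeg_extd.
rewrite exprzDr ?unitrN1 // ja expr1z.
by case: a {ja}; rewrite ?expr0 ?expr1; ring.
Qed.

Lemma par_fneg a x : par a x -> par a (H x).
Proof.
move=> [j hj ja]; exists (j - (2 * p.+1)%N%:Z); first exact: fdeg_neg.
rewrite exprzDr ?unitrN1 // ja -[RHS]mulr1; congr (_ * _).
by rewrite -invr_expz -exprnP exprM sqrrN !expr1n invr1.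
Qed.

Lemma par_wedge a b x y : par a x -> par b y -> par (a (+) b) (x ** y).
Proof.
move=> [j hj ja] [k hk kb]; exists (j + k); first exact: fdeg_wedge.
by rewrite exprzDr ?unitrN1 // ja kb signr_addb.
Qed.

Lemma par_leib a x y : par a x -> d (x ** y) = d x ** y + (-1) ^+ nat_of_bool a *: (x ** d y).
Proof. by move=> [j hj <-]; exact: fextd_fwedge. Qed.

(** A consequence of H W H = H alone, as the projection is 1 - W H. *)
Lemma fproj_idem x : P (P x) = P x.
Proof.
rewrite -!cokP_proj /cokP.
have HD a b : H (a - b) = H a - H b.
  by rewrite -scaleN1r addrC [H (_ + _)]fop_linear addrC scaleN1r.
by rewrite HD fneg_pow_neg subrr fpow0 subr0.
Qed.

Lemma fprojP k x y : P (k *: x + y) = k *: P x + P y.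
Proof. exact: fop_linear. Qed.
Lemma fstarP k x y : star (k *: x + y) = k *: star x + star y.
Proof. exact: fop_linear. Qed.
Lemma fproj0 : P 0 = 0. Proof. exact: fop0. Qed.
Lemma fstar0 : star 0 = 0. Proof. exact: fop0. Qed.
Lemma fneg0 : H 0 = 0. Proof. exact: fop0. Qed.
Lemma fextd0 : d 0 = 0. Proof. exact: linear0f (@fextd_linear _ _ _). Qed.
Lemma fwedge0l x : 0 ** x = 0.
Proof. by apply: form_inj; rewrite -[LHS]/(wedge (fval 0) (fval x)) !fval0 wedge0l. Qed.
Lemma fwedge0r x : x ** 0 = 0.
Proof. by apply: form_inj; rewrite -[LHS]/(wedge (fval x) (fval 0)) !fval0 wedge0r. Qed.
Lemma kerP0 : K 0 = 0. Proof. by rewrite kerP_star fstar0 fproj0 fstar0. Qed.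

Lemma fpowB q x y : fpow homega q (x - y) = fpow homega q x - fpow homega q y.
Proof. by rewrite -scaleN1r addrC fpow_linear addrC scaleN1r. Qed.

Lemma fpow_kerP x : W (K x) = 0.
Proof. by rewrite /kerP fpowB fpow_neg_pow subrr. Qed.

Lemma kerP_id x : W x = 0 -> K x = x.
Proof. by move=> Wx; rewrite /kerP Wx fneg0 subr0. Qed.

Lemma fdeg0 D : fdeg D (0 : form M).
Proof. by rewrite /fdeg fval0; exact: dform0. Qed.

Lemma fdegN D x : fdeg D x -> fdeg D (- x).
Proof. by move=> h; rewrite -scaleN1r -[_ *: x]addr0; apply: fdegP => //; exact: fdeg0. Qed.

Lemma fdegD D x y : fdeg D x -> fdeg D y -> fdeg D (x + y).
Proof. by move=> hx hy; rewrite -[x]scale1r; exact: fdegP. Qed.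

Lemma fdegZ D (k : R) x : fdeg D x -> fdeg D (k *: x).
Proof. by move=> hx; rewrite -[_ *: x]addr0; apply: fdegP => //; exact: fdeg0. Qed.

Lemma fdeg_kerP D x : fdeg D x -> fdeg D (K x).
Proof.
move=> h; rewrite kerP_star (_ : D = (2 * n)%N%:Z - ((2 * n)%N%:Z - D)); last by lia.
by apply: fdeg_star; apply: fdeg_proj; exact: fdeg_star.
Qed.

Lemma fdeg_eq0 D x : fdeg D x -> (D < 0) || ((2 * n)%N%:Z < D) -> x = 0.
Proof.
move=> /dformE[l _] hD; apply: form_inj; rewrite fval0.
by case/orP: hD => h; [exact: lform_neg l | apply: lform_large l; rewrite -mul2n].
Qed.

Lemma kerP_small D x : fdeg D x -> D + p%:Z < n%:Z -> K x = 0.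
Proof. by move=> h hD; rewrite kerP_star; exact: fpow_ker_small h hD. Qed.

(* An element of F_p of degree D is a pair (x, y) with x in F^p Omega^D and y
   in the kernel of omega^(p+1); a barred form is represented by its image
   under the reflection. *)
Definition good D u := if D <= (n + p)%N%:Z
  then [/\ fdeg D u.1, P u.1 = u.1 & u.2 = 0]
  else [/\ u.1 = 0, fdeg (D - (2 * p)%N%:Z - 1) u.2 & W u.2 = 0].

Definition emb D u : chart_family M :=
  if D <= (n + p)%N%:Z then fval u.1 else fval (star u.2).

Lemma good0 D : good D 0.
Proof.
rewrite /good; case: ifP => _; split => //=; rewrite ?fproj0 ?fpow0 //; exact: fdeg0.
Qed.

Lemma goodP D (k : R) u v : good D u -> good D v -> good D (k *: u + v).
Proof.
rewrite /good /=; case: ifP => _ [u1 u2 u3] [v1 v2 v3]; split.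
- exact: fdegP.
- by rewrite fprojP u2 v2.
- by rewrite u3 v3 scaler0 addr0.
- by rewrite u1 v1 scaler0 addr0.
- exact: fdegP.
- by rewrite fpow_linear u3 v3 scaler0 addr0.
Qed.

Lemma embP D (k : R) u v : emb D (k *: u + v) = k *: emb D u + emb D v.
Proof.
rewrite /emb; case: ifP => _; first exact: fvalE.
by rewrite -fvalE -fstarP.
Qed.

Lemma emb0 D : emb D 0 = 0.
Proof. by rewrite /emb; case: ifP; rewrite ?[(0 : _ * _).2]/= ?fstar0 ?fval0. Qed.

Lemma good_Fp D u : good D u -> Fp omega p D (emb D u).
Proof.
rewrite /good /emb /Fp; case: (lerP D (n + p)%N%:Z) => hD.
  move=> [u1 u2 _]; rewrite andbT; case: (lerP 0 D) => D0.
    by exists (fval u.1) => //; rewrite -fval_proj u2.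
  by rewrite (fdeg_eq0 u1) ?D0 // fval0.
move=> [_ u2 u3]; rewrite andbF; case: (lerP D (2 * n + 2 * p + 1)%N%:Z) => D2.
  exists (fval (star u.2)).
    have -> : (2 * n + 2 * p + 1)%N%:Z - D = (2 * n)%N%:Z - (D - (2 * p)%N%:Z - 1) by lia.
    exact: fdeg_star.
  (* The reflection exchanges the kernel of W with the range of the projection. *)
  have E : star u.2 = P (star u.2) by rewrite -[u.2 in LHS](kerP_id u3) kerP_star fstarK.
  by rewrite -fval_proj -E.
have -> : u.2 = 0 by apply: (fdeg_eq0 u2); lia.
by rewrite fstar0 fval0.
Qed.

Lemma Fp_good D A : Fp omega p D A -> exists2 u, good D u & A = emb D u.
Proof.
rewrite /good /emb /Fp; case: (lerP D (n + p)%N%:Z) => hD; rewrite ?andbT ?andbF /=.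
  case: (lerP 0 D) => D0.
    move=> [B hB <-]; pose b := mkform (is_form_dform hB).
    exists (P b, 0); last by [].
    by split=> //=; [exact: fdeg_proj | exact: fproj_idem].
  move=> ->; exists 0; last exact: (esym (@fval0 _ _ M)).
  by split; rewrite ?fproj0 //; exact: fdeg0.
case: (lerP D (2 * n + 2 * p + 1)%N%:Z) => D2.
  move=> [B hB <-]; pose b := mkform (is_form_dform hB).
  exists (0, star (P b)); last exact: (congr1 fval (esym (fstarK homega (P b)))).
  split=> //=.
    rewrite (_ : D - _ - 1 = (2 * n)%N%:Z - ((2 * n + 2 * p + 1)%N%:Z - D)); last by lia.
    by apply: fdeg_star; exact: fdeg_proj.
  have -> : star (P b) = K (star (P b)) by rewrite kerP_star fstarK fproj_idem.
  exact: fpow_kerP.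
move=> ->; exists 0; last exact: (esym (etrans (congr1 fval fstar0) (@fval0 _ _ M))).
by split; rewrite ?fpow0 //; exact: fdeg0.
Qed.

End Model.

(** * The operators del_plus and del_minus, and the middle differential *)

Section DelPlusMinus.
Context {R : realType} {n : nat} {M : manifold R n.*2} (omega : chart_family M).
Hypothesis homega : symplectic omega.
Implicit Types (A B : chart_family M) (x y : form M) (r s p : nat).
Local Notation Lpow := (Lpow omega).
Local Notation primitive := (primitive omega).
Local Notation del_pair := (del_pair omega).

Lemma fstar_basis r s x : (r + s <= n)%N -> primitive s (fval x) ->
  fstar homega (fpow homega r x) = fpow homega (n - r - s) x.
Proof. by move=> rs px; rewrite [LHS](fop_basis _ _ _ rs px). Qed.

Lemma form_decomp x : x = \sum_(s < n.+1) \sum_(r < (n - s).+1)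
  fpow homega r (mkform (is_form_lef homega r s (form_is x))).
Proof.
apply: form_inj; have [_ _ E] := lef_dec homega (form_is x); rewrite {1}E.
rewrite (big_morph fval (@fvalD _ _ M) (@fval0 _ _ M)); apply: eq_bigr => s _.
by rewrite (big_morph fval (@fvalD _ _ M) (@fval0 _ _ M)).
Qed.

Lemma is_form_prim (s : int) A : primitive s A -> is_form A.
Proof. by move/primitive_dform/is_form_dform. Qed.

Lemma primitive_bound (s : int) A : primitive s A -> A != 0 -> 0 <= s <= n%:Z.
Proof. by rewrite /Defs.primitive /=; case: ifP => // _ ->; rewrite eqxx. Qed.

Definition del_spec (s : int) A (X : chart_family M * chart_family M) := [/\ primitive (s + 1) X.1,
  primitive (s - 1) X.2 & extd A = X.1 + Lop omega X.2].

(** Since d commutes with L, the form d A is killed by L^(n-s+1). Its nonzero components L^r b_t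
    then satisfy r + t >= s, and 2r + t = s + 1 leaves only r = 0 and r = 1. *)
Lemma del_pair_ex (s : nat) A : (s <= n)%N -> primitive s A ->
  exists X : chart_family M * chart_family M, del_spec s A X.
Proof.
move=> sn pA; have [dA LA] := (primitive_nat omega A sn).1 pA.
pose a := fextd (mkform (is_form_dform dA)).
have Wa : fpow homega (n - s).+1 a = 0.
  rewrite -fextd_fpow (_ : fpow _ _ _ = 0).
    exact: linear0f (@fextd_linear _ _ _).
  by apply: form_inj; rewrite fval0 -[RHS]LA subSn.
have da : dform (s%:Z + 1) (fval a) := dform_extd dA.
(* A form in the kernel of L^(n-s+1) equals its image under the projector [kerP] for p = n - s, so
   it is enough to inspect the terms that survive this projector. *)
have := kerP_id Wa; rewrite kerP_star {1}(form_decomp a).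
(* The claim is stated for an arbitrary form because it is additive and can then be checked term by
   term. *)
pose Q Y := exists X : chart_family M * chart_family M, [/\ primitive (s%:Z + 1) X.1, primitive (s%:Z - 1) X.2 &
  Y = X.1 + Lop omega X.2].
move=> E; suff : Q (fval a) by case=> X QX; exists X.
have Q0 : Q 0.
  exists (0, 0); split; try exact: primitive0.
  by rewrite /= add0r; exact: esym (Lpow0 omega 1).
have QD Y Z : Q Y -> Q Z -> Q (Y + Z).
  move=> [X [X1 X2 ->]] [X' [X1' X2' ->]]; exists (X.1 + X'.1, X.2 + X'.2).
  split=> /=.
  - by rewrite -[X.1]scale1r; exact: primitiveP.
  - by rewrite -[X.2]scale1r; exact: primitiveP.
  - by rewrite -[X.2 in RHS]scale1r LopP scale1r addrACA.
have sD : {morph (fun x => fstar homega (fproj homega (n - s) (fstar homega x))) :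
    x y / x + y}.
  move=> x y; rewrite -[x]scale1r fstarP fprojP fstarP !scale1r //.
have s0 : fstar homega (fproj homega (n - s) (fstar homega 0)) = 0.
  by rewrite !(fstar0, fproj0).
rewrite -E (big_morph _ sD s0) (big_morph fval (@fvalD _ _ M) (@fval0 _ _ M)).
elim/big_ind: _ => // t _.
rewrite (big_morph _ sD s0) (big_morph fval (@fvalD _ _ M) (@fval0 _ _ M)).
elim/big_ind: _ => // r _.
set b := mkform _.
have pb : primitive t (fval b) by exact/lef_primitive/form_is.
have rt : (r + t <= n)%N by have := ltn_ord r; have := ltn_ord t; lia.
have rt' : (n - r - t + t <= n)%N by lia.
rewrite (fstar_basis rt pb).
rewrite [fproj _ _ _](fop_basis _ _ _ rt' pb).
case: ifP => rts; last by rewrite fstar0 fval0.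
rewrite (fstar_basis rt' pb).
rewrite (_ : n - (n - r - t) - t = r)%N; last by lia.
case: (eqVneq (2 * r + t)%N (s + 1)%N) => [E2|E2]; last first.
  rewrite (_ : b = 0) ?fpow0 ?fval0 //; apply: form_inj; rewrite fval0.
  by apply: (lef_dform homega da); move: E2; lia.
have [r0|r0] := posnP r.
  exists (fval b, 0); split=> /=; last by rewrite r0 [Lop _ 0](Lpow0 omega 1) addr0.
    by rewrite (_ : s%:Z + 1 = t) //; lia.
  exact: primitive0.
have r1 : (r : nat) = 1%N by lia.
exists (0, fval b); split=> /=; first exact: primitive0.
  by rewrite (_ : s%:Z - 1 = t) //; lia.
by rewrite r1 add0r.
Qed.

Lemma del_pairP (s : nat) A : (s <= n)%N -> primitive s A ->
  del_spec s A (del_pair s A).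
Proof.
move=> sn pA; have [X hX] := del_pair_ex sn pA.
exact: (@xgetPex _ (0, 0) [set X | del_spec s A X] (ex_intro _ X hX)).
Qed.

Lemma lef0 r s : lef omega 0 r s = 0.
Proof. by rewrite (lef_dform homega (dform0 (2 * r + s + 1)%N%:Z)) //; lia. Qed.

(** [del_plus] and [del_minus] also sum over zero components, so the pair chosen for 0 has to be
    known. Its two parts occupy different slots of the Lefschetz decomposition of 0, hence both
    vanish. *)
Lemma del_pair0 (s : nat) : (s <= n)%N -> del_pair s 0 = (0, 0).
Proof.
move=> sn; have [] := del_pairP sn (primitive0 omega s).
case: (del_pair s 0) => X Y /= pX pY; rewrite (_ : extd 0 = 0); last first.
  have := extd_linear (-1) (is_form_sfam is_form0) (is_form_sfam (@is_form0 _ _ M)).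
  by rewrite !scaleN1r oppr0 addr0 addNr.
move=> E.
have key r t : lef omega X r t + lef omega (Lpow 1 Y) r t = 0.
  rewrite -(lef0 r t) E -[X in RHS]scale1r.
  rewrite (lefP homega) ?scale1r //; first exact: is_form_prim pX.
  exact: (@is_form_Lpow _ _ _ _ homega 1 _ (is_form_prim pY)).
have X0 : X = 0.
  apply: contrapT => /eqP X0; have := primitive_bound pX X0 => sb.
  have sb' : (0 + s.+1 <= n)%N by lia.
  have pX' : primitive s.+1 X by rewrite (_ : Posz _ = s%:Z + 1) //; lia.
  have := key 0%N s.+1.
  rewrite -[X in lef omega X]/(Lpow 0 X) (lef_basis homega sb' pX') !eqxx [true && true]/=.
  have [->|Y0] := eqVneq Y 0.
    by rewrite Lpow0 lef0 addr0 => /eqP; rewrite (negbTE X0).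
  have := primitive_bound pY Y0 => sY.
  have sY' : (1 + s.-1 <= n)%N by lia.
  have pY' : primitive s.-1 Y by rewrite (_ : Posz _ = s%:Z - 1) //; lia.
  by rewrite (lef_basis homega sY' pY') /= addr0 => /eqP; rewrite (negbTE X0).
rewrite X0; congr pair.
apply: contrapT => /eqP Y0; have := primitive_bound pY Y0 => sY.
have sY' : (1 + s.-1 <= n)%N by lia.
have pY' : primitive s.-1 Y by rewrite (_ : Posz _ = s%:Z - 1) //; lia.
have := key 1%N s.-1; rewrite X0 lef0 add0r (lef_basis homega sY' pY') !eqxx [true && true]/=.
by move/eqP; rewrite (negbTE Y0).
Qed.

Lemma sum_basis (f : nat -> chart_family M -> chart_family M) r s B :
  (r + s <= n)%N -> primitive s B -> (forall t, (t <= n)%N -> f t 0 = 0) ->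
  \sum_(t < n.+1) \sum_(q < (n - t).+1)
     Lpow q (f t (lef omega (Lpow r B) q t)) = Lpow r (f s B).
Proof.
move=> rs pB f0; rewrite (lef_basis homega rs pB).
have sn : (s < n.+1)%N by lia.
have rn : (r < (n - s).+1)%N by lia.
rewrite (bigD1 (Ordinal sn)) //= [X in _ + X]big1 ?addr0 => [|s' s's].
  rewrite (bigD1 (Ordinal rn)) //= [X in _ + X]big1 ?addr0 ?eqxx // => r' r'r.
  rewrite -[r' == r :> nat]/(r' == Ordinal rn) (negbTE r'r) f0 ?Lpow0 //.
rewrite big1 // => r' _; rewrite -[s' == s :> nat]/(s' == Ordinal sn).
by rewrite (negbTE s's) andbF f0 ?Lpow0 // -ltnS.
Qed.

Lemma del_plus_basis r s B : (r + s <= n)%N -> primitive s B ->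
  del_plus omega (Lpow r B) = Lpow r (del_pair s B).1.
Proof.
move=> rs pB; apply: (sum_basis (f := fun t A => (del_pair t A).1)) => //.
by move=> t tn; rewrite del_pair0.
Qed.

Lemma del_minus_basis r s B : (r + s <= n)%N -> primitive s B ->
  del_minus omega (Lpow r B) = Lpow r (del_pair s B).2.
Proof.
move=> rs pB; apply: (sum_basis (f := fun t A => (del_pair t A).2)) => //.
by move=> t tn; rewrite del_pair0.
Qed.

Lemma del_plus0 : del_plus omega 0 = 0.
Proof.
have := del_plus_basis (leq0n n : (0 + 0 <= n)%N) (primitive0 omega 0).
by rewrite Lpow0 del_pair0.
Qed.

(** In degree n + p = 2r + s the bounds r <= p and r + s <= n force r = p. *)
Lemma top_filtered p x : (p <= n)%N -> fdeg (n + p)%N x -> fproj homega p x = x ->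
  exists2 b, primitive (n - p)%N (fval b) & x = fpow homega p b.
Proof.
move=> pn dx Px; exists (mkform (is_form_lef homega p (n - p) (form_is x))).
  exact/lef_primitive/form_is.
have sn : (n - p < n.+1)%N by lia.
have rn : (p < (n - (n - p)).+1)%N by lia.
apply: form_inj; rewrite -{1}Px -[LHS]/(lefschetz_op omega _ _ (fval x)) /lefschetz_op.
rewrite (bigD1 (Ordinal sn)) //= [X in _ + X]big1 ?addr0 => [|s' s's].
  rewrite (bigD1 (Ordinal rn)) //= [X in _ + X]big1 ?addr0 // => r' /andP[_ r'r].
  rewrite (lef_dform homega dx) ?Lpow0 //.
  by move: r'r; rewrite -val_eqE /=; lia.
rewrite big1 // => r' r'p; rewrite (lef_dform homega dx) ?Lpow0 //.
by move: s's r'p; rewrite -val_eqE /=; have := ltn_ord r'; have := ltn_ord s'; lia.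
Qed.

(** For b primitive of degree n - p one has d (L^p b) = L^(p+1) del_- b, because L^p kills del_+ b.
    So H d yields del_- b, and a second d yields del_+ del_- b + L del_- del_- b, whose last term is
    reflected out of the filtration. *)
Lemma del_plus_minus p x : (p <= n)%N -> fdeg (n + p)%N x ->
  fproj homega p x = x ->
  del_plus omega (del_minus omega (fval x)) =
  fval (fstar homega (kerP (fneg homega p.+1) (fpow homega p.+1)
    (fextd (fneg homega p.+1 (fextd x))))).
Proof.
move=> pn dx Px; have [b pb ->] := top_filtered pn dx Px.
have psn : (p + (n - p) <= n)%N by lia.
rewrite -[fval (fpow _ _ _)]/(Lpow p (fval b)) (del_minus_basis psn pb).
have [p1 p2 E] := del_pairP (leq_subr p n) pb.
set X := del_pair _ _ in p1 p2 E *.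
pose bp := mkform (is_form_prim p1); pose bm := mkform (is_form_prim p2).
have Eb : fextd b = bp + fpow homega 1 bm.
  by apply: form_inj; rewrite fvalD.
have Ebp : fpow homega p bp = 0.
  (* For p = 0 the form del_+ b would have degree n + 1, where [primitive] only contains 0. *)
  case: (posnP p) => [p0|p0].
    apply: form_inj; rewrite fval0 p0 -[LHS]/(X.1).
    by have := p1; rewrite p0 subn0 /Defs.primitive /= ifF //; lia.
  have p1' : primitive (n - p).+1 (fval bp).
    by rewrite (_ : Posz _ = (n - p)%N%:Z + 1) //; lia.
  by apply: (fpow_primitive0 homega _ p1'); lia.
have Ed : fextd (fpow homega p b) = fpow homega p.+1 bm.
  rewrite fextd_fpow Eb -[bp]scale1r fpow_linear Ebp scaler0 add0r fpow_add.
  by rewrite addn1.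
rewrite Ed kerP_star fstarK.
(* For p = n the form b has degree 0, and del_- b has degree -1. *)
case: (ltnP p n) => pn'; last first.
  have X20 : X.2 = 0.
    by have := p2; rewrite /Defs.primitive /= ifF //; lia.
  have -> : bm = 0 by apply: form_inj; rewrite fval0.
  rewrite X20 Lpow0 del_plus0 fpow0 fneg0 (linear0f (@fextd_linear _ _ _)).
  by rewrite fstar0 fproj0 fval0.
have p2' : primitive (n - p).-1 (fval bm).
  by rewrite (_ : Posz _ = (n - p)%N%:Z - 1) //; lia.
have sn1 : (p.+1 + (n - p).-1 <= n)%N by lia.
have sn2 : (p + (n - p).-1 <= n)%N by lia.
have -> : fneg homega p.+1 (fpow homega p.+1 bm) = bm.
  rewrite [LHS](fop_basis _ _ _ sn1 p2') leqnn subnn.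
  by apply: form_inj.
rewrite -[X.2]/(fval bm) (del_plus_basis sn2 p2').
have sn3 : ((n - p).-1 <= n)%N by lia.
have [q1 q2 F] := del_pairP sn3 p2'.
set Y := del_pair _ _ in q1 q2 F *.
pose cp := mkform (is_form_prim q1); pose cm := mkform (is_form_prim q2).
have -> : fextd bm = fpow homega 0 cp + fpow homega 1 cm.
  by apply: form_inj; rewrite fvalD.
have q1' : primitive (n - p)%N (fval cp).
  by rewrite (_ : Posz _ = (n - p).-1%:Z + 1) //; lia.
have sn4 : (0 + (n - p) <= n)%N by lia.
have sn5 : (n - 0 - (n - p) + (n - p) <= n)%N by lia.
rewrite -[fpow homega 0 cp]scale1r fstarP fprojP !scale1r.
rewrite (fstar_basis sn4 q1').
rewrite [fproj _ _ (fpow _ _ cp)](fop_basis _ _ _ sn5 q1').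
rewrite (_ : n - 0 - (n - p) = p)%N; last by lia.
rewrite leqnn fvalD -[fval (fpow homega p cp)]/(Lpow p Y.1).
rewrite (_ : fval (fproj _ _ _) = 0) ?addr0 //.
have [->|c0] := eqVneq cm 0.
  by rewrite fpow0 fstar0 fproj0 fval0.
have := primitive_bound q2; rewrite -[Y.2]/(fval cm) => qb.
have c0' : fval cm != 0 by apply: contra c0 => /eqP c0; apply/eqP/form_inj; rewrite fval0.
have := qb c0' => qb'.
have q2' : primitive (n - p - 2)%N (fval cm).
  by rewrite (_ : Posz _ = (n - p).-1%:Z - 1) //; lia.
have sn6 : (1 + (n - p - 2) <= n)%N by lia.
rewrite (fstar_basis sn6 q2').
(* The reflected exponent is p + 1, just outside the filtration. *)
have sn7 : (n - 1 - (n - p - 2) + (n - p - 2) <= n)%N by lia.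
rewrite [fproj _ _ _](fop_basis _ _ _ sn7 q2') ifF ?fval0 //.
lia.
Qed.

End DelPlusMinus.

(** * The operations of F_p in the cone model *)

Section Products.
Context {R : realType} {n : nat} {M : manifold R n.*2} (omega : chart_family M).
Hypothesis homega : symplectic omega.
Variable p : nat.
Hypothesis hp : (p <= n)%N.
Implicit Types (x y z : form M) (u v w : form M * form M) (D : int).
Local Notation P := (fproj homega p).
Local Notation star := (fstar homega).
Local Notation W := (fpow homega p.+1).
Local Notation H := (fneg homega p.+1).
Local Notation d := (@fextd R n.*2 M).
Local Notation "x ** y" := (fwedge x y) (at level 40, left associativity).
Local Notation K := (kerP H W).
Local Notation G := (cone_mixed (@fwedge R n.*2 M) d H).
Local Notation T := (cone_triple (@fwedge R n.*2 M) H).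
Local Notation M1 := (cone_m1 d H W).
Local Notation M2 := (cone_m2 (@fwedge R n.*2 M) d H W).
Local Notation M3 := (cone_m3 (@fwedge R n.*2 M) H W).
Local Notation good := (good homega p).
Local Notation emb := (emb homega p).

Definition par_of D : bool := odd `|D|%N.

Lemma par_ofE D : ((-1) ^ D : R) = (-1) ^+ nat_of_bool (par_of D).
Proof.
rewrite /par_of signr_odd; case: D => q; first by [].
by rewrite NegzE -invr_expz -exprnP abszN absz_nat; rewrite -signr_odd; case: odd;
  rewrite ?expr0 ?expr1 ?invrN1 ?invr1.
Qed.

Lemma par_of_fdeg D x : fdeg D x -> par (par_of D) x.
Proof. by move=> h; exists D => //; exact: par_ofE. Qed.

(** In each of the three terms H lowers the degree by 2p + 2 and d raises it by 1, which matches the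
    shift in [good]. *)
Lemma fdeg_G D D' x y : fdeg D x -> fdeg D' y ->
  fdeg (D + D' - (2 * p)%N%:Z - 1) (G (par_of D) x y).
Proof.
move=> hx hy; rewrite /cone_mixed; apply: fdegD; first apply: fdegD.
- apply: fdegN.
  rewrite (_ : _ - 1 = D + D' - (2 * p.+1)%N%:Z + 1); last by lia.
  by apply: fdeg_extd; apply: fdeg_neg; exact: fdeg_wedge.
- rewrite (_ : _ - 1 = D + 1 - (2 * p.+1)%N%:Z + D'); last by lia.
  by apply: fdeg_wedge => //; apply: fdeg_neg; exact: fdeg_extd.
- apply: fdegZ; rewrite (_ : _ - 1 = D + (D' + 1 - (2 * p.+1)%N%:Z)); last by lia.
  by apply: fdeg_wedge => //; apply: fdeg_neg; exact: fdeg_extd.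
Qed.

Lemma fdeg_T D D' D'' x y z : fdeg D x -> fdeg D' y -> fdeg D'' z ->
  fdeg (D + D' + D'' - (2 * p)%N%:Z - 2) (T x y z).
Proof.
move=> hx hy hz; rewrite /cone_triple; apply: fdegD; last apply: fdegN.
- rewrite (_ : _ - 2 = D + (D' + D'' - (2 * p.+1)%N%:Z)); last by lia.
  by apply: fdeg_wedge => //; apply: fdeg_neg; exact: fdeg_wedge.
- rewrite (_ : _ - 2 = D + D' - (2 * p.+1)%N%:Z + D''); last by lia.
  by apply: fdeg_wedge => //; apply: fdeg_neg; exact: fdeg_wedge.
Qed.

Lemma emb_unbarred D u : D <= (n + p)%N%:Z -> emb D u = fval u.1.
Proof. by rewrite /emb => ->. Qed.

Lemma emb_barred D u : (n + p)%N%:Z < D -> emb D u = fval (star u.2).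
Proof. by rewrite /emb leNgt => ->. Qed.

Lemma good_unbarred D u : D <= (n + p)%N%:Z ->
  good D u = [/\ fdeg D u.1, P u.1 = u.1 & u.2 = 0].
Proof. by rewrite /good => ->. Qed.

Lemma good_barred D u : (n + p)%N%:Z < D ->
  good D u = [/\ u.1 = 0, fdeg (D - (2 * p)%N%:Z - 1) u.2 & W u.2 = 0].
Proof. by rewrite /good leNgt => ->. Qed.

(** Below n + p the second component of M1 vanishes for degree reasons, from n + p on the first one
    does; at n + p itself [del_plus_minus] identifies the middle map. *)
Lemma m1_emb D u : good D u ->
  good (D + 1) (M1 u) /\ Fp_m1 omega p (D, emb D u) = emb (D + 1) (M1 u).
Proof.
case: u => x y; rewrite /M1 !cokP_proj.
have [hD|hD] := ltrP D (n + p)%N%:Z.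
  rewrite good_unbarred ?(ltW hD) // => -[/= dx Px ->].
  have hD1 : D + 1 <= (n + p)%N%:Z by lia.
  have dH : fdeg (D - (2 * p)%N%:Z) (d (H (d x))).
    rewrite (_ : _ - _ = D + 1 - (2 * p.+1)%N%:Z + 1); last by lia.
    by apply: fdeg_extd; apply: fdeg_neg; exact: fdeg_extd.
  split; last by rewrite !emb_unbarred ?(ltW hD) // /Fp_m1 hD.
  rewrite good_unbarred //; split=> /=.
  - by apply: fdeg_proj; exact: fdeg_extd.
  - exact: fproj_idem.
  - by rewrite fextd0 oppr0 add0r (kerP_small homega dH) ?oppr0 //; lia.
have [hD2|hD2] := eqVneq D (n + p)%N%:Z.
  rewrite hD2 good_unbarred // => -[/= dx Px ->].
  have hD1 : (n + p)%N%:Z < (n + p)%N%:Z + 1 by lia.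
  have dH : fdeg ((n + p)%N%:Z - (2 * p)%N%:Z) (d (H (d x))).
    rewrite (_ : _ - _ = (n + p)%N%:Z + 1 - (2 * p.+1)%N%:Z + 1); last by lia.
    by apply: fdeg_extd; apply: fdeg_neg; exact: fdeg_extd.
  rewrite fextd0 oppr0 add0r; split.
    rewrite good_barred //; split=> /=.
    - by apply: (fproj_large homega (fdeg_extd dx)); lia.
    - rewrite (_ : _ - 1 = (n + p)%N%:Z - (2 * p)%N%:Z); last by lia.
      by apply: fdegN; exact: fdeg_kerP.
    - by rewrite -scaleN1r -[_ *: _]addr0 fpow_linear fpow_kerP fpow0 scaler0 addr0.
  rewrite (emb_barred _ hD1) (emb_unbarred _ (lexx _)) /Fp_m1 ltxx eqxx.
  rewrite -[(_, _).1]/x -[(_, _).2]/(- K (d (H (d x)))).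
  rewrite (del_plus_minus hp dx Px).
  by rewrite -[- K _]scaleN1r -[_ *: K _]addr0 fstarP fstar0 addr0 scaleN1r fvalN.
have {hD hD2} hD : (n + p)%N%:Z < D by rewrite lt_neqAle eq_sym hD2.
rewrite good_barred // => -[/= -> dy Wy].
have hD1 : (n + p)%N%:Z < D + 1 by lia.
rewrite fextd0 fneg0 fextd0 kerP0 subr0 fproj0; split.
  rewrite good_barred //; split=> //=.
    rewrite (_ : _ - 1 = D - (2 * p)%N%:Z - 1 + 1); last by lia.
    by apply: fdegN; exact: fdeg_extd.
  rewrite -scaleN1r -[_ *: _]addr0 fpow_linear -fextd_fpow Wy.
  by rewrite fextd0 fpow0 scaler0 addr0.
have h1 : (D < (n + p)%N%:Z) = false by rewrite ltNge (ltW hD).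
have h2 : (D == (n + p)%N%:Z) = false by rewrite gt_eqF.
rewrite !emb_barred // /Fp_m1 h1 h2.
rewrite -[(0, y).2]/y -[(0, - d y).2]/(- d y) -[- d y]scaleN1r -[_ *: d y]addr0 fstarP fstar0.
rewrite addr0 scaleN1r fvalN; congr (- _).
(* Writing y as the reflection of [star y] turns d into [d_minus] conjugated by the reflection. *)
by rewrite -[y in RHS](fstarK homega).
Qed.

Lemma kerP_star_star x : star (K x) = P (star x).
Proof. by rewrite kerP_star fstarK. Qed.

Lemma star_form0 : Defs.star omega 0 = 0.
Proof.
have := congr1 fval (fstar0 homega); rewrite fval_star.
by rewrite (@fval0 _ _ M).
Qed.

(** Both cases of the product of unbarred forms come from one pair: if D + D' <= n + p its second
    component vanishes, otherwise its first. *)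
Lemma m2_emb D D' u v : good D u -> good D' v ->
  good (D + D') (M2 (par_of D) u v) /\
  Fp_m2 omega p (D, emb D u) (D', emb D' v) = emb (D + D') (M2 (par_of D) u v).
Proof.
case: u v => x y [x' y'].
have Z : good (D + D') (0, 0) /\ (0 : chart_family M) = emb (D + D') (0, 0).
  by split; [exact: good0 | rewrite emb0].
rewrite /M2 cokP_proj /= /Fp_m2 /unbarred.
have [hD|hD] := lerP D (n + p)%N%:Z; have [hD'|hD'] := lerP D' (n + p)%N%:Z.
- rewrite (good_unbarred _ hD) (good_unbarred _ hD') => -[/= dx Px ->] [/= dx' Px' ->].
  rewrite (emb_unbarred _ hD) (emb_unbarred _ hD') fwedge0l fwedge0r scaler0 !addr0 -[(_, _).1]/x.
  rewrite -[(_, _).1]/x'; have dG := fdeg_G dx dx'.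
  have [hDD|hDD] := lerP (D + D') (n + p)%N%:Z.
    rewrite (good_unbarred _ hDD) (emb_unbarred _ hDD); split=> //; split=> /=.
    + by apply: fdeg_proj; exact: fdeg_wedge.
    + exact: fproj_idem.
    + by apply: (kerP_small homega dG); lia.
  rewrite (good_barred _ hDD) (emb_barred _ hDD); split.
    split=> /=; last exact: fpow_kerP.
    + by apply: (fproj_large homega (fdeg_wedge dx dx')).
    + exact: fdeg_kerP.
  rewrite -[(_, _).2]/(K _) kerP_star_star par_ofE fval_proj fval_star.
  by rewrite /cone_mixed !fvalD fvalN fvalZ.
- rewrite (good_unbarred _ hD) (good_barred _ hD') => -[/= dx Px ->] [/= -> dy' Wy'].
  have -> : K (G (par_of D) x 0) = 0.
    rewrite /cone_mixed fwedge0r fneg0 fextd0 oppr0 add0r fwedge0r fneg0 fwedge0r.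
    by rewrite scaler0 addr0 kerP0.
  rewrite fwedge0r fproj0 fwedge0l addr0 add0r (emb_unbarred _ hD) (emb_barred _ hD').
  (* In negative degree the form is 0; otherwise the total degree stays above n + p. *)
  have [D0|D0] := ltrP D 0.
    have -> : x = 0 by apply: (fdeg_eq0 dx); rewrite D0.
    rewrite -[(_, _).1]/(0 : form M) fval0 wedge0l fwedge0l scaler0.
    by rewrite star_form0 ?scaler0.
  have hDD : (n + p)%N%:Z < D + D' by lia.
  rewrite (good_barred _ hDD) (emb_barred _ hDD); split.
    split=> //=.
    + rewrite (_ : _ - 1 = D + (D' - (2 * p)%N%:Z - 1)); last by lia.
      by apply: fdegZ; exact: fdeg_wedge.
    + rewrite -[_ *: _]addr0 fpow_linear -fpow_fwedger Wy' fwedge0r.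
      by rewrite fpow0 scaler0 addr0.
  rewrite -[(_, _).1]/x -[(0, y').2]/y' -[(_, _).2]/(_ *: (x ** y')).
  rewrite par_ofE -[_ *: (x ** y')]addr0 fstarP fstar0 addr0 fvalZ; congr (_ *: _).
  by rewrite -[y' in RHS](fstarK homega).
- rewrite (good_barred _ hD) (good_unbarred _ hD') => -[/= -> dy Wy] [/= dx' Px' ->].
  have -> : K (G (par_of D) 0 x') = 0.
    rewrite /cone_mixed fwedge0l fneg0 fextd0 oppr0 add0r fneg0 !fwedge0l.
    by rewrite scaler0 addr0 kerP0.
  rewrite fwedge0l fproj0 fwedge0l scaler0 !add0r (emb_unbarred _ hD') (emb_barred _ hD).
  have [D0|D0] := ltrP D' 0.
    have -> : x' = 0 by apply: (fdeg_eq0 dx'); rewrite D0.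
    rewrite -[(_, _).1]/(0 : form M) fval0 wedge0r fwedge0r.
    by rewrite star_form0.
  have hDD : (n + p)%N%:Z < D + D' by lia.
  rewrite (good_barred _ hDD) (emb_barred _ hDD); split.
    split=> //=.
    + rewrite (_ : _ - 1 = (D - (2 * p)%N%:Z - 1) + D'); last by lia.
      exact: fdeg_wedge.
    + by rewrite -fpow_fwedgel Wy fwedge0l.
  rewrite -[(x', _).1]/x' -[(0, y).2]/y -[(_, _).2]/(y ** x').
  by rewrite -[y in RHS](fstarK homega).
- rewrite (good_barred _ hD) (good_barred _ hD') => -[/= -> _ _] [/= -> _ _].
  have -> : K (G (par_of D) 0 0) = 0.
    rewrite /cone_mixed fwedge0l fneg0 fextd0 oppr0 add0r fneg0 !fwedge0l.
    by rewrite scaler0 addr0 kerP0.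
  by rewrite !fwedge0l fproj0 fwedge0r scaler0 !add0r.
Qed.

Lemma T0l y z : T 0 y z = 0.
Proof. by rewrite /cone_triple !fwedge0l fneg0 fwedge0l subrr. Qed.
Lemma T0m x z : T x 0 z = 0.
Proof. by rewrite /cone_triple fwedge0l fwedge0r fneg0 fwedge0l fwedge0r subrr. Qed.
Lemma T0r x y : T x y 0 = 0.
Proof. by rewrite /cone_triple !fwedge0r fneg0 fwedge0r subrr. Qed.

(** The second component has degree D + D' + D'' - 2p - 2, which reaches n - p exactly when D + D' +
    D'' >= n + p + 2: this is the origin of the bound in m_3. *)
Lemma m3_emb D D' D'' u v w : good D u -> good D' v -> good D'' w ->
  good (D + D' + D'' - 1) (M3 u v w) /\
  Fp_m3 omega p (D, emb D u) (D', emb D' v) (D'', emb D'' w) =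
  emb (D + D' + D'' - 1) (M3 u v w).
Proof.
case: u v w => x y [x' y'] [x'' y''].
have Z : good (D + D' + D'' - 1) (0, 0) /\
    (0 : chart_family M) = emb (D + D' + D'' - 1) (0, 0).
  by split; [exact: good0 | rewrite emb0].
rewrite /M3 /= /Fp_m3 /unbarred.
have [hD|hD] := lerP D (n + p)%N%:Z; last first.
  by rewrite (good_barred _ hD) => -[/= -> _ _] _ _; rewrite T0l kerP0.
have [hD'|hD'] := lerP D' (n + p)%N%:Z; last first.
  by rewrite (good_barred _ hD') // => _ [/= -> _ _] _; rewrite T0m kerP0.
have [hD''|hD''] := lerP D'' (n + p)%N%:Z; last first.
  by rewrite (good_barred _ hD'') // => _ _ [/= -> _ _]; rewrite T0r kerP0.
rewrite (good_unbarred _ hD) (good_unbarred _ hD') (good_unbarred _ hD'') => -[/= dx _ _] [/= dx' _ _] [/= dx'' _ _].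
rewrite (emb_unbarred _ hD) (emb_unbarred _ hD') (emb_unbarred _ hD'') /=.
have dT := fdeg_T dx dx' dx''.
have [hS|hS] := lerP (n + p + 2)%N%:Z (D + D' + D''); last first.
  by rewrite (kerP_small homega dT) //; lia.
have hS' : (n + p)%N%:Z < D + D' + D'' - 1 by lia.
rewrite (good_barred _ hS') (emb_barred _ hS'); split.
  split=> //=; last exact: fpow_kerP.
  apply: fdeg_kerP; rewrite (_ : _ - 1 = D + D' + D'' - (2 * p)%N%:Z - 2) //; lia.
rewrite -[(_, _).2]/(K _) kerP_star_star fval_proj fval_star.
by rewrite /cone_triple fvalD fvalN.
Qed.

End Products.

(** * The Stasheff relations *)

Section Tri.
Variables (V : zmodType) (F : nat -> nat -> V).
Let nat1 (f : nat -> V) : \sum_(1 <= s < 2) f s = f 1%N.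
Proof. exact: big_nat1. Qed.
Let nat2 (f : nat -> V) : \sum_(1 <= s < 3) f s = f 1%N + f 2%N.
Proof. by rewrite big_nat_recr //= nat1. Qed.
Let nat3 (f : nat -> V) : \sum_(1 <= s < 4) f s = f 1%N + f 2%N + f 3%N.
Proof. by rewrite big_nat_recr //= nat2. Qed.
Let nat4 (f : nat -> V) : \sum_(1 <= s < 5) f s = f 1%N + f 2%N + f 3%N + f 4%N.
Proof. by rewrite big_nat_recr //= nat3. Qed.
Let ord2 (f : nat -> V) : \sum_(r < 2) f r = f 0%N + f 1%N.
Proof. by rewrite big_ord_recr big_ord1. Qed.
Let ord3 (f : nat -> V) : \sum_(r < 3) f r = f 0%N + f 1%N + f 2%N.
Proof. by rewrite big_ord_recr /= ord2. Qed.
Let ord4 (f : nat -> V) : \sum_(r < 4) f r = f 0%N + f 1%N + f 2%N + f 3%N.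
Proof. by rewrite big_ord_recr /= ord3. Qed.

(** These unfold the triangular sum of [stasheff] for one to four inputs. *)
Lemma tri_sum1 : \sum_(r < 1) \sum_(1 <= s < (1 - r).+1) F r s = F 0%N 1%N.
Proof. by rewrite big_ord1; exact: nat1. Qed.
Lemma tri_sum2 : \sum_(r < 2) \sum_(1 <= s < (2 - r).+1) F r s =
  F 0%N 1%N + F 0%N 2%N + F 1%N 1%N.
Proof.
rewrite (ord2 (fun r => \sum_(1 <= s < (2 - r).+1) F r s)).
by congr (_ + _); [exact: nat2 | exact: nat1].
Qed.
Lemma tri_sum3 : \sum_(r < 3) \sum_(1 <= s < (3 - r).+1) F r s =
  F 0%N 1%N + F 0%N 2%N + F 0%N 3%N + (F 1%N 1%N + F 1%N 2%N) + F 2%N 1%N.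
Proof.
rewrite (ord3 (fun r => \sum_(1 <= s < (3 - r).+1) F r s)).
by congr (_ + _ + _); [exact: nat3 | exact: nat2 | exact: nat1].
Qed.
Lemma tri_sum4 : \sum_(r < 4) \sum_(1 <= s < (4 - r).+1) F r s =
  F 0%N 1%N + F 0%N 2%N + F 0%N 3%N + F 0%N 4%N + (F 1%N 1%N + F 1%N 2%N + F 1%N 3%N) + (F 2%N 1%N + F 2%N 2%N) + F 3%N 1%N.
Proof.
rewrite (ord4 (fun r => \sum_(1 <= s < (4 - r).+1) F r s)).
by congr (_ + _ + _ + _); [exact: nat4 | exact: nat3 | exact: nat2 | exact: nat1].
Qed.
End Tri.

Section Stasheff.
Context {R : fieldType} {V : lmodType R} (m : seq (int * V) -> V).
Implicit Types (xs : seq (int * V)) (x y z t : int * V).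

Definition stasheff_term xs r s : V :=
  ((-1) ^+ (r + s * (size xs - r - s)) : R) *:
    (((-1) ^ ((2 - s%:Z) * degree (take r xs)) : R) *: m (insert_m m r s xs)).

Lemma degree0 : degree (@nil (int * V)) = 0.
Proof. exact: big_nil. Qed.
Lemma degree_cons x xs : degree (x :: xs) = x.1 + degree xs.
Proof. exact: big_cons. Qed.

Let deg := (degree0, degree_cons, addr0, mulr0, expr0z).

Let signp k (v : V) : ~~ odd k -> ((-1) ^+ k : R) *: v = v.
Proof. by move=> /negbTE ok; rewrite -signr_odd ok expr0 scale1r. Qed.
Let signm k (v : V) : odd k -> ((-1) ^+ k : R) *: v = - v.
Proof. by move=> ok; rewrite -signr_odd ok expr1 scaleN1r. Qed.

Lemma stasheff_1 x : stasheff m [:: x] = (m [:: (x.1 + 1, m [:: x])] = 0).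
Proof.
congr (_ = 0); change (\sum_(r < 1) \sum_(1 <= s < (1 - r).+1)
    stasheff_term [:: x] r s = m [:: (x.1 + 1, m [:: x])]).
rewrite tri_sum1 /stasheff_term /insert_m /= !deg !signp // scale1r.
by rewrite (_ : x.1 + 2 - 1%:Z = x.1 + 1) //; ring.
Qed.

Lemma stasheff_2 x y : stasheff m [:: x; y] =
  (- m [:: (x.1 + 1, m [:: x]); y] + m [:: (x.1 + y.1, m [:: x; y])]
  - ((-1) ^ x.1 : R) *: m [:: x; (y.1 + 1, m [:: y])] = 0).
Proof.
congr (_ = 0); transitivity (\sum_(r < 2) \sum_(1 <= s < (2 - r).+1)
    stasheff_term [:: x; y] r s) => //.
rewrite tri_sum2 /stasheff_term /insert_m /= !deg.
congr (_ + _ + _).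
- rewrite signm // scale1r (_ : x.1 + 2 - 1%:Z = x.1 + 1) //; ring.
- rewrite signp // scale1r (_ : x.1 + y.1 + 2 - 2%:Z = x.1 + y.1) //; ring.
- rewrite signm // (_ : y.1 + 2 - 1%:Z = y.1 + 1); last by ring.
  by rewrite (_ : (2 - 1%:Z) * x.1 = x.1) //; ring.
Qed.

Lemma stasheff_3 x y z :
  stasheff m [:: x; y; z] =
  (m [:: (x.1 + 1, m [:: x]); y; z] + m [:: (x.1 + y.1, m [:: x; y]); z]
  + m [:: (x.1 + y.1 + z.1 - 1, m [:: x; y; z])]
  + (((-1) ^ x.1 : R) *: m [:: x; (y.1 + 1, m [:: y]); z]
     - m [:: x; (y.1 + z.1, m [:: y; z])])
  + ((-1) ^ (x.1 + y.1) : R) *: m [:: x; y; (z.1 + 1, m [:: z])] = 0).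
Proof.
congr (_ = 0); transitivity (\sum_(r < 3) \sum_(1 <= s < (3 - r).+1)
    stasheff_term [:: x; y; z] r s) => //.
rewrite tri_sum3 /stasheff_term /insert_m /= !deg.
congr (_ + _ + _ + (_ + _) + _).
- rewrite signp // scale1r (_ : x.1 + 2 - 1%:Z = x.1 + 1) //; ring.
- rewrite signp // scale1r (_ : x.1 + y.1 + 2 - 2%:Z = x.1 + y.1) //; ring.
- rewrite signp // scale1r (_ : _ + 2 - 3%:Z = x.1 + y.1 + z.1 - 1) //; ring.
- rewrite signp // (_ : y.1 + 2 - 1%:Z = y.1 + 1); last by ring.
  by rewrite (_ : (2 - 1%:Z) * x.1 = x.1) //; ring.
- rewrite signm // (_ : (2 - 2%:Z) * x.1 = 0); last by ring.
  by rewrite expr0z scale1r (_ : y.1 + z.1 + 2 - 2%:Z = y.1 + z.1) //; ring.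
- rewrite signp // (_ : z.1 + 2 - 1%:Z = z.1 + 1); last by ring.
  by rewrite (_ : (2 - 1%:Z) * (x.1 + y.1) = x.1 + y.1) //; ring.
Qed.

(** The terms through m_4 drop out by the assumptions on m, which leaves m_2 and m_3 composed with
    each other. *)
Lemma stasheff_4 x y z t : (forall xs, size xs = 4%N -> m xs = 0) ->
  m [:: (x.1 + y.1 + z.1 + t.1 - 2, 0)] = 0 ->
  m [:: (x.1 + y.1, m [:: x; y]); z; t]
  - m [:: (x.1 + y.1 + z.1 - 1, m [:: x; y; z]); t]
  + (- m [:: x; (y.1 + z.1, m [:: y; z]); t]
     - ((-1) ^ x.1 : R) *: m [:: x; (y.1 + z.1 + t.1 - 1, m [:: y; z; t])])
  + m [:: x; y; (z.1 + t.1, m [:: z; t])] = 0 ->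
  stasheff m [:: x; y; z; t].
Proof.
move=> m4 m0 E; change (\sum_(r < 4) \sum_(1 <= s < (4 - r).+1)
    stasheff_term [:: x; y; z; t] r s = 0).
rewrite tri_sum4 /stasheff_term /insert_m /= !deg.
rewrite (m4 [:: x; y; z; t]) //.
rewrite (_ : _ + 2 - 4%:Z = x.1 + y.1 + z.1 + t.1 - 2); last by ring.
rewrite m0 (m4 [:: _; y; z; t]) // (m4 [:: x; _; z; t]) // (m4 [:: x; y; _; t]) //.
rewrite (m4 [:: x; y; z; _]) // !scaler0 !addr0 !add0r -[RHS]E.
congr (_ + _ + (_ + _) + _).
- rewrite signp // scale1r (_ : x.1 + y.1 + 2 - 2%:Z = x.1 + y.1) //; ring.
- rewrite signm // scale1r (_ : _ + 2 - 3%:Z = x.1 + y.1 + z.1 - 1) //; ring.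
- rewrite signm // (_ : (2 - 2%:Z) * x.1 = 0); last by ring.
  by rewrite expr0z scale1r (_ : y.1 + z.1 + 2 - 2%:Z = y.1 + z.1) //; ring.
- rewrite signm // (_ : _ + 2 - 3%:Z = y.1 + z.1 + t.1 - 1); last by ring.
  (* m_3 has degree -1, so the Koszul exponent is - x.1; inverting a sign does not change it. *)
  rewrite (_ : (2 - 3%:Z) * x.1 = - x.1); last by ring.
  rewrite -invr_expz; case: x.1 => k; rewrite ?NegzE -?invr_expz -!exprnP -signr_odd;
    by case: odd; rewrite ?expr0 ?expr1 ?invrN1 ?invr1.
- rewrite signp // (_ : (2 - 2%:Z) * _ = 0); last by ring.
  by rewrite expr0z scale1r (_ : z.1 + t.1 + 2 - 2%:Z = z.1 + t.1) //; ring.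
Qed.

End Stasheff.

(** Passes from the relation in the cone model to the order of terms in [stasheff_2]; the next two
    lemmas serve three and four inputs. *)
Lemma stasheff2_rearrange (V : zmodType) (a b c : V) :
  a = b + c -> - b + a - c = 0.
Proof. by move=> ->; ZmodTac.zmod. Qed.

Lemma stasheff3_rearrange (V : zmodType) (a b c e f g : V) :
  a + b + c + e + f - g = 0 -> b + f + a + (c - g) + e = 0.
Proof. by move=> E; rewrite -[RHS]E; ZmodTac.zmod. Qed.

Lemma stasheff4_rearrange (V : zmodType) (a b c e f : V) :
  - a - b + c - e + f = 0 -> c - a + (- e - b) + f = 0.
Proof. by move=> E; rewrite -[RHS]E; ZmodTac.zmod. Qed.

(** * The A-infinity structure on F_p *)

Section FilteredAinfinity.
Context {R : realType} {n : nat} {M : manifold R n.*2} (omega : chart_family M).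
Hypothesis homega : symplectic omega.
Variable p : nat.
Hypothesis hp : (p <= n)%N.
Implicit Types (x y z : form M) (u v w : form M * form M) (D : int).
Local Notation P := (fproj homega p).
Local Notation W := (fpow homega p.+1).
Local Notation H := (fneg homega p.+1).
Local Notation d := (@fextd R n.*2 M).
Local Notation M1 := (cone_m1 d H W).
Local Notation M2 := (cone_m2 (@fwedge R n.*2 M) d H W).
Local Notation M3 := (cone_m3 (@fwedge R n.*2 M) H W).
Local Notation good := (good homega p).
Local Notation emb := (emb homega p).
Local Notation Fp := (Fp omega p).
Local Notation m := (Fp_m omega p).

Lemma par_ofD D D' : par_of (D + D') = par_of D (+) par_of D'.
Proof.
apply: (@signr_inj R).
by rewrite -par_ofE exprzDr ?unitrN1 // !par_ofE signr_addb.
Qed.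

Lemma par_ofN D : par_of (- D) = par_of D.
Proof. by rewrite /par_of abszN. Qed.

(** The target degree is a variable with an equation, so that different integer expressions of one
    degree can be matched by [ring]. *)
Lemma Fp_m1E D D' u : good D u -> D' = D + 1 ->
  good D' (M1 u) /\ m [:: (D, emb D u)] = emb D' (M1 u).
Proof. by move=> gu ->; exact: m1_emb. Qed.

Lemma Fp_m2E D D' D'' u v : good D u -> good D' v -> D'' = D + D' ->
  good D'' (M2 (par_of D) u v) /\
  m [:: (D, emb D u); (D', emb D' v)] = emb D'' (M2 (par_of D) u v).
Proof. by move=> gu gv ->; exact: m2_emb. Qed.

Lemma Fp_m3E D D' D'' D3 u v w : good D u -> good D' v -> good D'' w ->
  D3 = D + D' + D'' - 1 ->
  good D3 (M3 u v w) /\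
  m [:: (D, emb D u); (D', emb D' v); (D'', emb D'' w)] = emb D3 (M3 u v w).
Proof. by move=> gu gv gw ->; exact: m3_emb. Qed.

(** In a barred degree D the second component is a form of degree D - 2p - 1, of opposite parity. *)
Lemma good_parity D u : good D u ->
  cone_homog W (@par R n M) (par_of D) u.
Proof.
have par0 a : @par R n M a 0.
  by exists (nat_of_bool a)%:Z; [exact: fdeg0 | rewrite -exprnP].
case: (lerP D (n + p)%N%:Z) => hD.
  rewrite good_unbarred // => -[u1 _ u2]; split.
  - exact: par_of_fdeg.
  - by rewrite u2.
  - by rewrite u2 fpow0.
rewrite good_barred // => -[u1 u2 u3]; split=> //; first by rewrite u1.
have := par_of_fdeg u2; congr par.
rewrite -addrA -opprD par_ofD par_ofN.
have -> : par_of ((2 * p)%N%:Z + 1) = true by rewrite /par_of -PoszD absz_nat; lia.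
by rewrite addbT.
Qed.

Let fwDl x y z : fwedge (x + y) z = fwedge x z + fwedge y z.
Proof. by rewrite -[x]scale1r fwedgePl !scale1r. Qed.
Let fwDr x y z : fwedge x (y + z) = fwedge x y + fwedge x z.
Proof. by rewrite -[y]scale1r fwedgePr !scale1r. Qed.
Let fwZl (k : R) x y : fwedge (k *: x) y = k *: fwedge x y.
Proof. by rewrite -[k *: x]addr0 fwedgePl fwedge0l addr0. Qed.
Let fwZr (k : R) x y : fwedge x (k *: y) = k *: fwedge x y.
Proof. by rewrite -[k *: y]addr0 fwedgePr fwedge0r addr0. Qed.
Let dlin := @fextd_linear R n.*2 M.
Let Hlin : linear H := @fop_linear R n M omega homega _ _.
Let Wlin : linear W := @fpow_linear R n M omega homega _.

Lemma filtered_stasheff1 u : W u.2 = 0 -> M1 (M1 u) = 0.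
Proof.
apply: (cone_stasheff1 dlin Hlin Wlin).
- exact: fextd_fextd.
- exact: fextd_fpow.
- exact: fpow_neg_pow.
Qed.

Lemma filtered_stasheff2 D D' u v : good D u -> good D' v ->
  M1 (M2 (par_of D) u v) = M2 (par_of (D + 1)) (M1 u) v +
    ((-1) ^ D : R) *: M2 (par_of D) u (M1 v).
Proof.
move=> /good_parity gu /good_parity[_ _ Wv].
rewrite par_ofD addbT par_ofE.
apply: (cone_stasheff2 fwDl fwDr fwZl fwZr dlin Hlin Wlin (@fwedgeA _ _ _)
  (@fextd_fextd _ _ _) (fextd_fpow homega _) (fpow_fwedgel homega _)
  (fpow_fwedger homega _) (@fpow_neg_pow _ _ _ _ homega p)
  (@fneg_pow_neg _ _ _ _ homega p) (par := @par R n M)) => //.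
- by move=> a x y; exact: par_leib.
- by move=> a x; exact: par_fextd.
- by move=> a x; exact: par_fneg.
Qed.

Lemma filtered_stasheff3 D D' D'' u v w : good D u -> good D' v -> good D'' w ->
  M1 (M3 u v w) + M3 (M1 u) v w + ((-1) ^ D : R) *: M3 u (M1 v) w
  + ((-1) ^ (D + D') : R) *: M3 u v (M1 w)
  + M2 (par_of (D + D')) (M2 (par_of D) u v) w
  - M2 (par_of D) u (M2 (par_of D') v w) = 0.
Proof.
move=> /good_parity gu /good_parity gv /good_parity[_ _ Ww].
rewrite exprzDr ?unitrN1 // par_ofD !par_ofE.
apply: (cone_stasheff3 fwDl fwDr fwZl fwZr dlin Hlin Wlin (@fwedgeA _ _ _)
  (@fextd_fextd _ _ _) (fextd_fpow homega _) (fpow_fwedgel homega _)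
  (fpow_fwedger homega _) (@fpow_neg_pow _ _ _ _ homega p)
  (@fneg_pow_neg _ _ _ _ homega p) (par := @par R n M)) => //.
- by move=> a x y; exact: par_leib.
- by move=> a x; exact: par_fneg.
- by move=> a b x y; exact: par_wedge.
Qed.

Lemma filtered_stasheff4 a b c u v w t :
  - M2 c (M3 u v w) t - ((-1) ^+ nat_of_bool a : R) *: M2 a u (M3 v w t)
  + M3 (M2 a u v) w t - M3 u (M2 b v w) t + M3 u v (M2 c w t) = 0.
Proof.
apply: (cone_stasheff4 fwDl fwDr fwZl fwZr dlin Hlin Wlin (@fwedgeA _ _ _)
  (@fextd_fextd _ _ _) (fextd_fpow homega _) (fpow_fwedgel homega _)
  (fpow_fwedger homega _) (@fpow_neg_pow _ _ _ _ homega p)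
  (@fneg_pow_neg _ _ _ _ homega p)).
Qed.

(** For the relation with four inputs, where the parity attached to an output of M3 has to be
    exchanged for another one. *)
Lemma cone_m2_sign a b u v : u.1 = 0 -> M2 a u v = M2 b u v.
Proof.
by move=> u0; rewrite /cone_m2 /cone_mixed u0 !fwedge0l !scaler0.
Qed.

Let M1P := cone_m1_linear dlin Hlin Wlin.
Let M2Pl := cone_m2_linear_l (@fwedgePl _ _ _) dlin Hlin Wlin.
Let M2Pr := cone_m2_linear_r (@fwedgePr _ _ _) dlin Hlin Wlin.
Let M3P := cone_m3_linear (@fwedgePl _ _ _) (@fwedgePr _ _ _) Hlin Wlin.

Lemma homogeneous_cons (A : int * chart_family M) xs :
  homogeneous Fp (A :: xs) <-> Fp A.1 A.2 /\ homogeneous Fp xs.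
Proof.
split=> [h|[hA h] B]; first by split=> [|B hB]; apply: h; rewrite inE ?eqxx ?hB ?orbT.
by rewrite inE => /orP[/eqP ->|/h].
Qed.

Lemma homogeneous_emb D A xs : homogeneous Fp ((D, A) :: xs) ->
  (exists2 u, good D u & A = emb D u) /\ homogeneous Fp xs.
Proof. by move=> /homogeneous_cons[/(Fp_good homega)]. Qed.

Let embD D u v : emb D (u + v) = emb D u + emb D v.
Proof. by rewrite -[u]scale1r embP !scale1r. Qed.
Let embZ D (k : R) u : emb D (k *: u) = k *: emb D u.
Proof. by rewrite -[_ *: u]addr0 embP emb0 addr0. Qed.
Let embN D u : emb D (- u) = - emb D u.
Proof. by rewrite -scaleN1r embZ scaleN1r. Qed.

Lemma Fp_subspaces : subspaces Fp.
Proof.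
move=> j; split; first by rewrite -(emb0 homega p j); apply: good_Fp; exact: good0.
move=> c A B /(Fp_good homega)[u gu ->] /(Fp_good homega)[v gv ->].
by rewrite -embP; apply: good_Fp; exact: goodP.
Qed.

Lemma Fp_m_large xs : (3 < size xs)%N -> m xs = 0.
Proof. by case: xs => [|x [|y [|z [|t xs]]]]. Qed.

Lemma Fp_m_degree xs : (0 < size xs)%N -> homogeneous Fp xs ->
  Fp (degree xs + 2 - (size xs)%:Z) (m xs).
Proof.
case: xs => [|[D A] [|[D' A'] [|[D'' A''] [|t xs]]]] // _.
- move=> /homogeneous_emb[[u gu ->] _].
  rewrite degree_cons degree0 addr0.
  have [|g E] := Fp_m1E (D' := D + 2 - 1%:Z) gu; first by ring.
  by have := good_Fp g; rewrite -E.
- move=> /homogeneous_emb[[u gu ->]].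
  move=> /homogeneous_emb[[v gv ->] _].
  rewrite !degree_cons degree0 addr0.
  have [|g E] := Fp_m2E (D'' := D + D' + 2 - 2%:Z) gu gv; first by ring.
  by have := good_Fp g; rewrite -E.
- move=> /homogeneous_emb[[u gu ->]].
  move=> /homogeneous_emb[[v gv ->]].
  move=> /homogeneous_emb[[w gw ->] _].
  rewrite !degree_cons degree0 addr0.
  have [|g E] := Fp_m3E (D3 := D + (D' + D'') + 2 - 3%:Z) gu gv gw; first by ring.
  by have := good_Fp g; rewrite -E.
- by move=> _; case: (Fp_subspaces (degree [:: (D, A), (D', A'), (D'', A''), t & xs] + 2 - (size xs).+4%:Z)).
Qed.

Lemma Fp_multilinear : multilinear Fp m.
Proof.
move=> xs ys j c A B hxs hys /(Fp_good homega)[u gu ->] /(Fp_good homega)[v gv ->].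
rewrite -embP; have guv := goodP c gu gv.
case: xs hxs => [|[D X] [|[D' X'] [|x3 xs]]] hxs.
- case: ys hys => [|[E Y] [|[E' Y'] [|y3 ys]]] hys; rewrite ?cat_cons ?cat0s.
  + have [_ ->] := Fp_m1E guv erefl; have [_ ->] := Fp_m1E gu erefl.
    by have [_ ->] := Fp_m1E gv erefl; rewrite M1P embP.
  + move/homogeneous_emb: hys => [[w gw ->] _].
    have [_ ->] := Fp_m2E guv gw erefl; have [_ ->] := Fp_m2E gu gw erefl.
    by have [_ ->] := Fp_m2E gv gw erefl; rewrite M2Pl embP.
  + move/homogeneous_emb: hys => [[w gw ->]].
    move=> /homogeneous_emb[[t gt ->] _].
    have [_ ->] := Fp_m3E guv gw gt erefl; have [_ ->] := Fp_m3E gu gw gt erefl.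
    by have [_ ->] := Fp_m3E gv gw gt erefl; have [-> _ _] := M3P c u v w t; rewrite embP.
  + by rewrite scaler0 addr0.
- move/homogeneous_emb: hxs => [[w gw ->] _].
  case: ys hys => [|[E Y] [|y3 ys]] hys; rewrite ?cat_cons ?cat0s.
  + have [_ ->] := Fp_m2E gw guv erefl; have [_ ->] := Fp_m2E gw gu erefl.
    by have [_ ->] := Fp_m2E gw gv erefl; rewrite M2Pr embP.
  + move/homogeneous_emb: hys => [[t gt ->] _].
    have [_ ->] := Fp_m3E gw guv gt erefl; have [_ ->] := Fp_m3E gw gu gt erefl.
    by have [_ ->] := Fp_m3E gw gv gt erefl; have [_ -> _] := M3P c u v w t; rewrite embP.
  + by rewrite scaler0 addr0.
- move/homogeneous_emb: hxs => [[w gw ->]].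
  move=> /homogeneous_emb[[t gt ->] _].
  case: ys hys => [|y3 ys] hys; rewrite ?cat_cons ?cat0s.
  + have [_ ->] := Fp_m3E gw gt guv erefl; have [_ ->] := Fp_m3E gw gt gu erefl.
    by have [_ ->] := Fp_m3E gw gt gv erefl; have [_ _ ->] := M3P c u v w t; rewrite embP.
  + by rewrite scaler0 addr0.
- by rewrite !Fp_m_large ?scaler0 ?addr0 // !size_cat /= addnS.
Qed.

Lemma Fp_m_zero xs ys D : homogeneous Fp xs -> homogeneous Fp ys ->
  m (xs ++ (D, 0) :: ys) = 0.
Proof.
move=> hxs hys; have [g0 _] := Fp_subspaces D.
have := Fp_multilinear (-1) hxs hys g0 g0.
by rewrite !scaleN1r oppr0 addr0 addNr.
Qed.

Lemma homogeneous_take k xs : homogeneous Fp xs -> homogeneous Fp (take k xs).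
Proof. by move=> h x /mem_take/h. Qed.
Lemma homogeneous_drop k xs : homogeneous Fp xs -> homogeneous Fp (drop k xs).
Proof. by move=> h x /mem_drop/h. Qed.

(** M3 has zero first component and reads only first components. For five inputs these are the only
    compositions in which both arities are at most three. *)
Lemma Fp_m3m3 xs : size xs = 5%N -> homogeneous Fp xs ->
  forall r, (r < 3)%N -> m (insert_m m r 3 xs) = 0.
Proof.
case: xs => [|[D1 A1] [|[D2 A2] [|[D3 A3] [|[D4 A4] [|[D5 A5] [|//]]]]]] // _.
move=> /homogeneous_emb[[u1 g1 ->]].
move=> /homogeneous_emb[[u2 g2 ->]].
move=> /homogeneous_emb[[u3 g3 ->]].
move=> /homogeneous_emb[[u4 g4 ->]].
move=> /homogeneous_emb[[u5 g5 ->] _].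
have k1 u v w : u.1 = 0 -> M3 u v w = 0.
  by move=> u0; rewrite /cone_m3 u0 T0l kerP0.
have k2 u v w : v.1 = 0 -> M3 u v w = 0.
  by move=> u0; rewrite /cone_m3 u0 T0m kerP0.
have k3 u v w : w.1 = 0 -> M3 u v w = 0.
  by move=> u0; rewrite /cone_m3 u0 T0r kerP0.
case=> [|[|[|//]]] _; rewrite /insert_m.
- rewrite -[take 3 _]/[:: (D1, emb D1 u1); (D2, emb D2 u2); (D3, emb D3 u3)].
  rewrite !degree_cons degree0 addr0.
  have [|g ->] := Fp_m3E (D3 := D1 + (D2 + D3) + 2 - 3%:Z) g1 g2 g3; first by ring.
  by have [_ ->] := Fp_m3E g g4 g5 erefl; rewrite k1 // emb0.
- rewrite -[take 3 _]/[:: (D2, emb D2 u2); (D3, emb D3 u3); (D4, emb D4 u4)].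
  rewrite !degree_cons degree0 addr0.
  have [|g ->] := Fp_m3E (D3 := D2 + (D3 + D4) + 2 - 3%:Z) g2 g3 g4; first by ring.
  by have [_ ->] := Fp_m3E g1 g g5 erefl; rewrite k2 // emb0.
- rewrite -[take 3 _]/[:: (D3, emb D3 u3); (D4, emb D4 u4); (D5, emb D5 u5)].
  rewrite !degree_cons degree0 addr0.
  have [|g ->] := Fp_m3E (D3 := D3 + (D4 + D5) + 2 - 3%:Z) g3 g4 g5; first by ring.
  by have [_ ->] := Fp_m3E g1 g2 g erefl; rewrite k3 // emb0.
Qed.

Lemma Fp_stasheff xs : (0 < size xs)%N -> homogeneous Fp xs -> stasheff m xs.
Proof.
case: xs => [|[D1 A1] [|[D2 A2] [|[D3 A3] [|[D4 A4] [|x5 xs]]]]] // _.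
- move=> /homogeneous_emb[[u1 g1 ->] _].
  rewrite stasheff_1; have [g2 ->] := Fp_m1E g1 erefl.
  have [_ ->] := Fp_m1E g2 erefl; rewrite filtered_stasheff1 ?emb0 //.
  by have [] := good_parity g1.
- move=> /homogeneous_emb[[u1 g1 ->]].
  move=> /homogeneous_emb[[u2 g2 ->] _].
  rewrite stasheff_2.
  have [h1 ->] := Fp_m1E g1 erefl; have [h2 ->] := Fp_m1E g2 erefl.
  have [h3 ->] := Fp_m2E g1 g2 erefl.
  have [|_ ->] := Fp_m2E (D'' := D1 + D2 + 1) h1 g2; first by ring.
  have [|_ ->] := Fp_m2E (D'' := D1 + D2 + 1) g1 h2; first by ring.
  have [_ ->] := Fp_m1E h3 erefl.
  have := congr1 (emb (D1 + D2 + 1)) (filtered_stasheff2 g1 g2).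
  by rewrite embD embZ; exact: stasheff2_rearrange.
- move=> /homogeneous_emb[[u1 g1 ->]].
  move=> /homogeneous_emb[[u2 g2 ->]].
  move=> /homogeneous_emb[[u3 g3 ->] _].
  rewrite stasheff_3.
  have [h1 ->] := Fp_m1E g1 erefl; have [h2 ->] := Fp_m1E g2 erefl.
  have [h3 ->] := Fp_m1E g3 erefl.
  have [h12 ->] := Fp_m2E g1 g2 erefl; have [h23 ->] := Fp_m2E g2 g3 erefl.
  have [h123 ->] := Fp_m3E g1 g2 g3 erefl.
  have [|_ ->] := Fp_m3E (D3 := D1 + D2 + D3) h1 g2 g3; first by ring.
  have [|_ ->] := Fp_m3E (D3 := D1 + D2 + D3) g1 h2 g3; first by ring.
  have [|_ ->] := Fp_m3E (D3 := D1 + D2 + D3) g1 g2 h3; first by ring.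
  have [_ ->] := Fp_m2E h12 g3 erefl.
  have [|_ ->] := Fp_m2E (D'' := D1 + D2 + D3) g1 h23; first by ring.
  have [|_ ->] := Fp_m1E (D' := D1 + D2 + D3) h123; first by ring.
  have := congr1 (emb (D1 + D2 + D3)) (filtered_stasheff3 g1 g2 g3).
  rewrite emb0 !(embD, embN, embZ); exact: stasheff3_rearrange.
- move=> /homogeneous_emb[[u1 g1 ->]].
  move=> /homogeneous_emb[[u2 g2 ->]].
  move=> /homogeneous_emb[[u3 g3 ->]].
  move=> /homogeneous_emb[[u4 g4 ->] _].
  apply: stasheff_4; [by move=> xs xs4; apply: Fp_m_large; rewrite xs4 | |].
    exact: (@Fp_m_zero [::] [::]).
  have [h12 ->] := Fp_m2E g1 g2 erefl; have [h23 ->] := Fp_m2E g2 g3 erefl.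
  have [h34 ->] := Fp_m2E g3 g4 erefl.
  have [h123 ->] := Fp_m3E g1 g2 g3 erefl.
  have [h234 ->] := Fp_m3E g2 g3 g4 erefl.
  pose S := D1 + D2 + D3 + D4 - 1.
  have [|_ ->] := Fp_m3E (D3 := S) h12 g3 g4; first by rewrite /S; ring.
  have [|_ ->] := Fp_m3E (D3 := S) g1 h23 g4; first by rewrite /S; ring.
  have [|_ ->] := Fp_m3E (D3 := S) g1 g2 h34; first by rewrite /S; ring.
  have [|_ ->] := Fp_m2E (D'' := S) h123 g4; first by rewrite /S; ring.
  have [|_ ->] := Fp_m2E (D'' := S) g1 h234; first by rewrite /S; ring.
  (* The output of M3 has the parity of D1 + D2 + D3 - 1, while the abstract relation uses one
     parity, here that of D3, in its first and last terms. *)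
  rewrite (cone_m2_sign _ (par_of D3) (u := M3 _ _ _)) // par_ofE.
  have := congr1 (emb S) (filtered_stasheff4 (par_of D1) (par_of D2) (par_of D3)
    u1 u2 u3 u4).
  rewrite emb0 !(embD, embN, embZ); exact: stasheff4_rearrange.
(* With at least five inputs the inner or the outer operation has arity above three, except for m_3
   inside m_3. *)
set ys := [:: (D1, A1), (D2, A2), (D3, A3), (D4, A4), x5 & xs] => hys.
have sys : (4 < size ys)%N by [].
clearbody ys.
rewrite /stasheff big1 // => r _; rewrite big_nat_cond big1 // => s.
rewrite andbT => /andP[s1 s2].
rewrite (_ : m (insert_m m r s ys) = 0) ?scaler0 //.
have sr := ltn_ord r.
have sd : size (take s (drop r ys)) = s by rewrite size_take size_drop; case: ltnP; lia.
case: (ltnP 3 s) => s3.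
  rewrite /insert_m [m (take _ _)]Fp_m_large; last by rewrite sd.
  by apply: Fp_m_zero; [exact: homogeneous_take | exact: homogeneous_drop].
have [E5|N5] := boolP ((size ys == 5%N) && (s == 3%N)).
  case/andP: E5 => /eqP E5 /eqP s3'; rewrite s3'.
  by apply: Fp_m3m3 => //; lia.
apply: Fp_m_large; rewrite /insert_m size_cat /= size_take size_drop sr.
have aux (a b c : nat) : (4 < a -> c < (a - b).+1 -> b < a -> c <= 3 ->
    a <> 5 \/ c <> 3 -> 3 < b + (a - (b + c)).+1)%N by lia.
by apply: aux => //; move: N5; rewrite negb_and => /orP[] /eqP; [left | right].
Qed.

Lemma Fp_Ainfty : Ainfty_algebra Fp m.
Proof.
split; [exact: Fp_subspaces | exact: Fp_m_degree | exact: Fp_multilinear |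
  exact: Fp_stasheff].
Qed.

End FilteredAinfinity.

(** * The cohomology ring *)

Section QuotientRing.
Variable T : zmodType.
Variables (Z B : set T) (mul : T -> T -> T) (one : T).
Hypotheses (Z0 : Z 0) (ZB : forall x y, Z x -> Z y -> Z (x - y)).
Hypotheses (B0 : B 0) (BB : forall x y, B x -> B y -> B (x - y)).
Hypotheses (BZ : B `<=` Z) (Z1 : Z one).
Hypotheses (ZM : forall x y, Z x -> Z y -> Z (mul x y))
  (BMl : forall x y, B x -> Z y -> B (mul x y))
  (BMr : forall x y, Z x -> B y -> B (mul x y))
  (mulBl : forall x y z, Z x -> Z y -> Z z -> mul (x - y) z = mul x z - mul y z)
  (mulBr : forall x y z, Z x -> Z y -> Z z -> mul x (y - z) = mul x y - mul x z)
  (mulA : forall x y z, Z x -> Z y -> Z z -> B (mul x (mul y z) - mul (mul x y) z))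
  (mul1 : forall x, Z x -> B (mul one x - x))
  (mulr1 : forall x, Z x -> B (mul x one - x)).

Let ZN x : Z x -> Z (- x). Proof. by move=> zx; rewrite -sub0r; exact: ZB. Qed.
Let ZD x y : Z x -> Z y -> Z (x + y).
Proof. by move=> zx /ZN; rewrite -{2}[y]opprK; exact: ZB. Qed.
Let BN x : B x -> B (- x). Proof. by move=> zx; rewrite -sub0r; exact: BB. Qed.
Let BD x y : B x -> B y -> B (x + y).
Proof. by move=> zx /BN; rewrite -{2}[y]opprK; exact: BB. Qed.

(** A chosen representative of the coset of x modulo B; elements outside Z get the representative of
    0, which makes the function total. *)
Let rep (x : T) : T :=
  xget 0 [set y | Z y /\ B (y - (if `[< Z x >] then x else 0))].
Let repP x : Z (rep x) /\ B (rep x - (if `[< Z x >] then x else 0)).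
Proof.
rewrite /rep; case: xgetP => // /(_ (if `[< Z x >] then x else 0)) h.
by exfalso; apply: h => /=; rewrite subrr; split=> //; case: asboolP.
Qed.
Let Zrep x : Z (rep x). Proof. by case: (repP x). Qed.
Let Brep x : Z x -> B (rep x - x).
Proof. by move=> zx; have [_] := repP x; rewrite asboolT. Qed.
Let rep_eq x y : Z x -> Z y -> B (x - y) -> rep x = rep y.
Proof.
(* The two cosets are the same set, so the choice returns the same element. *)
move=> zx zy b; rewrite /rep !asboolT //; congr xget.
apply/seteqP; split=> t /= [zt h]; split=> //.
- by rewrite (_ : t - y = (t - x) + (x - y)); [exact: BD | rewrite addrA subrK].
- by rewrite (_ : t - x = (t - y) - (x - y)); [exact: BB | rewrite opprB addrA subrK].
Qed.
Let rep_id x : rep (rep x) = rep x.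
Proof.
have [zx|nzx] := pselect (Z x); first exact: rep_eq (Brep zx).
have e : rep x = rep 0 by rewrite {1}/rep asboolF // /rep asboolT.
by rewrite e; exact: rep_eq (Brep Z0).
Qed.

(** The quotient is realised as the subtype of chosen representatives. *)
Let can_rep (x : T) : bool := `[< Z x /\ rep x = x >].
Local Notation Q := {x : T | can_rep x}.
Let cl (x : T) : Q := exist can_rep (rep x) (asboolT (conj (Zrep x) (rep_id x))).
Let Zval (h : Q) : Z (val h).
Proof. by have /asboolP[] := valP h. Qed.
Let clK (h : Q) : cl (val h) = h.
Proof. by apply: val_inj; have /asboolP[] := valP h. Qed.
Let cl_eq x y : Z x -> Z y -> cl x = cl y <-> B (x - y).
Proof.
move=> zx zy; split=> [/(congr1 val)/= e|b]; last exact/val_inj/rep_eq.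
rewrite (_ : x - y = (rep y - y) - (rep x - x)); first exact: BB (Brep zy) (Brep zx).
by rewrite e opprB [RHS]addrC addrA subrK.
Qed.
Let cl_rep x : Z x -> B (val (cl x) - x). Proof. exact: Brep. Qed.

Let add (h k : Q) : Q := cl (val h + val k).
Let opp (h : Q) : Q := cl (- val h).
Let qmul (h k : Q) : Q := cl (mul (val h) (val k)).
Let clD x y : Z x -> Z y -> add (cl x) (cl y) = cl (x + y).
Proof.
move=> zx zy; apply/cl_eq; [exact: ZD (Zval _) (Zval _) | exact: ZD |].
by rewrite opprD addrACA; apply: BD; exact: cl_rep.
Qed.
Let clN x : Z x -> opp (cl x) = cl (- x).
Proof.
move=> zx; apply/cl_eq; [exact: ZN (Zval _) | exact: ZN |].
by rewrite -opprD; apply: BN; exact: cl_rep.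
Qed.
Let clM x y : Z x -> Z y -> qmul (cl x) (cl y) = cl (mul x y).
Proof.
move=> zx zy; apply/cl_eq; [exact: ZM (Zval _) (Zval _) | exact: ZM |].
set x' := val _; set y' := val _.
have [zx' zy'] : Z x' /\ Z y' by split; exact: Zval.
(* Change the representative of one factor at a time. *)
rewrite (_ : _ - _ = mul (x' - x) y' + mul x (y' - y)).
  by apply: BD; [apply: BMl => // | apply: BMr => //]; exact: cl_rep.
by rewrite mulBl // mulBr // addrA subrK.
Qed.

Let clP (P : Q -> Prop) : (forall x, Z x -> P (cl x)) -> forall h, P h.
Proof. by move=> h k; rewrite -(clK k); apply: h; exact: Zval. Qed.

Let mulDl x y z : Z x -> Z y -> Z z -> mul (x + y) z = mul x z + mul y z.
Proof.
move=> zx zy zz; have zN := ZN zy.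
have := mulBl zx zN zz; rewrite opprK => ->; congr (_ + _).
by rewrite -[- y]sub0r mulBl // opprB (_ : mul 0 z = 0) ?subr0 // -{1}(subrr y) mulBl // subrr.
Qed.
Let mulDr x y z : Z x -> Z y -> Z z -> mul x (y + z) = mul x y + mul x z.
Proof.
move=> zx zy zz; have zN := ZN zz.
have := mulBr zx zy zN; rewrite opprK => ->; congr (_ + _).
by rewrite -[- z]sub0r mulBr // opprB (_ : mul x 0 = 0) ?subr0 // -{1}(subrr y) mulBr // subrr.
Qed.

(** Associativity and the unit laws hold modulo B, which is how the product of an A-infinity algebra
    behaves on cocycles; the ring axioms then hold strictly on representatives. *)
Lemma quotient_ring : exists (H : pzRingType) (cl : T -> H),
    [/\ forall h, exists2 z, Z z & cl z = h,
        forall z w, Z z -> Z w -> cl (z + w) = cl z + cl w,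
        forall z, Z z -> (cl z = 0 <-> B z) &
        forall z w, Z z -> Z w -> Z (mul z w) /\ cl (mul z w) = cl z * cl w].
Proof.
have addA : associative add.
  elim/clP => x zx; elim/clP => y zy; elim/clP => z zz.
  by rewrite !clD ?addrA //; exact: ZD.
have addC : commutative add.
  by elim/clP => x zx; elim/clP => y zy; rewrite !clD // addrC.
have add0 : left_id (cl 0) add.
  by elim/clP => x zx; rewrite clD // add0r.
have addN : left_inverse (cl 0) opp add.
  by elim/clP => x zx; rewrite clN // clD ?addNr //; exact: ZN.
have qmulA : associative qmul.
  elim/clP => x zx; elim/clP => y zy; elim/clP => z zz.
  rewrite !clM //; try exact: ZM.
  by apply/cl_eq; [exact/ZM/ZM | apply: ZM => //; exact: ZM | exact: mulA].
have qmul1 : left_id (cl one) qmul.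
  by elim/clP => x zx; rewrite clM //; apply/cl_eq => //; [exact: ZM | exact: mul1].
have qmulr1 : right_id (cl one) qmul.
  by elim/clP => x zx; rewrite clM //; apply/cl_eq => //; [exact: ZM | exact: mulr1].
have qmulDl : left_distributive qmul add.
  elim/clP => x zx; elim/clP => y zy; elim/clP => z zz.
  by rewrite clD // !clM // ?clD ?mulDl //; try exact: ZM; exact: ZD.
have qmulDr : right_distributive qmul add.
  elim/clP => x zx; elim/clP => y zy; elim/clP => z zz.
  by rewrite clD // !clM // ?clD ?mulDr //; try exact: ZM; exact: ZD.
pose Hz := HB.pack_for zmodType Q (GRing.isZmodule.Build Q addA addC add0 addN).
pose Hr := HB.pack_for pzRingType Q Hz
  (GRing.Zmodule_isPzRing.Build Hz qmulA qmul1 qmulr1 qmulDl qmulDr).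
exists Hr, cl; split.
- by move=> h; exists (val h); [exact: Zval | exact: clK].
- by move=> z w zz zw; rewrite -clD.
- by move=> z zz; rewrite -[z in B z]subr0; exact: cl_eq.
- by move=> z w zz zw; split; [exact: ZM | rewrite -clM].
Qed.

End QuotientRing.

(** * Cohomology of an A-infinity algebra with bounded grading *)

Section Cohomology.
Context {R : fieldType} {V : lmodType R}.
Variables (gr : int -> set V) (m : seq (int * V) -> V) (N : nat).
Hypothesis mA : Ainfty_algebra gr m.
Hypothesis grN : forall j x, gr j x -> ~~ (0 <= j < N%:Z) -> x = 0.
Implicit Types (f g z w t : int -> V) (j k l : int).

Let zsum (f : int -> V) : V := \sum_(j \in [set: int]) f j.
Let bounded (f : int -> V) := forall j, ~~ (0 <= j < N%:Z) -> f j = 0.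

(** As the grading is bounded, the sum over all integers in [total_m2] becomes an ordinary finite
    sum. *)
Lemma zsum_ord f : bounded f -> zsum f = \sum_(i < N) f i%:Z.
Proof.
move=> fN; rewrite /zsum (fsbigE [seq i%:Z | i <- iota 0 N]) //; first last.
- move=> j _ /mapP jN; apply: fN; apply/negP => /andP[j0 jlt]; apply: jN.
  by exists `|j|%N; [rewrite mem_iota; lia | lia].
- by rewrite map_inj_uniq ?iota_uniq // => x y [].
rewrite (eq_bigl xpredT) => [|j]; last by rewrite in_setT.
by rewrite big_map -[in LHS](subn0 N) big_mkord.
Qed.

Lemma zsum_shift f k : zsum (fun j => f (j - k)) = zsum f.
Proof.
rewrite /zsum [RHS](reindex_fsbigT (fun j : int => j - k)) //.
by exists (fun j : int => j + k) => j; rewrite ?subrK ?addrK.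
Qed.

Lemma zsum1 f k : bounded f -> (forall j, j != k -> f j = 0) -> zsum f = f k.
Proof.
move=> fN fk; rewrite /zsum (fsbigE [:: k]) //; first last.
  by move=> j _; rewrite inE; exact: fk.
by rewrite big_mkcond big_seq1 in_setT.
Qed.

Let gr0 j : gr j 0. Proof. by have [h _ _ _] := mA; case: (h j). Qed.
Let grP j (c : R) x y : gr j x -> gr j y -> gr j (c *: x + y).
Proof. by have [h _ _ _] := mA; case: (h j) => _; exact. Qed.
Let grZ j (c : R) x : gr j x -> gr j (c *: x).
Proof. by move=> gx; rewrite -[c *: x]addr0; exact: grP. Qed.
Let gr_sum j (F : 'I_N -> V) : (forall i, gr j (F i)) -> gr j (\sum_(i < N) F i).
Proof.
by move=> h; elim/big_ind: _ => // x y gx gy; rewrite -[x]scale1r; exact: grP.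
Qed.

Let hom1 j x : gr j x -> homogeneous gr [:: (j, x)].
Proof. by move=> gx y; rewrite inE => /eqP ->. Qed.
Let hom2 j x k y : gr j x -> gr k y -> homogeneous gr [:: (j, x); (k, y)].
Proof. by move=> gx gy u; rewrite !inE => /orP[]/eqP ->. Qed.
Let hom3 j x k y l u : gr j x -> gr k y -> gr l u ->
  homogeneous gr [:: (j, x); (k, y); (l, u)].
Proof. by move=> gx gy gu v; rewrite !inE => /or3P[]/eqP ->. Qed.

Let m1_gr j k x : gr j x -> k = j + 1 -> gr k (m [:: (j, x)]).
Proof.
move=> gx ->; have [_ h _ _] := mA; have := h [:: (j, x)] isT (hom1 gx).
by rewrite degree_cons degree0 /= (_ : j + 0 + 2 - 1%:Z = j + 1) //; ring.
Qed.
Let m2_gr j k l x y : gr j x -> gr k y -> l = j + k ->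
  gr l (m [:: (j, x); (k, y)]).
Proof.
move=> gx gy ->; have [_ h _ _] := mA; have := h [:: (j, x); (k, y)] isT (hom2 gx gy).
by rewrite !degree_cons degree0 /= (_ : _ - 2%:Z = j + k) //; ring.
Qed.
Let m3_gr j k l i x y u : gr j x -> gr k y -> gr l u -> i = j + k + l - 1 ->
  gr i (m [:: (j, x); (k, y); (l, u)]).
Proof.
move=> gx gy gu ->; have [_ h _ _] := mA; have := h [:: (j, x); (k, y); (l, u)] isT (hom3 gx gy gu).
by rewrite !degree_cons degree0 /= (_ : _ - 3%:Z = j + k + l - 1) //; ring.
Qed.

Let homnil : homogeneous gr [::]. Proof. by []. Qed.
Let mP1 j (c : R) x y : gr j x -> gr j y ->
  m [:: (j, c *: x + y)] = c *: m [:: (j, x)] + m [:: (j, y)].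
Proof. by have [_ _ h _] := mA => gx gy; exact: (h [::] [::]). Qed.
Let mP2l j k (c : R) x y u : gr j x -> gr j y -> gr k u ->
  m [:: (j, c *: x + y); (k, u)] = c *: m [:: (j, x); (k, u)] + m [:: (j, y); (k, u)].
Proof.
by have [_ _ h _] := mA => gx gy gu; exact: (h [::] [:: (k, u)] j c x y homnil (hom1 gu)).
Qed.
Let mP2r j k (c : R) x y u : gr j x -> gr j y -> gr k u ->
  m [:: (k, u); (j, c *: x + y)] = c *: m [:: (k, u); (j, x)] + m [:: (k, u); (j, y)].
Proof.
by have [_ _ h _] := mA => gx gy gu; exact: (h [:: (k, u)] [::] j c x y (hom1 gu) homnil).
Qed.

Let m0 j : m [:: (j, 0)] = 0.
Proof. by have := mP1 (-1) (gr0 j) (gr0 j); rewrite !scaleN1r oppr0 addr0 addNr. Qed.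
Let m20l j k u : gr k u -> m [:: (j, 0); (k, u)] = 0.
Proof.
by move=> gu; have := mP2l (-1) (gr0 j) (gr0 j) gu; rewrite !scaleN1r oppr0 addr0 addNr.
Qed.
Let m20r j k u : gr k u -> m [:: (k, u); (j, 0)] = 0.
Proof.
by move=> gu; have := mP2r (-1) (gr0 j) (gr0 j) gu; rewrite !scaleN1r oppr0 addr0 addNr.
Qed.
Let mZ2l j k (c : R) x u : gr j x -> gr k u ->
  m [:: (j, c *: x); (k, u)] = c *: m [:: (j, x); (k, u)].
Proof. by move=> gx gu; rewrite -[c *: x]addr0 mP2l // m20l // addr0. Qed.

Let add_sum j (F : 'I_N -> V) (phi : V -> V) :
  (forall x y, gr j x -> gr j y -> phi (x + y) = phi x + phi y) ->
  phi 0 = 0 -> (forall i, gr j (F i)) ->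
  phi (\sum_(i < N) F i) = \sum_(i < N) phi (F i).
Proof.
move=> phiD phi0 gF.
suff [] : gr j (\sum_(i < N) F i) /\ phi (\sum_(i < N) F i) = \sum_(i < N) phi (F i) by [].
apply: (big_ind2 (fun x y => gr j x /\ phi x = y)) => // x x' y y' [gx <-] [gy <-].
by split; [rewrite -[x]scale1r; exact: grP | exact: phiD].
Qed.

Definition graded z := forall j, gr j (z j).
Let grB z : graded z -> bounded z. Proof. by move=> gz j; exact: grN. Qed.

(** Finite support is automatic for a bounded grading. *)
Lemma gr_totalE : gr_total gr = graded.
Proof.
apply/seteqP; split=> z; [by case | move=> gz; split=> //].
apply: (@sub_finite_set _ _ [set` [seq i%:Z | i <- iota 0 N]]) => // j /= zj.
have : 0 <= j < N%:Z by apply: contraNT zj => jN; apply/eqP/(grB gz jN).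
by move=> jN; apply/mapP; exists `|j|%N; [rewrite mem_iota; lia | lia].
Qed.

Let d z := total_m1 m z.
Let mul z w := total_m2 m z w.

Let d_graded z : graded z -> graded (d z).
Proof. by move=> gz j; apply: m1_gr (gz _) _; rewrite subrK. Qed.

Let mul_bounded z w l : graded z -> graded w ->
  bounded (fun j => m [:: (j, z j); (l - j, w (l - j))]).
Proof. by move=> gz gw j jN; rewrite (grB gz jN) m20l. Qed.

Let mulE z w l : graded z -> graded w ->
  mul z w l = \sum_(i < N) m [:: (i%:Z, z i%:Z); (l - i%:Z, w (l - i%:Z))].
Proof. by move=> gz gw; exact: zsum_ord (mul_bounded l gz gw). Qed.

Let mul_zsum z w l : mul z w l = zsum (fun j => m [:: (j, z j); (l - j, w (l - j))]).
Proof. by []. Qed.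

Let mul_graded z w : graded z -> graded w -> graded (mul z w).
Proof.
move=> gz gw l; rewrite mulE //; apply: gr_sum => i.
by apply: m2_gr (gz _) (gw _) _; rewrite addrC subrK.
Qed.

Let gradedP (c : R) z w : graded z -> graded w -> graded (c *: z + w).
Proof. by move=> gz gw j; exact: grP. Qed.
Let dP (c : R) z w : graded z -> graded w -> d (c *: z + w) = c *: d z + d w.
Proof. by move=> gz gw; apply/funext => j; exact: mP1. Qed.
Let mulPl (c : R) z w t : graded z -> graded w -> graded t ->
  mul (c *: z + w) t = c *: mul z t + mul w t.
Proof.
move=> gz gw gt; apply/funext => l.
rewrite [LHS]mulE //; last exact: gradedP.
rewrite [RHS](_ : _ = c *: mul z t l + mul w t l) // !mulE // scaler_sumr -big_split.
by apply: eq_bigr => i _; exact: mP2l.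
Qed.
Let mulPr (c : R) z w t : graded z -> graded w -> graded t ->
  mul t (c *: z + w) = c *: mul t z + mul t w.
Proof.
move=> gz gw gt; apply/funext => l.
rewrite [LHS]mulE //; last exact: gradedP.
rewrite [RHS](_ : _ = c *: mul t z l + mul t w l) // !mulE // scaler_sumr -big_split.
by apply: eq_bigr => i _; exact: mP2r.
Qed.

Let dd z : graded z -> d (d z) = 0.
Proof.
move=> gz; apply/funext => j; have [_ _ _ h] := mA.
have := h [:: (j - 1 - 1, z (j - 1 - 1))] isT (hom1 (gz _)).
by rewrite stasheff_1 /= subrK.
Qed.

Let leibniz_at j k x y : gr j x -> gr k y ->
  m [:: (j + k, m [:: (j, x); (k, y)])] =
    m [:: (j + 1, m [:: (j, x)]); (k, y)] +
    ((-1) ^ j : R) *: m [:: (j, x); (k + 1, m [:: (k, y)])].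
Proof.
move=> gx gy; have [_ _ _ h] := mA.
have := h [:: (j, x); (k, y)] isT (hom2 gx gy); rewrite stasheff_2 /= => E.
by apply/eqP; rewrite -subr_eq0 opprD addrA; apply/eqP; rewrite -[RHS]E; congr (_ - _); exact: addrC.
Qed.

(** On cocycles the terms of the third Stasheff relation with an inner m_1 drop out, and m_3 bounds
    the associator. *)
Let assoc_at j k l x y u : gr j x -> gr k y -> gr l u ->
  m [:: (j, x)] = 0 -> m [:: (k, y)] = 0 -> m [:: (l, u)] = 0 ->
  m [:: (j, x); (k + l, m [:: (k, y); (l, u)])]
  - m [:: (j + k, m [:: (j, x); (k, y)]); (l, u)] =
  m [:: (j + k + l - 1, m [:: (j, x); (k, y); (l, u)])].
Proof.
move=> gx gy gu dx dy du; have [_ _ hm h] := mA.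
have := h [:: (j, x); (k, y); (l, u)] isT (hom3 gx gy gu).
rewrite stasheff_3 /= dx dy du.
have z1 := hm [::] [:: (k, y); (l, u)] (j + 1) (-1) 0 0 homnil (hom2 gy gu) (gr0 _) (gr0 _).
have z2 := hm [:: (j, x)] [:: (l, u)] (k + 1) (-1) 0 0 (hom1 gx) (hom1 gu) (gr0 _) (gr0 _).
have z3 := hm [:: (j, x); (k, y)] [::] (l + 1) (-1) 0 0 (hom2 gx gy) homnil (gr0 _) (gr0 _).
rewrite !scaleN1r oppr0 addr0 !addNr /= in z1 z2 z3.
rewrite z1 z2 z3 !scaler0 addr0 add0r add0r => E.
by rewrite -[LHS]addr0 -E; ZmodTac.zmodu.
Qed.

Let cocycleP z : cocycle gr m z <-> graded z /\ d z = 0.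
Proof. by rewrite /cocycle /= gr_totalE. Qed.
Let coboundaryP z : coboundary gr m z <-> exists2 y, graded y & d y = z.
Proof. by rewrite /coboundary gr_totalE. Qed.
Let cocycle_at z j : d z = 0 -> m [:: (j, z j)] = 0.
Proof. by move=> /(congr1 (fun f => f (j + 1))); rewrite /d /total_m1 addrK. Qed.

Let bcob z : coboundary gr m z -> cocycle gr m z.
Proof. by move=> /coboundaryP[y gy <-]; apply/cocycleP; split; [exact: d_graded | exact: dd]. Qed.

(* The Leibniz rule, with the sign absorbed in [z]. *)
Let leibniz z w : graded z -> graded w ->
  d (mul z w) = mul (d z) w + mul (fun j => ((-1) ^ j : R) *: z j) (d w).
Proof.
move=> gz gw; have gz' : graded (fun j => ((-1) ^ j : R) *: z j) by move=> j; exact: grZ.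
have [gdz gdw] := (d_graded gz, d_graded gw).
apply/funext => l.
rewrite [RHS](_ : _ = mul (d z) w l + mul (fun j => ((-1) ^ j : R) *: z j) (d w) l) //.
(* The entry of [d z] in degree j comes from z (j - 1); shifting the index makes z i appear on both
   sides. *)
rewrite [mul (d z) w l](mul_zsum _ _ l) -(zsum_shift _ (- 1)) zsum_ord; last first.
  by move=> j jN; rewrite opprK /d /total_m1 addrK (grB gz jN) m0 m20l.
rewrite [mul _ (d w) l]mulE // -big_split.
rewrite [LHS]/total_m1 [mul z w _]mulE // (add_sum (j := l - 1) (phi := fun v => m [:: (l - 1, v)])).
- apply: eq_bigr => i _ /=.
  rewrite (_ : l - 1 - i%:Z = l - i%:Z - 1); last by ring.
  rewrite {1}(_ : l - 1 = i%:Z + (l - i%:Z - 1)); last by ring.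
  rewrite leibniz_at // subrK opprK; congr (_ + _).
    rewrite /d /total_m1 addrK (_ : l - (i%:Z + 1) = l - i%:Z - 1) //; ring.
  by rewrite mZ2l.
- by move=> x y gx gy; have := mP1 1 gx gy; rewrite !scale1r.
- exact: m0.
- by move=> i; apply: m2_gr (gz _) (gw _) _; ring.
Qed.

(** The twist is a scalar in each degree, so it preserves cocycles. *)
Let sgz z : graded z -> d z = 0 -> graded (fun j => ((-1) ^ j : R) *: z j) /\
  d (fun j => ((-1) ^ j : R) *: z j) = 0.
Proof.
move=> gz dz; split=> [j|]; first exact: grZ.
apply/funext => j; rewrite /d /total_m1.
by rewrite -[_ *: _]addr0 mP1 // m0 addr0 cocycle_at // scaler0.
Qed.
Let mul0z z : graded z -> mul 0 z = 0.
Proof.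
by move=> gz; have := mulPl (-1) (gr0 : graded 0) (gr0 : graded 0) gz; rewrite !scaleN1r oppr0 addr0 addNr.
Qed.
Let mulz0 z : graded z -> mul z 0 = 0.
Proof.
by move=> gz; have := mulPr (-1) (gr0 : graded 0) (gr0 : graded 0) gz; rewrite !scaleN1r oppr0 addr0 addNr.
Qed.

Let cocycle_mul z w : cocycle gr m z -> cocycle gr m w -> cocycle gr m (mul z w).
Proof.
move=> /cocycleP[gz dz] /cocycleP[gw dw]; apply/cocycleP; split; first exact: mul_graded.
by rewrite leibniz // dz dw mul0z // mulz0 ?addr0 //; case: (sgz gz dz).
Qed.

Let coboundary_mull z w : coboundary gr m z -> cocycle gr m w -> coboundary gr m (mul z w).
Proof.
move=> /coboundaryP[y gy <-] /cocycleP[gw dw]; apply/coboundaryP.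
exists (mul y w); first exact: mul_graded.
by rewrite leibniz // dw mulz0 ?addr0 // => j; exact: grZ.
Qed.

Let coboundary_mulr z w : cocycle gr m z -> coboundary gr m w -> coboundary gr m (mul z w).
Proof.
move=> /cocycleP[gz dz] /coboundaryP[y gy <-]; apply/coboundaryP.
have [gz' dz'] := sgz gz dz.
(* Twisting the witness beforehand cancels the sign of the Leibniz rule. *)
exists (mul (fun j => ((-1) ^ j : R) *: z j) y); first exact: mul_graded.
rewrite leibniz // dz' mul0z // add0r; congr mul; apply/funext => j.
by rewrite scalerA -exprMz_comm ?unitrN1 // mulrNN mulr1 exp1rz scale1r.
Qed.

Let mulA z w t : cocycle gr m z -> cocycle gr m w -> cocycle gr m t ->
  coboundary gr m (mul z (mul w t) - mul (mul z w) t).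
Proof.
move=> /cocycleP[gz dz] /cocycleP[gw dw] /cocycleP[gt dt]; apply/coboundaryP.
(* m_3 has degree -1, so the component in degree l collects the triples of total degree l + 1. *)
exists (fun l => \sum_(i < N) \sum_(j < N)
  m [:: (i%:Z, z i%:Z); (j%:Z, w j%:Z); (l + 1 - i%:Z - j%:Z, t (l + 1 - i%:Z - j%:Z))]).
  by move=> l; apply: gr_sum => i; apply: gr_sum => j; apply: m3_gr => //; ring.
apply/funext => l; apply: esym.
rewrite [LHS](_ : _ = mul z (mul w t) l - mul (mul z w) t l) //.
have [gzw gwt] := (mul_graded gz gw, mul_graded gw gt).
rewrite !mulE //.
(* Both bracketings are brought to one double sum over the degrees of z and w. *)
transitivity (\sum_(i < N) \sum_(j < N)
  (m [:: (i%:Z, z i%:Z); (l - i%:Z, m [:: (j%:Z, w j%:Z); (l - i%:Z - j%:Z, t (l - i%:Z - j%:Z))])]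
  - m [:: (i%:Z + j%:Z, m [:: (i%:Z, z i%:Z); (j%:Z, w j%:Z)]); (l - i%:Z - j%:Z, t (l - i%:Z - j%:Z))])).
  under [RHS]eq_bigr => i _ do rewrite sumrB.
  rewrite sumrB; congr (_ - _).
    apply: eq_bigr => i _; rewrite mulE //.
    rewrite (add_sum (j := l - i%:Z) (phi := fun v => m [:: (i%:Z, z i%:Z); (l - i%:Z, v)])) //.
    - by move=> x y gx gy; have := mP2r 1 gx gy (gz i%:Z); rewrite !scale1r.
    - exact: m20r.
    - by move=> j; apply: m2_gr => //; ring.
  transitivity (\sum_(k < N) \sum_(i < N)
    m [:: (k%:Z, m [:: (i%:Z, z i%:Z); (k%:Z - i%:Z, w (k%:Z - i%:Z))]); (l - k%:Z, t (l - k%:Z))]).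
    apply: eq_bigr => k _; rewrite mulE //.
    rewrite (add_sum (j := k%:Z) (phi := fun v => m [:: (k%:Z, v); (l - k%:Z, t (l - k%:Z))])) //.
    - by move=> x y gx gy; have := mP2l 1 gx gy (gt (l - k%:Z)); rewrite !scale1r.
    - exact: m20l.
    - by move=> j; apply: m2_gr => //; ring.
  rewrite exchange_big /=; apply: eq_bigr => i _.
  (* In the left bracketing the summation index is the degree k of the product of z and w;
     substituting k = i + j turns it into the degree j of w. *)
  pose f k := m [:: (k, m [:: (i%:Z, z i%:Z); (k - i%:Z, w (k - i%:Z))]); (l - k, t (l - k))].
  rewrite -[LHS]/(\sum_(k < N) f k%:Z) -zsum_ord => [|k kN]; last first.
    rewrite /f (_ : m [:: _; (k - _, _)] = 0) ?m20l //.
    by apply: grN kN; apply: m2_gr => //; ring.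
  rewrite -(zsum_shift _ (- i%:Z)) zsum_ord => [|j jN]; last first.
    by rewrite /f opprK addrK (grB gw jN) m20r // m20l.
  apply: eq_bigr => j _; rewrite /f opprK addrK.
  by rewrite (_ : l - (j%:Z + i%:Z) = l - i%:Z - j%:Z) ?[j%:Z + _]addrC //; ring.
rewrite [RHS]/d /total_m1 (add_sum (j := l - 1) (phi := fun v => m [:: (l - 1, v)])).
- apply: eq_bigr => i _; rewrite (add_sum (j := l - 1) (phi := fun v => m [:: (l - 1, v)])).
  + apply: eq_bigr => j _; rewrite subrK.
    have := assoc_at (gz i%:Z) (gw j%:Z) (gt (l - i%:Z - j%:Z)) (cocycle_at _ dz) (cocycle_at _ dw) (cocycle_at _ dt).
    rewrite (_ : j%:Z + _ = l - i%:Z); last by ring.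
    by rewrite (_ : i%:Z + j%:Z + _ - 1 = l - 1) //; ring.
  + by move=> x y gx gy; have := mP1 1 gx gy; rewrite !scale1r.
  + exact: m0.
  + by move=> j; apply: m3_gr => //; ring.
- by move=> x y gx gy; have := mP1 1 gx gy; rewrite !scale1r.
- exact: m0.
- by move=> i; apply: gr_sum => j; apply: m3_gr => //; ring.
Qed.

Variable u : V.
Hypotheses (gru : gr 0 u) (m1u : m [:: (0, u)] = 0).
Hypothesis mu : forall j x, gr j x ->
  m [:: (0, u); (j, x)] = x /\ m [:: (j, x); (0, u)] = x.

Let one : int -> V := fun j => if j == 0 then u else 0.
Let gone : graded one.
Proof. by move=> j; rewrite /one; case: eqP => [->|]. Qed.
Let cocycle_one : cocycle gr m one.
Proof.
apply/cocycleP; split=> //; apply/funext => j; rewrite /d /total_m1 /one.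
by case: eqP => [->|_]; [rewrite m1u | rewrite m0].
Qed.
Let mul1 z : graded z -> mul one z = z.
Proof.
move=> gz; apply/funext => l; rewrite mul_zsum [LHS](zsum1 (k := 0)).
- by rewrite /one eqxx subr0; case: (mu (gz l)).
- exact: mul_bounded.
- by move=> j /negbTE j0; rewrite /one j0 m20l.
Qed.
Let mulz1 z : graded z -> mul z one = z.
Proof.
move=> gz; apply/funext => l; rewrite mul_zsum [LHS](zsum1 (k := l)).
- by rewrite /one subrr eqxx; case: (mu (gz l)).
- exact: mul_bounded.
- by move=> j jl; rewrite /one subr_eq0 eq_sym (negbTE jl) m20r.
Qed.

Theorem Ainfty_cohomology_is_ring : cohomology_is_ring gr m.
Proof.
split; first exact: bcob.
have sub z w : z - w = (-1 : R) *: w + z by rewrite scaleN1r addrC.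
have d0 : d 0 = 0 by apply/funext => j; exact: m0.
apply: (quotient_ring (mul := mul) (one := one)) => //.
- by apply/cocycleP.
- move=> z w /cocycleP[gz dz] /cocycleP[gw dw]; apply/cocycleP.
  by rewrite sub; split; [exact: gradedP | rewrite dP // dz dw scaler0 addr0].
- by apply/coboundaryP; exists 0.
- move=> z w /coboundaryP[z' gz <-] /coboundaryP[w' gw <-]; apply/coboundaryP.
  by exists (-1 *: w' + z'); [exact: gradedP | rewrite dP // -sub].
- by move=> z w t /cocycleP[gz _] /cocycleP[gw _] /cocycleP[gt _]; rewrite !sub mulPl.
- by move=> z w t /cocycleP[gz _] /cocycleP[gw _] /cocycleP[gt _]; rewrite !sub mulPr.
- by move=> z /cocycleP[gz _]; rewrite mul1 // subrr; apply/coboundaryP; exists 0.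
- by move=> z /cocycleP[gz _]; rewrite mulz1 // subrr; apply/coboundaryP; exists 0.
Qed.

End Cohomology.

(** * The unit of F_p *)

Section Unit.
Context {R : realType} {n : nat} {M : manifold R n.*2} (omega : chart_family M).
Hypothesis homega : symplectic omega.
Variable p : nat.
Hypothesis hp : (p <= n)%N.
Implicit Types (x y z : form M) (u v w : form M * form M) (D : int).
Local Notation P := (fproj homega p).
Local Notation W := (fpow homega p.+1).
Local Notation H := (fneg homega p.+1).
Local Notation d := (@fextd R n.*2 M).
Local Notation K := (kerP H W).
Local Notation M1 := (cone_m1 d H W).
Local Notation M2 := (cone_m2 (@fwedge R n.*2 M) d H W).
Local Notation good := (good homega p).
Local Notation emb := (emb homega p).
Local Notation G := (cone_mixed (@fwedge R n.*2 M) d H).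

Let one : form M := mkform (is_form_dform dform_one).
Let fdeg_one : fdeg 0 one. Proof. exact: dform_one. Qed.
Let mul1 x : fwedge one x = x.
Proof. by apply: form_inj; exact: wedge1 (is_form_sfam (form_is x)). Qed.
Let mulx1 x : fwedge x one = x.
Proof. by apply: form_inj; exact: wedge_one (is_form_sfam (form_is x)). Qed.
Let d_one : d one = 0.
Proof. by apply: form_inj; rewrite fval0; exact: extd_one. Qed.
(** H would send 1 to a negative degree, so W H contributes nothing. *)
Let proj_one : P one = one.
Proof.
rewrite -cokP_proj /cokP (fdeg_eq0 (fdeg_neg homega p.+1 fdeg_one)) ?fpow0 ?subr0 //.
Qed.
(** Being fixed by the projection means that W H x = 0, and H W H = H. *)
Let neg_proj x : P x = x -> H x = 0.
Proof.
move=> Px; rewrite -fneg_pow_neg.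
have -> : W (H x) = 0 by rewrite fpow_neg Px subrr.
by rewrite fneg0.
Qed.
Let ker_neg x : K (H x) = 0.
Proof. by rewrite /kerP fneg_pow_neg subrr. Qed.

Let U : form M * form M := (one, 0).

Let good_proj D v : good D v -> P v.1 = v.1.
Proof.
have [hD|hD] := lerP D (n + p)%N%:Z; first by rewrite good_unbarred // => -[].
by rewrite good_barred // => -[-> _ _]; rewrite fproj0.
Qed.

Let good_unit : good 0 U.
Proof. by rewrite good_unbarred. Qed.

Let M1_unit : M1 U = 0.
Proof.
rewrite /cone_m1 -[U.1]/one -[U.2]/(0 : form M) d_one cokP_proj fproj0.
by rewrite fneg0 fextd0 kerP0 subr0 oppr0.
Qed.

(** The constant 1 is a strict unit: the only term of [cone_mixed] that survives is H (d x), which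
    [kerP] kills. *)
Let M2_unitl a D v : good D v -> a = false -> M2 a U v = v.
Proof.
move=> /good_proj Pv ->; rewrite /cone_m2 -[U.1]/one -[U.2]/(0 : form M) !mul1 fwedge0l.
rewrite cokP_proj Pv addr0 expr0 scale1r /cone_mixed !mul1 d_one fneg0 fwedge0l neg_proj //.
rewrite fextd0 oppr0 !add0r expr0 scale1r ker_neg add0r.
by case: v {Pv}.
Qed.

Let M2_unitr a D v : good D v -> M2 a v U = v.
Proof.
move=> /good_proj Pv; rewrite /cone_m2 -[U.1]/one -[U.2]/(0 : form M) !mulx1 fwedge0r.
rewrite cokP_proj Pv scaler0 addr0 /cone_mixed !mulx1 d_one fneg0 fwedge0r neg_proj //.
rewrite fextd0 oppr0 scaler0 addr0 !add0r ker_neg add0r.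
by case: v {Pv}.
Qed.

Lemma Fp_cohomology_is_ring : cohomology_is_ring (Fp omega p) (Fp_m omega p).
Proof.
(* The degrees of F_p run from 0 to 2n + 2p + 1, whence the bound 2n + 2p + 2. *)
apply: (@Ainfty_cohomology_is_ring _ _ _ _ (2 * n + 2 * p + 2)%N
  (Fp_Ainfty homega hp) _ (emb 0 U)).
- move=> D A; rewrite /Fp; case: ifP => [|_]; first by lia.
  by case: ifP => [|_ ->//]; lia.
- exact: good_Fp.
- by have [_ ->] := Fp_m1E hp good_unit erefl; rewrite M1_unit emb0.
- move=> D A /(Fp_good homega)[v gv ->]; split.
  + have [|_ ->] := Fp_m2E (D'' := D) hp good_unit gv; first by rewrite add0r.
    by rewrite (M2_unitl gv).
  + have [|_ ->] := Fp_m2E (D'' := D) hp gv good_unit; first by rewrite addr0.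
    by rewrite (M2_unitr _ gv).
Qed.

End Unit.

Theorem mainTheorem5 (R : realType) (n p : nat) (M : manifold R n.*2)
    (omega : chart_family M) (homega : symplectic omega) (hp : (p <= n)%N) :
  Ainfty_algebra (Fp omega p) (Fp_m omega p) /\
  cohomology_is_ring (Fp omega p) (Fp_m omega p).
Proof. by split; [exact: Fp_Ainfty | exact: Fp_cohomology_is_ring]. Qed.
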